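(* Let $(\Omega,\mathcal F,(\mathcal F_t)_{t\ge0},\mathbb P)$ be a filtered probability space satisfying the usual conditions, $B$ an $(\mathcal F_t)$-adapted $d$-dimensional Brownian motion started at $0$, and let $\mathbf I=\{1,\dots,m\}$. For each $i\in\mathbf I$ let $\phi_i:\mathbb R\to(-\infty,+\infty]$ be convex and lower semicontinuous with $\phi_i=+\infty$ on $(-\infty,0)$ and $\phi_i$ of class $C^1$ on $(0,\infty)$; let $n_i$ be pairwise distinct unit vectors of $\mathbb R^d$ and $a_i\in\mathbb R$. Set $\Phi(x)=\sum_{i}\phi_i(x\cdot n_i-a_i)$, $D=\{x: x\cdot n_i>a_i\ \forall i\}$, assumed nonempty. Let $(X,L)$ be the solution of the multivalued SDE associated with $\Phi$ (see context) with $\mathcal F_0$-measurable initial condition $X_0\in\overline D$. For $i\in\mathbf I$ let $H_i=\{x: x\cdot n_i=a_i\}$, $K_i=\{x: x\cdot n_i=a_i,\ x\cdot n_j>a_j\ \forall j\ne i\}$, $\sigma_i=\inf\{t>0:X_t\in H_i\}$, $\tau_i=\inf\{t>0:X_t\in K_i\}$, and $p_i(x)=\int_1^x\exp\{2(\phi_i(u)-\phi_i(1))\}\,du$ for $x\ge0$. If $i\in\mathbf I$ satisfies $p_i(0)=-\infty$, equivalently $\int_{0+}\exp\{2\phi_i(u)\}\,du=\infty$, then $\mathbb P(\sigma_i=\infty)=\mathbb P(\tau_i=\infty)=1$.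
   Context: A unit vector $n(x)$ is a unit inward normal to $D$ at $x\in\partial D$ if $n(x)\cdot(x-z)\le0$ for all $z\in\overline D$. The solution of the multivalued SDE associated with $\Phi$ (which exists and is unique) is the pair consisting of a continuous $(\mathcal F_t)$-adapted $\overline D$-valued process $X$ and a continuous $(\mathcal F_t)$-adapted nondecreasing process $L$ such that for all $t\ge0$: $X_t=X_0+B_t-\int_0^t\nabla\Phi(X_s)\,ds+\int_0^t n_s\,dL_s$ and $L_t=\int_0^t\mathbf 1_{\{X_s\in\partial D\}}dL_s$, where $n_s$ is $dL_s$-a.e. a unit inward normal to $D$ at $X_s$; here $\nabla\Phi(x)=\sum_i n_i\phi_i'(x\cdot n_i-a_i)$ on $D$. *)

(* Defs.v *)
From HB Require Import structures.
From mathcomp Require Import all_boot all_order all_algebra.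
From mathcomp Require Import all_classical all_reals all_analysis.
Set Implicit Arguments. Unset Strict Implicit. Unset Printing Implicit Defensive.
Import Order.TTheory GRing.Theory Num.Theory.
Import numFieldNormedType.Exports.
Local Open Scope classical_set_scope.
Local Open Scope ring_scope.

Section Defs.
Context {R : realType}.

Definition dotv (d : nat) (x y : 'rV[R]_d) : R := \sum_(j < d) x ord0 j * y ord0 j.

(* closure of D = {x | x.n_i > a_i forall i} (D nonempty, convex) *)
Definition Dopen (d m : nat) (n : 'I_m -> 'rV[R]_d) (a : 'I_m -> R) : set 'rV[R]_d :=
  [set x | forall i, a i < dotv x (n i)].
Definition Dbar (d m : nat) (n : 'I_m -> 'rV[R]_d) (a : 'I_m -> R) : set 'rV[R]_d :=
  [set x | forall i, a i <= dotv x (n i)].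
Definition Dbound (d m : nat) (n : 'I_m -> 'rV[R]_d) (a : 'I_m -> R) : set 'rV[R]_d :=
  Dbar n a `\` Dopen n a.

Definition unit_inward_normal (d m : nat) (n : 'I_m -> 'rV[R]_d) (a : 'I_m -> R)
  (v x : 'rV[R]_d) : Prop :=
  dotv v v = 1 /\ forall z, Dbar n a z -> dotv v (x - z) <= 0.

Definition Hplane (d m : nat) (n : 'I_m -> 'rV[R]_d) (a : 'I_m -> R) (i : 'I_m)
  : set 'rV[R]_d := [set x | dotv x (n i) = a i].
Definition Kface (d m : nat) (n : 'I_m -> 'rV[R]_d) (a : 'I_m -> R) (i : 'I_m)
  : set 'rV[R]_d :=
  [set x | dotv x (n i) = a i /\ forall j, j != i -> a j < dotv x (n j)].

Definition econvex (f : R -> \bar R) : Prop :=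
  (forall x, f x != -oo%E) /\
  forall (x y l : R), (0 <= l <= 1)%R ->
    (f (l * x + (1 - l) * y)%R <= l%:E * f x + (1 - l)%R%:E * f y)%E.
Definition elsc (f : R -> \bar R) : Prop :=
  forall x (r : R), (r%:E < f x)%E -> \forall y \near x, (r%:E < f y)%E.

Definition fin_part (f : R -> \bar R) : R -> R := fun u => fine (f u).

(* nabla Phi(x) = sum_i n_i phi_i'(x.n_i - a_i)  (meaningful on D) *)
Definition gradPhi (d m : nat) (phi : 'I_m -> R -> \bar R) (n : 'I_m -> 'rV[R]_d)
  (a : 'I_m -> R) (x : 'rV[R]_d) : 'rV[R]_d :=
  \sum_(i < m) (derive1 (fin_part (phi i)) (dotv x (n i) - a i)) *: n i.

(* Lebesgue--Stieltjes measure dL of a function L (used only for L continuous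
   nondecreasing); zero measure otherwise *)
Definition stieltjes_cum (L : R -> R) : cumulative R R :=
  match pselect (nondecreasing L /\ right_continuous L) with
  | left h => HB.pack L (isCumulative.Build R _ R L (proj1 h) (proj2 h))
  | right _ => HB.pack (fun _ : R => 0 : R)
      (isCumulative.Build R _ R (fun _ : R => 0 : R)
         (fun x y _ => lexx (0 : R)) (fun x => cvg_cst (0 : R)))
  end.

Definition stieltjes (L : R -> R) : set (measurableTypeR R) -> \bar R :=
  lebesgue_stieltjes_measure (stieltjes_cum L).
HB.instance Definition _ (L : R -> R) := Measure.on (stieltjes L).

Definition usual_filtration {dO} {Omega : measurableType dO}
  (P : probability Omega R) (F : R -> set (set Omega)) : Prop :=
  (forall t, 0 <= t -> sigma_algebra setT (F t)) /\
  (forall t, 0 <= t -> F t `<=` measurable) /\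
  (forall s t, 0 <= s <= t -> F s `<=` F t) /\
  (forall t, 0 <= t -> F t = [set A | forall s, t < s -> F s A]) /\
  (forall N, P.-negligible N -> F 0 N).

Definition adapted {dO} {Omega : measurableType dO} (F : R -> set (set Omega))
  (Y : R -> Omega -> R) : Prop :=
  forall t, 0 <= t -> forall A : set R, measurable A -> F t (Y t @^-1` A).

Definition adaptedv {dO} {Omega : measurableType dO} (d : nat)
  (F : R -> set (set Omega)) (Y : R -> Omega -> 'rV[R]_d) : Prop :=
  forall j : 'I_d, adapted F (fun t w => Y t w ord0 j).

(* d-dimensional (F_t)-Brownian motion started at 0: a.s. continuous paths,
   B_0 = 0, adapted, and for 0 <= s < t the increment B_t - B_s is independent
   of F_s with law N(0,(t-s) I_d) -- expressed through the characteristic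
   function of the increment restricted to events A of F_s. *)
Definition brownian {dO} {Omega : measurableType dO} (d : nat)
  (P : probability Omega R) (F : R -> set (set Omega))
  (B : R -> Omega -> 'rV[R]_d) : Prop :=
  {ae P, forall w, B 0 w = 0 /\ {in `[0, +oo[, continuous (fun t => B t w)}} /\
  adaptedv F B /\
  forall s t, 0 <= s -> s < t -> forall A, F s A -> forall u : 'rV[R]_d,
    (\int[P]_(w in A) (cos (dotv u (B t w - B s w)))%:E
       = P A * (expR (- ((t - s) * dotv u u) / 2))%:E)%E /\
    (\int[P]_(w in A) (sin (dotv u (B t w - B s w)))%:E = 0)%E.

Definition msde_solution {dO} {Omega : measurableType dO} (d m : nat)
  (P : probability Omega R) (F : R -> set (set Omega))
  (B : R -> Omega -> 'rV[R]_d)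
  (phi : 'I_m -> R -> \bar R) (n : 'I_m -> 'rV[R]_d) (a : 'I_m -> R)
  (X : R -> Omega -> 'rV[R]_d) (L : R -> Omega -> R) : Prop :=
  adaptedv F X /\ adapted F L /\
  {ae P, forall w,
    {in `[0, +oo[, continuous (fun t => X t w)} /\
    {in `[0, +oo[, continuous (fun t => L t w)} /\
    {in `[0, +oo[ &, {homo (fun t => L t w) : s t / s <= t}} /\
    (forall t, 0 <= t -> Dbar n a (X t w)) /\
    exists nv : R -> 'rV[R]_d,
      {ae stieltjes (fun t => L (Num.max t 0)%R w), forall s, 0 <= s ->
         unit_inward_normal n a (nv s) (X s w)} /\
      forall t, 0 <= t ->
        ((L t w)%:E = \int[stieltjes (fun t => L (Num.max t 0)%R w)]_(s in `[0%R, t])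
              (\1_(Dbound n a) (X s w))%:E)%E /\
        forall j : 'I_d,
          lebesgue_measure.-integrable `[0%R, t]
             (fun s => (gradPhi phi n a (X s w) ord0 j)%:E) /\
          (stieltjes (fun t => L (Num.max t 0)%R w)).-integrable `[0%R, t]
             (fun s => (nv s ord0 j)%:E) /\
          X t w ord0 j = X 0 w ord0 j + B t w ord0 j
            - (\int[lebesgue_measure]_(s in `[0%R, t]) gradPhi phi n a (X s w) ord0 j)
            + (\int[stieltjes (fun t => L (Num.max t 0)%R w)]_(s in `[0%R, t])
                   nv s ord0 j)}.

End Defs.

(* Main.v *)
(* Suppose that X hits H_i at a time t > 0, let S be the set of the faces containing
   X_t, let q be the dimension of the span of the normals n_k, k in S, and let Z be the
   squared distance of X to the intersection of the hyperplanes H_k, k in S.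

   If Z vanishes at all rational times shortly before t, then n_i.X is constant on an
   interval, on which n_i.B therefore has bounded variation; this is a null event.

   Otherwise Z reaches 0 from a positive value while X stays away from the faces outside
   S. There the reflection is orthogonal to the gradient of Z, and the derivatives
   phi_k' are bounded above, being monotone. Let w(y) = exp(2 phi_i(y) + C y) if
   S = {i}, and w(y) = exp(C y) / y if S has several elements, in which case q >= 2.
   Put V(z) = int_(sqrt z)^1 w. For large C, V(Z) is a local supermartingale, and
   V(0+) = oo, by hypothesis in the first case. Hence Z does not reach 0.

   No stochastic integral is needed: along a fine grid, the increments of V(Z) are
   dominated, up to small errors, by bounded martingale differences built from the sines
   of the Brownian increments, whose conditional moments are read off the
   characteristic function. *)
Require Import Defs.
From HB Require Import structures.
From mathcomp Require Import all_boot all_order all_algebra.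
From mathcomp Require Import all_classical all_reals all_analysis.
From mathcomp Require Import ring lra measurable_realfun.
Set Implicit Arguments. Unset Strict Implicit. Unset Printing Implicit Defensive.
Import Order.TTheory GRing.Theory Num.Theory.
Import numFieldNormedType.Exports.
Local Open Scope classical_set_scope.
Local Open Scope ring_scope.

(** * Expectations against a factor of the past *)

(** Let [p] be the projection of [X - x0] on the span of the active normals and [y] its length. Up
    to a factor 2 in [V], the generator applied to [V(Z)] is [-(w/y) * (q - 1 + y * w'/w - 2 *
    p.gradPhi)], so a weight is admissible as soon as [2 * p.gradPhi <= q - 1 + y * w'/w]. For an
    active face [k], [p.n_k] is the distance to that face, hence nonnegative; this is why upper
    bounds on [phi_k'] suffice although [phi_k'] may tend to [-oo]. If [S = {i}], then [y] is the
    distance to the face, and [y * w'/w] contains [2 * y * phi_i'(y)], which cancels the singular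
    term exactly. If [q >= 2], the weight [exp(C y) / y] leaves [q - 2 + C * y], which dominates
    [2 * p.gradPhi] for large [C]. The bounded variation part is controlled only path by path, with
    no moments and no uniformity, so the mesh required depends on the path. Probabilities are
    therefore estimated on each fixed grid, and the hitting event is covered by the lower limit of
    the grid events. *)

Section BoundedExpectation.
Context {R : realType} {dO : measure_display} {Omega : measurableType dO}
  (P : probability Omega R).
Implicit Types (G H : Omega -> R).

(** All expectations below are of bounded functions, so integrability reduces to this predicate. *)
Definition bddmeas G := measurable_fun setT G /\ exists C : R, forall w, `|G w| <= C.

Lemma bddmeas_integrable G : bddmeas G -> P.-integrable setT (EFin \o G).
Proof.
move=> [mG [C GC]]; apply: measurable_bounded_integrable => //.
- by apply: le_lt_trans (probability_le1 P measurableT) _; rewrite ltry.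
- exists C; split; first exact: num_real.
  by move=> x Cx w _; apply: le_trans (GC w) (ltW Cx).
Qed.

Definition esp G : R := \int[P]_w G w.

Lemma espD G H : bddmeas G -> bddmeas H ->
  esp (fun w => G w + H w) = esp G + esp H.
Proof. by move=> bG bH; apply: RintegralD => //; exact: bddmeas_integrable. Qed.

Lemma espB G H : bddmeas G -> bddmeas H ->
  esp (fun w => G w - H w) = esp G - esp H.
Proof. by move=> bG bH; apply: RintegralB => //; exact: bddmeas_integrable. Qed.

Lemma espZ (c : R) G : bddmeas G -> esp (fun w => c * G w) = c * esp G.
Proof. by move=> bG; apply: RintegralZl => //; exact: bddmeas_integrable. Qed.

Lemma le_esp G H : bddmeas G -> bddmeas H -> (forall w, G w <= H w) ->
  esp G <= esp H.
Proof.
by move=> bG bH GH; apply: le_Rintegral => //; exact: bddmeas_integrable.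
Qed.

Lemma esp_cst (c : R) : esp (fun _ => c) = c.
Proof.
rewrite /esp Rintegral_cst//.
by have /(congr1 fine)/= -> := @probability_setT _ _ _ P; rewrite mulr1.
Qed.

Lemma bddmeas_cst (c : R) : bddmeas (fun _ => c).
Proof. by split => //; exists `|c|. Qed.

Lemma bddmeasD G H : bddmeas G -> bddmeas H -> bddmeas (fun w => G w + H w).
Proof.
move=> [mG [C GC]] [mH [D HD]]; split; first exact: measurable_funD.
exists (C + D) => w; apply: le_trans (ler_normD _ _) _; exact: lerD.
Qed.

Lemma bddmeasM G H : bddmeas G -> bddmeas H -> bddmeas (fun w => G w * H w).
Proof.
move=> [mG [C GC]] [mH [D HD]]; split; first exact: measurable_funM.
by exists (C * D) => w; rewrite normrM; exact: ler_pM.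
Qed.

Lemma bddmeasB G H : bddmeas G -> bddmeas H -> bddmeas (fun w => G w - H w).
Proof.
move=> bG bH; have := bddmeasD bG (bddmeasM (bddmeas_cst (-1)) bH).
by congr bddmeas; apply/funext => w; rewrite mulN1r.
Qed.

Lemma bddmeas_sum (I : Type) (r : seq I) (G : I -> Omega -> R) :
  (forall i, bddmeas (G i)) -> bddmeas (fun w => \sum_(i <- r) G i w).
Proof.
move=> bG; elim: r => [|i r IH].
  have := bddmeas_cst 0; congr bddmeas; apply/funext => w; by rewrite big_nil.
have := bddmeasD (bG i) IH.
by congr bddmeas; apply/funext => w; rewrite big_cons.
Qed.

Lemma esp_sum (I : Type) (r : seq I) (G : I -> Omega -> R) :
  (forall i, bddmeas (G i)) ->
  esp (fun w => \sum_(i <- r) G i w) = \sum_(i <- r) esp (G i).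
Proof.
move=> bG; elim: r => [|i r IH].
  rewrite big_nil -[RHS](esp_cst 0); congr esp.
  by apply/funext => w; rewrite big_nil.
rewrite big_cons -IH -espD//; last exact: bddmeas_sum.
by congr esp; apply/funext => w; rewrite big_cons.
Qed.

Lemma norm_esp_le (C : R) G : bddmeas G -> (forall w, `|G w| <= C) -> `|esp G| <= C.
Proof.
move=> bG GC; rewrite ler_norml -{1}(esp_cst (-C)) -{2}(esp_cst C).
by apply/andP; split; apply: le_esp => //; try exact: bddmeas_cst;
  move=> w; have := GC w; rewrite ler_norml => /andP[].
Qed.

Lemma bddmeas_indic (A : set Omega) : measurable A -> bddmeas \1_A.
Proof.
move=> mA; split; first exact: measurable_indic.
by exists 1 => w; rewrite indicE; case: (_ \in _); rewrite ?normr1 ?normr0.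
Qed.

Lemma esp_indicM (A : set Omega) G : measurable A ->
  esp (fun w => \1_A w * G w) = \int[P]_(w in A) G w.
Proof.
move=> mA; rewrite Rintegral_mkcond; congr esp; apply/funext => w.
by rewrite /patch indicE; case: ifP; rewrite ?mul1r ?mul0r.
Qed.

Lemma esp_indic (A : set Omega) : measurable A -> esp \1_A = fine (P A).
Proof.
move=> mA; rewrite -[LHS]/(\int[P]_w \1_A w).
by rewrite /Rintegral integral_indic// setIT.
Qed.

Definition subsigma (F : set (set Omega)) :=
  sigma_algebra setT F /\ F `<=` measurable.

(** Measurability is taken on the type that carries the sigma-algebra generated by [F], so that the
    closure lemmas for measurable functions apply unchanged. *)
Definition Fmeas dT (T : measurableType dT) (F : set (set Omega)) (G : Omega -> T) :=
  measurable_fun setT (G : g_sigma_algebraType F -> T).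

Lemma FmeasP dT (T : measurableType dT) F (G : Omega -> T) : subsigma F ->
  Fmeas F G <-> (forall A, measurable A -> F (G @^-1` A)).
Proof.
move=> [sF _]; split.
  move=> mG A mA; have := mG measurableT A mA.
  by rewrite setTI /measurable/= sigma_algebra_id.
by move=> h _ A mA; rewrite setTI /measurable/= sigma_algebra_id//; exact: h.
Qed.

Lemma Fmeas_measurable dT (T : measurableType dT) F (G : Omega -> T) :
  subsigma F -> Fmeas F G -> measurable_fun setT G.
Proof.
move=> sF /(FmeasP _ sF) h _ A mA; rewrite setTI; apply: sF.2; exact: h.
Qed.

Lemma FmeasS dT (T : measurableType dT) F F' (G : Omega -> T) :
  subsigma F -> subsigma F' -> F `<=` F' -> Fmeas F G -> Fmeas F' G.
Proof.
move=> sF sF' FF' /(FmeasP _ sF) h; apply/(FmeasP _ sF') => A mA.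
by apply: FF'; exact: h.
Qed.


(** Counting the integers [1, ..., N] that are at most [x] gives the integer part of [x], capped at
    [N]. *)
Lemma layer_sum (N : nat) (x : R) : 0 <= x ->
  let S := \sum_(k < N) ((k.+1%:R <= x)%R : nat)%:R in
  (N%:R <= x -> S = N%:R) /\ (x < N%:R -> S <= x < S + 1).
Proof.
move=> x0; elim: N => [|N [IH1 IH2]] /=.
  by rewrite big_ord0; split=> // /(le_lt_trans x0); rewrite ltxx.
rewrite big_ord_recr/=; split.
  move=> Nx; rewrite Nx IH1; first by rewrite mulr1n -natr1.
  by apply: le_trans Nx; rewrite ler_nat.
move=> xN; rewrite (lt_geF xN) addr0.
have [xN'|Nx] := ltP x N%:R; first exact: IH2.
by rewrite IH1// Nx natr1.
Qed.

Lemma layer_approx (C e : R) (N : nat) (x : R) : 0 <= x <= C ->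
  e = (C + 1) / N.+1%:R ->
  `|x - e * \sum_(k < N.+1) ((e * k.+1%:R <= x)%R : nat)%:R| <= e.
Proof.
move=> /andP[x0 xC] eE; have e0 : 0 < e.
  by rewrite eE divr_gt0// (le_lt_trans (le_trans x0 xC))// ltrDl.
have xe0 : 0 <= x / e by rewrite divr_ge0// ltW.
have [_ /=] := layer_sum N.+1 xe0.
have -> : x / e < N.+1%:R.
  rewrite ltr_pdivrMr// eE mulrC -mulrA mulVf ?pnatr_eq0// mulr1.
  by rewrite (le_lt_trans xC)// ltrDl.
under eq_bigr => k _ do rewrite ler_pdivlMr// mulrC.
move=> /(_ isT)/andP[]; set S := \sum_(_ < _) _.
rewrite ler_pdivlMr// ltr_pdivrMr// => h1 h2.
by rewrite ger0_norm; lra.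
Qed.

(** Layer-cake approximation: up to [e], the shifted factor [G + C] is [e] times a finite sum of
    indicators of its level sets. These belong to [F], so each indicator annihilates [xi]; the error
    is at most [e * D]. *)
Lemma esp_mulF0 F G (xi : Omega -> R) : subsigma F -> Fmeas F G -> bddmeas G ->
  bddmeas xi -> (forall A, F A -> \int[P]_(w in A) xi w = 0) ->
  esp (fun w => G w * xi w) = 0.
Proof.
move=> sF mG bG bxi xi0.
have [_ [C GC]] := bG; have [_ [D xiD]] := bxi.
have GC' w : 0 <= G w + C <= C + C.
  by have := GC w; rewrite ler_norml => /andP[? ?]; apply/andP; split; lra.
have mlev (c : R) : F [set w | c <= G w + C].
  have -> : [set w | c <= G w + C] = G @^-1` `[c - C, +oo[.
    apply/seteqP; split => w /=; rewrite in_itv/= andbT; lra.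
  by have /(FmeasP _ sF) := mG; apply.
have espxi : esp xi = 0.
  apply: (xi0 setT).
  by have [[h0 hC _] _] := sF; have := hC _ h0; rewrite setD0.
suff h N : `|esp (fun w => G w * xi w)| <= (C + C + 1) / N.+1%:R * D.
  apply/eqP; rewrite -normr_eq0 eq_le normr_ge0 andbT; apply/ler_addgt0Pl => r r0.
  rewrite addr0.
  have D0 : 0 <= D by apply: le_trans (xiD point).
  have C0 : 0 <= C by apply: le_trans (GC point).
  apply: le_trans (h (Num.truncn ((C + C + 1) * D / r))) _.
  rewrite mulrAC ler_pdivrMr// -ler_pdivrMl// [X in X <= _]mulrC.
  exact/ltW/truncnS_gt.
set e := _ / _.
pose T w := e * \sum_(k < N.+1) ((e * k.+1%:R <= G w + C)%R : nat)%:R.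
pose A (k : nat) := [set w | e * k.+1%:R <= G w + C].
have TE w : T w = \sum_(k < N.+1) e * \1_(A k) w.
  rewrite /T mulr_sumr; apply: eq_bigr => k _; rewrite indicE; congr (_ * _%:R).
  by congr nat_of_bool; apply/idP/idP; rewrite ?inE.
have bA k : bddmeas \1_(A k) by apply: bddmeas_indic; apply: sF.2; exact: mlev.
have bT : bddmeas T.
  have : bddmeas (fun w => \sum_(k < N.+1) e * \1_(A k) w).
    by apply: bddmeas_sum => k; apply: bddmeasM => //; exact: bddmeas_cst.
  by congr bddmeas; apply/funext => w; rewrite TE.
have bGC : bddmeas (fun w => G w + C) by apply: bddmeasD => //; exact: bddmeas_cst.
have T0 : esp (fun w => T w * xi w) = 0.
  rewrite (_ : (fun w => _) = fun w => \sum_(k < N.+1) e * (\1_(A k) w * xi w)); last first.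
    apply/funext => w; rewrite TE mulr_suml; apply: eq_bigr => k _; by rewrite mulrA.
  rewrite esp_sum; last first.
    by move=> k; apply: bddmeasM; [exact: bddmeas_cst|exact: bddmeasM].
  rewrite big1// => k _; rewrite espZ; last exact: bddmeasM.
  by rewrite esp_indicM ?xi0 ?mulr0//; [|apply: sF.2]; exact: mlev.
(* Adding [C * xi] and subtracting [T * xi] is free, both having expectation 0. *)
have -> : esp (fun w => G w * xi w) = esp (fun w => (G w + C - T w) * xi w).
  rewrite (_ : (fun w => (_ - _) * _) = fun w => G w * xi w + (C * xi w - T w * xi w)); last first.
    by apply/funext => w; ring.
  have bC := bddmeasM (bddmeas_cst C) bxi.
  rewrite espD ?espB ?espZ ?T0 ?espxi//; try exact: bddmeasM; last first.
    by apply: bddmeasB => //; exact: bddmeasM.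
  by rewrite mulr0 subr0 addr0.
apply: norm_esp_le; first by apply: bddmeasM => //; exact: bddmeasB.
move=> w; rewrite normrM ler_pM//; by rewrite ?(layer_approx (GC' w)).
Qed.

Lemma esp_mulF F G (xi : Omega -> R) (c : R) : subsigma F -> Fmeas F G ->
  bddmeas G -> bddmeas xi ->
  (forall A, F A -> (\int[P]_(w in A) (xi w)%:E = P A * c%:E)%E) ->
  esp (fun w => G w * xi w) = c * esp G.
Proof.
move=> sF mG bG bxi xic.
have bc := bddmeas_cst c.
have : esp (fun w => G w * (xi w - c)) = 0.
  apply: (esp_mulF0 sF) => //; first exact: bddmeasB.
  move=> A FA; have mA : measurable A by exact: sF.2.
  have iS H : bddmeas H -> P.-integrable A (EFin \o H).
    by move=> bH; apply: integrableS (bddmeas_integrable bH).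
  rewrite RintegralB//; try exact: iS.
  rewrite Rintegral_cst// /Rintegral xic// fineM//; last exact: fin_num_measure.
  by rewrite [fine (P A) * _]mulrC subrr.
rewrite (_ : (fun w => _) = fun w => G w * xi w - c * G w); last first.
  by apply/funext => w; ring.
rewrite espB ?espZ//; try exact: bddmeasM.
by move/subr0_eq.
Qed.

End BoundedExpectation.

(** * Euclidean geometry and null sets *)

Section DotProduct.
Context {R : realType} {d : nat}.
Implicit Types (x y z : 'rV[R]_d) (c : R).

Lemma dotvC x y : dotv x y = dotv y x.
Proof. by apply: eq_bigr => j _; rewrite mulrC. Qed.

Lemma dotvDl x y z : dotv (x + y) z = dotv x z + dotv y z.
Proof. by rewrite /dotv -big_split/=; apply: eq_bigr => j _; rewrite mxE mulrDl. Qed.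

Lemma dotvZl c x z : dotv (c *: x) z = c * dotv x z.
Proof. by rewrite /dotv mulr_sumr; apply: eq_bigr => j _; rewrite mxE mulrA. Qed.

Lemma dotvNl x z : dotv (- x) z = - dotv x z.
Proof. by rewrite -scaleN1r dotvZl mulN1r. Qed.

Lemma dotvBl x y z : dotv (x - y) z = dotv x z - dotv y z.
Proof. by rewrite dotvDl dotvNl. Qed.

Lemma dotv0l z : dotv 0 z = 0.
Proof. by rewrite -(scale0r 0) dotvZl mul0r. Qed.

Lemma dotvDr x y z : dotv z (x + y) = dotv z x + dotv z y.
Proof. by rewrite !(dotvC z) dotvDl. Qed.

Lemma dotvZr c x z : dotv z (c *: x) = c * dotv z x.
Proof. by rewrite !(dotvC z) dotvZl. Qed.

Lemma dotvNr x z : dotv z (- x) = - dotv z x.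
Proof. by rewrite !(dotvC z) dotvNl. Qed.

Lemma dotvBr x y z : dotv z (x - y) = dotv z x - dotv z y.
Proof. by rewrite dotvDr dotvNr. Qed.

Lemma dotv_suml (I : Type) (r : seq I) (f : I -> 'rV[R]_d) z :
  dotv (\sum_(i <- r) f i) z = \sum_(i <- r) dotv (f i) z.
Proof.
elim: r => [|i r IH]; first by rewrite !big_nil dotv0l.
by rewrite !big_cons dotvDl IH.
Qed.

Lemma dotv_ge0 x : 0 <= dotv x x.
Proof. by apply: sumr_ge0 => j _; rewrite -expr2 sqr_ge0. Qed.

Lemma dotv_eq0 x : dotv x x = 0 -> x = 0.
Proof.
move/eqP; rewrite psumr_eq0; last by move=> j _; rewrite -expr2 sqr_ge0.
move=> /allP h; apply/rowP => j; rewrite mxE; apply/eqP.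
by have := h j (mem_index_enum _); rewrite mulf_eq0 orbb.
Qed.

Lemma dotv_le_sqr x y : dotv x x = 1 -> dotv x y ^+ 2 <= dotv y y.
Proof.
move=> x1; have := dotv_ge0 (y - dotv x y *: x).
rewrite !(dotvBl, dotvBr, dotvZl, dotvZr) x1 (dotvC y x); nra.
Qed.

(** Gram-Schmidt along the list [S]. The last clause says by duality that every [e l] lies in the
    span of the normals; it makes the distance vanish at every point of the intersection of the
    hyperplanes. *)
Lemma orthonormal_basis (m : nat) (n : 'I_m -> 'rV[R]_d) (S : seq 'I_m) :
  exists q (e : 'I_q -> 'rV[R]_d),
  [/\ forall l l', dotv (e l) (e l') = (l == l')%:R,
      forall k w, k \in S ->
        dotv (n k) w = \sum_l dotv (n k) (e l) * dotv (e l) w &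
      forall w, (forall k, k \in S -> dotv (n k) w = 0) ->
        forall l, dotv (e l) w = 0].
Proof.
elim: S => [|k S [q [e [ee ne en]]]].
  by exists 0%N, (fun _ => 0); split; [by case|by []|by move=> w _ []].
pose r := n k - \sum_l dotv (n k) (e l) *: e l.
have re l : dotv r (e l) = 0.
  rewrite dotvBl dotv_suml (bigD1 l)//= dotvZl ee eqxx mulr1.
  by rewrite big1 ?addr0 ?subrr// => l' /negPf h; rewrite dotvZl ee h mulr0.
have nr w : dotv (n k) w = dotv r w + \sum_l dotv (n k) (e l) * dotv (e l) w.
  rewrite dotvBl dotv_suml -[LHS]addr0 -addrA; congr (_ + _).
  rewrite -sumrN -big_split/= big1// => l _.
  by rewrite dotvZl addNr.
(* If the remainder is 0, the new normal already lies in the span and the family is kept. *)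
have [r0|r0] := eqVneq (dotv r r) 0.
  exists q, e; split => //.
    move=> k' w; rewrite inE => /orP[/eqP ->|]; last exact: ne.
    by rewrite nr (dotv_eq0 r0) dotv0l add0r.
  move=> w h l; apply: en => k' k'S; apply: h; by rewrite inE k'S orbT.
pose a := (Num.sqrt (dotv r r))^-1.
have a2 : a * a * dotv r r = 1.
  by rewrite -invfM -expr2 sqr_sqrtr ?dotv_ge0// mulVf.
pose e' l := if unlift ord0 l is Some l' then e l' else a *: r.
have e'0 : e' ord0 = a *: r by rewrite /e' unlift_none.
have e'S l : e' (lift ord0 l) = e l by rewrite /e' liftK.
exists q.+1, e'; split.
- move=> l l'; case: (unliftP ord0 l) => [i ->|->]; case: (unliftP ord0 l') => [i' ->|->].
  + by rewrite !e'S ee (inj_eq lift_inj).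
  + by rewrite e'S e'0 dotvZr dotvC re mulr0.
  + by rewrite e'S e'0 dotvZl re mulr0.
  + by rewrite e'0 dotvZl dotvZr mulrA a2 eqxx.
- move=> k' w; rewrite big_ord_recl e'0.
  under eq_bigr => l _ do rewrite e'S.
  have [->{k'} _|k'k] := eqVneq k' k.
    rewrite nr; congr (_ + _); rewrite nr.
    rewrite (eq_bigr (fun=> 0)) => [|l _]; last by rewrite dotvZr dotvC dotvC (dotvC (e l)) re !mulr0.
    by rewrite big1_eq addr0 dotvZl dotvZr mulrACA mulrA a2 mul1r.
  rewrite inE (negPf k'k)/= => k'S; rewrite dotvZr.
  have -> : dotv (n k') r = 0.
    by rewrite (ne _ _ k'S) big1// => l _; rewrite (dotvC (e l)) re mulr0.
  by rewrite mulr0 mul0r add0r; exact: ne.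
- move=> w h l.
  have eh l' : dotv (e l') w = 0.
    by apply: en => k' k'S; apply: h; rewrite inE k'S orbT.
  case: (unliftP ord0 l) => [i ->|->]; rewrite ?e'S// e'0 dotvZl.
  have := nr w; rewrite h ?inE ?eqxx// big1 ?addr0 => [<-|l' _]; first by rewrite mulr0.
  by rewrite eh mulr0.
Qed.

End DotProduct.

(** * Lower limits of events and negligible sets *)

Section Covers.
Context {R : realType} {dO : measure_display} {Omega : measurableType dO}
  (P : probability Omega R).

Let tails_mono (E : nat -> set Omega) :
  {homo (fun m => \bigcap_(n in [set k | (m <= k)%N]) E n) : m n / (m <= n)%N >-> (m <= n)%O}.
Proof.
move=> m m' mm'; apply/subsetPset => w h k /= k'; apply: h => /=.
exact: leq_trans k'.
Qed.

Let tails_meas (E : nat -> set Omega) m : (forall n, measurable (E n)) ->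
  measurable (\bigcap_(n in [set k | (m <= k)%N]) E n).
Proof. by move=> mE; apply: bigcap_measurable => //; exists m => /=. Qed.

(** Fatou for events: the lower limit of the [E n] is the increasing union of the tail
    intersections, each of probability at most [r]. The index from which a point of [A] stays in the
    [E n] may depend on the point. *)
Lemma liminf_cover (A : set Omega) (E : nat -> set Omega) (n0 : nat) (r : R) :
  (forall n, measurable (E n)) ->
  (forall n, (n0 <= n)%N -> (P (E n) <= r%:E)%E) ->
  (forall w, A w -> \forall n \near \oo, E n w) ->
  exists B, [/\ measurable B, A `<=` B & (P B <= r%:E)%E].
Proof.
move=> mE Er AE.
pose B m := \bigcap_(n in [set k | (m <= k)%N]) E n.
have mB m : measurable (B m) by exact: tails_meas.
exists (\bigcup_m B m); split.
- exact: bigcup_measurable.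
- by move=> w /AE[m _ h]; exists m.
- have := @nondecreasing_cvg_mu _ _ _ P B mB (bigcup_measurable (fun n _ => mB n))
    (@tails_mono E).
  move=> /cvg_lim Bl; rewrite -[P _]Bl//; apply: lime_le.
    apply: ereal_nondecreasing_is_cvgn => m m' mm'; apply: le_measure; rewrite ?inE//.
    exact/subsetPset/tails_mono.
  apply: nearW => m; apply: le_trans (Er (maxn m n0) (leq_maxr _ _)).
  apply: le_measure; rewrite ?inE// => w; apply; exact: leq_maxl.
Qed.

(** Continuity from below along the tail intersections turns an index depending on the point into
    one index valid up to probability [r]. *)
Lemma ae_near_prob (E : nat -> set Omega) (r : R) : 0 < r ->
  (forall n, measurable (E n)) ->
  {ae P, forall w, \forall n \near \oo, E n w} ->
  \forall n \near \oo, (P (~` E n) <= r%:E)%E.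
Proof.
move=> r0 mE [N [mN N0 hN]].
pose B m := \bigcap_(n in [set k | (m <= k)%N]) E n.
have mB m : measurable (B m) by exact: tails_meas.
have mU : measurable (\bigcup_m B m) by exact: bigcup_measurable.
have PU : P (\bigcup_m B m) = 1%E.
  apply/eqP; rewrite eq_le probability_le1//=.
  have <- : P (~` N) = 1%E by rewrite probability_setC// N0 sube0.
  apply: le_measure; rewrite ?inE//; first exact: measurableC.
  move=> w nNw; apply: contrapT => h; apply: nNw; apply: hN => /= -[m _ hm].
  by apply: h; exists m.
have : (P \o B) @ \oo --> 1%:E.
  by rewrite -[X in _ --> X]PU; exact: (nondecreasing_cvg_mu mB mU (@tails_mono E)).
move=> /fine_cvgP[_] /cvgrPdist_le /(_ r r0)[m _ hm].
exists m => // n /= mn.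
apply: (@le_trans _ _ (P (~` B m))).
  apply: le_measure; rewrite ?inE//; try exact: measurableC.
  by apply: subsetC => w; apply.
have := hm m (leqnn m) => /=.
rewrite probability_setC// -{2}(@fineK _ (P (B m))) ?fin_num_measure//.
rewrite -EFinB lee_fin; exact: le_trans (ler_norm _).
Qed.

Lemma negligible_small (A N : set Omega) : P.-negligible N ->
  (forall r : R, 0 < r ->
     exists B, [/\ measurable B, A `\` N `<=` B & (P B <= r%:E)%E]) ->
  P.-negligible A.
Proof.
move=> nN h.
suff : P.-negligible (A `\` N).
  move=> /negligibleU /(_ nN); apply: negligibleS => w Aw.
  by have [Nw|Nw] := pselect (N w); [right|left].
have /choice[B hB] : forall n : nat, exists B,
    [/\ measurable B, A `\` N `<=` B & (P B <= (n.+1%:R^-1 : R)%:E)%E].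
  by move=> n; apply: h; rewrite invr_gt0.
exists (\bigcap_n B n); split.
- by apply: bigcap_measurable => // n _; have [] := hB n.
- apply/eqP; rewrite eq_le measure_ge0 andbT; apply/lee_addgt0Pr => r r0.
  rewrite add0e; have [mB _ Br] := hB (Num.truncn r^-1).
  apply: (@le_trans _ _ (P (B (Num.truncn r^-1)))).
    apply: le_measure; rewrite ?inE//; last by move=> w; apply.
    by apply: bigcap_measurable => // n _; have [] := hB n.
  apply: le_trans Br _; rewrite lee_fin -[leRHS]invrK lef_pV2 ?posrE ?invr_gt0//.
  exact/ltW/truncnS_gt.
- by move=> w Aw n _; have [_ + _] := hB n; apply.
Qed.

End Covers.

(** * Trigonometric moments of Brownian increments *)

Section FmeasOps.
Context {R : realType} {dO : measure_display} {Omega : measurableType dO}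
  (F : set (set Omega)).
Implicit Types (G H : Omega -> R).

Lemma Fmeas_cst (c : R) : Fmeas F (fun _ => c).
Proof. exact: measurable_cst. Qed.

Lemma FmeasD G H : Fmeas F G -> Fmeas F H -> Fmeas F (fun w => G w + H w).
Proof. exact: measurable_funD. Qed.

Lemma FmeasB G H : Fmeas F G -> Fmeas F H -> Fmeas F (fun w => G w - H w).
Proof. exact: measurable_funB. Qed.

Lemma FmeasM G H : Fmeas F G -> Fmeas F H -> Fmeas F (fun w => G w * H w).
Proof. exact: measurable_funM. Qed.

Lemma Fmeas_sum (I : Type) (r : seq I) (G : I -> Omega -> R) :
  (forall i, Fmeas F (G i)) -> Fmeas F (fun w => \sum_(i <- r) G i w).
Proof. by move=> mG; apply: measurable_sum => i; exact: mG. Qed.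

Lemma Fmeas_continuous (f : R -> R) G : continuous f -> Fmeas F G ->
  Fmeas F (fun w => f (G w)).
Proof. by move=> /continuous_measurable_fun mf; exact: measurableT_comp. Qed.

Lemma Fmeas_le G H : Fmeas F G -> Fmeas F H -> Fmeas F (fun w => G w <= H w).
Proof. exact: measurable_fun_ler. Qed.

Lemma Fmeas_lt G H : Fmeas F G -> Fmeas F H -> Fmeas F (fun w => G w < H w).
Proof. exact: measurable_fun_ltr. Qed.

Lemma Fmeas_and (a b : Omega -> bool) : Fmeas F a -> Fmeas F b ->
  Fmeas F (fun w => a w && b w).
Proof. exact: measurable_and. Qed.

Lemma Fmeas_all (I : Type) (r : seq I) (a : I -> Omega -> bool) :
  (forall i, Fmeas F (a i)) -> Fmeas F (fun w => all (a ^~ w) r).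
Proof.
move=> ma; elim: r => [|i r IH]/=; first exact: measurable_cst.
exact: Fmeas_and.
Qed.

Lemma Fmeas_if (a : Omega -> bool) G H : Fmeas F a -> Fmeas F G -> Fmeas F H ->
  Fmeas F (fun w => if a w then G w else H w).
Proof. by move=> ma mG mH; exact: (measurable_fun_ifT ma mG mH). Qed.

Lemma Fmeas_dotv d (u : 'rV[R]_d) (X : Omega -> 'rV[R]_d) :
  (forall j, Fmeas F (fun w => X w ord0 j)) -> Fmeas F (fun w => dotv u (X w)).
Proof. by move=> mX; apply: Fmeas_sum => j; apply: FmeasM => //; exact: Fmeas_cst. Qed.

End FmeasOps.

Section Filtration.
Context {R : realType} {dO : measure_display} {Omega : measurableType dO}
  (P : probability Omega R) (F : R -> set (set Omega)).
Hypothesis uF : usual_filtration P F.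

Lemma filtration_subsigma t : 0 <= t -> subsigma (F t).
Proof. by move=> t0; have [sF [mF _]] := uF; split; [exact: sF|exact: mF]. Qed.

Lemma filtration_mono dT (T : measurableType dT) s t (G : Omega -> T) :
  0 <= s -> s <= t -> Fmeas (F s) G -> Fmeas (F t) G.
Proof.
move=> s0 st; apply: FmeasS; try exact: filtration_subsigma.
  by apply: filtration_subsigma; exact: le_trans st.
by have [_ [_ [h _]]] := uF; apply: h; rewrite s0.
Qed.

Lemma adapted_Fmeas (Y : R -> Omega -> R) t : adapted F Y -> 0 <= t ->
  Fmeas (F t) (Y t).
Proof.
by move=> aY t0; apply/(FmeasP _ (filtration_subsigma t0)) => A; exact: aY.
Qed.

Lemma Fmeas_bddmeas t (G : Omega -> R) (C : R) : 0 <= t -> Fmeas (F t) G ->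
  (forall w, `|G w| <= C) -> bddmeas G.
Proof.
move=> t0 mG GC; split; last by exists C.
exact: Fmeas_measurable (filtration_subsigma t0) mG.
Qed.

Context {d : nat} (B : R -> Omega -> 'rV[R]_d).
Hypothesis bB : brownian P F B.

Lemma brownian_Fmeas t u : 0 <= t -> Fmeas (F t) (fun w => dotv u (B t w)).
Proof.
move=> t0; apply: Fmeas_dotv => j; have [_ [aB _]] := bB.
exact: (adapted_Fmeas (aB j)).
Qed.

Lemma brownian_incr_Fmeas s t u : 0 <= s -> s <= t ->
  Fmeas (F t) (fun w => dotv u (B t w - B s w)).
Proof.
move=> s0 st.
have := FmeasB (brownian_Fmeas u (le_trans s0 st))
  (filtration_mono s0 st (brownian_Fmeas u s0)).
by congr Fmeas; apply/funext => w; rewrite dotvBr.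
Qed.

Lemma norm_sin_le1 (x : R) : `|sin x| <= 1.
Proof. by rewrite ler_norml sin_geN1 sin_le1. Qed.

Lemma norm_cos_le1 (x : R) : `|cos x| <= 1.
Proof. by rewrite ler_norml cos_geN1 cos_le1. Qed.

Lemma bddmeas_trig s t u : 0 <= s -> s <= t ->
  bddmeas (fun w => sin (dotv u (B t w - B s w))) /\
  bddmeas (fun w => cos (dotv u (B t w - B s w))).
Proof.
move=> s0 st; have mB := brownian_incr_Fmeas u s0 st; have t0 := le_trans s0 st.
split; apply: (Fmeas_bddmeas t0 (C := 1)).
- by apply: Fmeas_continuous mB; exact: continuous_sin.
- by move=> w; exact: norm_sin_le1.
- by apply: Fmeas_continuous mB; exact: continuous_cos.
- by move=> w; exact: norm_cos_le1.
Qed.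

Section Increment.
Context (s t : R) (G : Omega -> R).
Hypothesis s0 : 0 <= s.
Hypothesis st : s < t.
Hypothesis mG : Fmeas (F s) G.
Hypothesis bG : bddmeas G.

Lemma brownian_sin u : esp P (fun w => G w * sin (dotv u (B t w - B s w))) = 0.
Proof.
rewrite (@esp_mulF _ _ _ P (F s) _ _ 0) ?mul0r//.
- exact: filtration_subsigma.
- exact: (bddmeas_trig u s0 (ltW st)).1.
- move=> A FA; have [_ [_ h]] := bB.
  by have [_ ->] := h _ _ s0 st A FA u; rewrite mule0.
Qed.

Lemma brownian_cos u : esp P (fun w => G w * cos (dotv u (B t w - B s w))) =
  expR (- ((t - s) * dotv u u) / 2) * esp P G.
Proof.
apply: (@esp_mulF _ _ _ P (F s)) => //.
- exact: filtration_subsigma.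
- exact: (bddmeas_trig u s0 (ltW st)).2.
- move=> A FA; have [_ [_ h]] := bB.
  by have [-> _] := h _ _ s0 st A FA u.
Qed.

(* The second moment of the sine of a centred Gaussian variable of variance [h]. *)
Definition kappa (h : R) : R := (1 - expR (- (2 * h))) / 2.

(** The product-to-sum formula leaves the cosines of the increments along [e l - e l'] and
    [e l + e l']. For [l != l'] both vectors have squared length 2 and the terms cancel; for
    [l = l'] the squared lengths are 0 and 4. *)
Lemma brownian_sinsin q (e : 'I_q -> 'rV[R]_d) l l' :
  (forall l l', dotv (e l) (e l') = (l == l')%:R) ->
  esp P (fun w => G w * (sin (dotv (e l) (B t w - B s w)) *
                         sin (dotv (e l') (B t w - B s w)))) =
  (l == l')%:R * kappa (t - s) * esp P G.
Proof.
move=> ee.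
have bc u := (bddmeas_trig u s0 (ltW st)).2.
have bGc u := bddmeasM bG (bc u).
rewrite (_ : (fun w => _) = fun w => 2^-1 *
  (G w * cos (dotv (e l - e l') (B t w - B s w)) -
   G w * cos (dotv (e l + e l') (B t w - B s w)))); last first.
  apply/funext => w; by rewrite dotvBl dotvDl cosB cosD; field.
rewrite espZ ?espB//; last exact: bddmeasB.
rewrite !brownian_cos !(dotvBl, dotvBr, dotvDl, dotvDr) !ee !eqxx (eq_sym l').
have [_|_] := eqVneq l l'; rewrite ?mulr1n ?mulr0n /kappa.
  rewrite (_ : - ((t - s) * _) / 2 = 0); last by field.
  rewrite (_ : - ((t - s) * _) / 2 = - (2 * (t - s))); last by field.
  by rewrite expR0; field.
by rewrite !subr0 !addr0 sub0r opprK add0r; field.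
Qed.

Lemma brownian_cos2 u (c : R) : dotv u u = 1 ->
  esp P (fun w => G w * cos (c * dotv u (B t w - B s w)) ^+ 2) =
  (1 + expR (- (2 * c ^+ 2 * (t - s)))) / 2 * esp P G.
Proof.
move=> u1.
have bGc u' := bddmeasM bG (bddmeas_trig u' s0 (ltW st)).2.
rewrite (_ : (fun w => _) = fun w => 2^-1 *
  (G w + G w * cos (dotv ((c + c) *: u) (B t w - B s w)))); last first.
  apply/funext => w; rewrite dotvZl mulrDl cosD -!expr2 sin2cos2; by field.
rewrite espZ ?espD//; last exact: bddmeasD.
rewrite brownian_cos dotvZl dotvZr u1 mulr1.
rewrite (_ : - ((t - s) * _) / 2 = - (2 * c ^+ 2 * (t - s))); last by field.
by field.
Qed.

End Increment.
End Filtration.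

(** * Infinite variation of Brownian paths *)

Section RealAnalysis.
Context {R : realType}.

(** Heine's theorem with only [x] confined to the segment: [y] may leave it, since [f] is continuous
    from both sides at the end points. *)
Lemma segment_unif_cont (f : R -> R) (s t e : R) :
  (forall x, s <= x <= t -> {for x, continuous f}) -> 0 < e ->
  exists2 r, 0 < r & forall x y, s <= x <= t -> `|x - y| < r ->
    `|f x - f y| < e.
Proof.
move=> cf e0.
pose Q (r x : R) := forall y, `|x - y| < r -> `|f x - f y| < e.
have : \forall r \near 0^'+, `[s, t]%classic `<=` Q r.
  apply: (compact_near_coveringP _).1; first exact: segment_compact.
  move=> x; rewrite /= in_itv/= => xst.
  have e20 : 0 < e / 2 by rewrite divr_gt0.
  have /cvgrPdist_lt/(_ _ e20) := cf x xst.
  rewrite near_nbhs/= => /nbhs_ballP[r /= r0 hr].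
  have r20 : 0 < r / 2 by rewrite divr_gt0.
  exists (ball x (r / 2), [set r' | r' < r / 2]); first split => /=.
  - exact: nbhsx_ballx.
  - exact: nbhs_right_lt.
  - move=> [x' r'] [/= xx' r'r] y x'y.
    have h1 : `|f x - f x'| < e / 2.
      by apply: hr; apply: lt_trans xx' _; rewrite ltr_pdivrMr// ltr_pMr// ltr1n.
    have h2 : `|f x - f y| < e / 2.
      apply: hr; rewrite /ball/= -(subrKA x').
      by apply: le_lt_trans (ler_normD _ _) _; move: xx' x'y r'r; rewrite /ball/=; lra.
    rewrite -(subrKA (f x)); apply: le_lt_trans (ler_normD _ _) _.
    by rewrite (distrC (f x')); lra.
move=> h.
have : \forall r \near 0^'+, 0 < r /\ `[s, t]%classic `<=` Q r.
  by near=> r; split; [near: r; exact: nbhs_right_gt|near: r].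
move=> /filter_ex[r [r0 hr]]; exists r => // x y xst; apply: hr.
by rewrite /= in_itv.
Unshelve. all: by end_near. Qed.

Lemma MVT0 (f df : R -> R) (x : R) : (forall y : R, is_derive y 1 f (df y)) ->
  exists2 c, `|c| <= `|x| & f x - f 0 = df c * x.
Proof.
move=> fdf.
have cf : continuous f by move=> y; have [dfy _] := fdf y; exact/differentiable_continuous/derivable1_diffP.
have [x0|x0] := leP 0 x.
  have [|c] := @MVT_segment R f df 0 x x0 (fun y _ => fdf y).
    exact: continuous_subspaceT.
  rewrite in_itv/= subr0 => /andP[c0 cx] ->; exists c => //.
  by rewrite !ger0_norm.
have [|c] := @MVT_segment R f df x 0 (ltW x0) (fun y _ => fdf y).
  exact: continuous_subspaceT.
rewrite in_itv/= => /andP[xc c0] h; exists c; last by lra.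
by rewrite !ler0_norm ?lerN2// ltW.
Qed.

Lemma norm_sin_le (x : R) : `|sin x| <= `|x|.
Proof.
have [c _] := @MVT0 sin cos x (fun y => is_derive_sin y).
rewrite sin0 subr0 => ->; rewrite normrM ler_piMl//; exact: cos_max.
Qed.

Lemma cos_ge (x : R) : 1 - x ^+ 2 / 2 <= cos x.
Proof.
have -> : cos x = 1 - 2 * sin (x / 2) ^+ 2.
  have -> : cos x = cos (x / 2 + x / 2) by congr cos; field.
  by rewrite cosD -!expr2 cos2sin2; field.
have := norm_sin_le (x / 2).
rewrite -ler_sqr ?nnegrE// !real_normK ?num_real//; nra.
Qed.

Lemma sin_dist (x : R) : `|x - sin x| <= `|x| ^+ 3.
Proof.
have [c cx] := @MVT0 sin cos x (fun y => is_derive_sin y).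
rewrite sin0 subr0 => ->.
have -> : x - cos c * x = (1 - cos c) * x by ring.
rewrite normrM exprSr ler_pM//.
rewrite ger0_norm ?subr_ge0 ?cos_le1//.
have cx2 : c ^+ 2 <= x ^+ 2.
  by rewrite -[leLHS]real_normK ?num_real// -[leRHS]real_normK ?num_real// ler_sqr ?nnegrE.
have := cos_ge c; have := sqr_ge0 c; rewrite real_normK ?num_real//; lra.
Qed.

Lemma norm_le_sin (x : R) : `|x| <= 1 / 2 -> `|x| <= 2 * `|sin x|.
Proof.
move=> x1; have h := sin_dist x.
have : `|x| <= `|x - sin x| + `|sin x|.
  by apply: le_trans (ler_normD _ _); rewrite subrK.
have : `|x| ^+ 3 <= `|x| / 4.
  rewrite exprSr mulrC ler_wpM2l//.
  have -> : 4^-1 = (1 / 2) ^+ 2 :> R by field.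
  by rewrite ler_sqr ?nnegrE.
have := normr_ge0 x; lra.
Qed.

(** The Weierstrass product inequality; the bounds on the partial product are carried along because
    the induction multiplies by it. *)
Lemma prod_ge_sum (N : nat) (b : nat -> R) : (forall k, 0 <= b k <= 1) ->
  0 <= \prod_(k < N) b k <= 1 /\ 1 - \sum_(k < N) (1 - b k) <= \prod_(k < N) b k.
Proof.
move=> b01; elim: N => [|N [IH0 IH]]; first by rewrite !big_ord0; split; lra.
by rewrite !big_ord_recr/=; have := b01 N; split; nra.
Qed.

Lemma cos_sqr_le1 (x : R) : 0 <= cos x ^+ 2 <= 1.
Proof. by rewrite sqr_ge0 cos2sin2 gerBl sqr_ge0. Qed.

Definition grid (s t : R) (n k : nat) : R := s + (t - s) * (k%:R / n.+1%:R).

Lemma grid0 s t n : grid s t n 0 = s.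
Proof. by rewrite /grid mul0r mulr0 addr0. Qed.

Lemma gridn s t n : grid s t n n.+1 = t.
Proof. by rewrite /grid divff ?pnatr_eq0// mulr1 addrC subrK. Qed.

Lemma gridS s t n k : grid s t n k.+1 - grid s t n k = (t - s) / n.+1%:R.
Proof. by rewrite /grid -(natr1 k); ring. Qed.

Lemma grid_lt s t n k : s < t -> grid s t n k < grid s t n k.+1.
Proof. by move=> st; rewrite -subr_gt0 gridS divr_gt0// subr_gt0. Qed.

Lemma grid_bounds s t n k : s < t -> (k <= n.+1)%N -> s <= grid s t n k <= t.
Proof.
move=> st kn; rewrite /grid.
have h0 : 0 <= k%:R / n.+1%:R :> R by rewrite divr_ge0.
have h1 : k%:R / n.+1%:R <= 1 :> R by rewrite ler_pdivrMr// mul1r ler_nat.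
move: h0 h1; set x := _ / _ => h0 h1; apply/andP; split; nra.
Qed.

Lemma grid_mesh (s t r : R) : 0 < r ->
  \forall n \near \oo, (t - s) / n.+1%:R < r.
Proof.
move=> r0; exists (Num.truncn ((t - s) / r)) => // n /= hn.
rewrite ltr_pdivrMr// mulrC -ltr_pdivrMr//.
by apply: lt_le_trans (truncnS_gt _) _; rewrite ler_nat ltnS.
Qed.

End RealAnalysis.

Section InfiniteVariation.
Context {R : realType} {dO : measure_display} {Omega : measurableType dO}
  (P : probability Omega R) (F : R -> set (set Omega)) (d : nat)
  (B : R -> Omega -> 'rV[R]_d) (s t : R) (u : 'rV[R]_d).
Hypothesis uF : usual_filtration P F.
Hypothesis bB : brownian P F B.
Hypothesis s0 : 0 <= s.
Hypothesis st : s < t.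
Hypothesis u1 : dotv u u = 1.

Let D n k w : R := dotv u (B (grid s t n k.+1) w - B (grid s t n k) w).

Let grid0le n k : (k <= n.+1)%N -> 0 <= grid s t n k.
Proof. by move=> /(grid_bounds st)/andP[h _]; exact: le_trans h. Qed.

Let Pi c n j w : R := \prod_(k < j) cos (c * D n k w) ^+ 2.

Let Pi01 c n j w : 0 <= Pi c n j w <= 1.
Proof.
apply: (prod_ge_sum j (b := fun k => cos (c * D n k w) ^+ 2) _).1 => k.
exact: cos_sqr_le1.
Qed.

Let Pi_meas c n j : (j <= n.+1)%N -> Fmeas (F (grid s t n j)) (Pi c n j).
Proof.
elim: j => [|j IH] jn.
  have := @Fmeas_cst R _ _ (F (grid s t n 0)) 1.
  by congr Fmeas; apply/funext => w; rewrite /Pi big_ord0.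
have jn' := ltnW jn; have lt := grid_lt n j st.
rewrite (_ : Pi c n j.+1 = fun w => Pi c n j w * cos (c * D n j w) ^+ 2); last first.
  by apply/funext => w; rewrite /Pi big_ord_recr.
apply: FmeasM; first exact (filtration_mono uF (grid0le jn') (ltW lt) (IH jn')).
apply: (Fmeas_continuous (f := fun x => cos (c * x) ^+ 2)).
  move=> x; rewrite /continuous_at; under eq_fun do rewrite expr2.
  rewrite expr2; have cc : {for x, continuous (fun x => cos (c * x))}; last exact: continuousM.
  apply: continuous_comp; last exact: continuous_cos.
  by apply: continuousM; [exact: cst_continuous|exact: cvg_id].
exact (brownian_incr_Fmeas uF bB u (grid0le jn') (ltW lt)).
Qed.

Let Pi_bdd c n j : (j <= n.+1)%N -> bddmeas (Pi c n j).
Proof.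
move=> jn; apply: (Fmeas_bddmeas uF (grid0le jn) (C := 1)); first exact: Pi_meas.
by move=> w; rewrite ger0_norm; case/andP: (Pi01 c n j w).
Qed.

Let esp_Pi c n j : (j <= n.+1)%N -> esp P (Pi c n j) =
  ((1 + expR (- (2 * c ^+ 2 * ((t - s) / n.+1%:R)))) / 2) ^+ j.
Proof.
elim: j => [|j IH] jn.
  rewrite expr0 -[RHS](esp_cst P); congr esp.
  by apply/funext => w; rewrite /Pi big_ord0.
have jn' := ltnW jn.
rewrite (_ : Pi c n j.+1 = fun w => Pi c n j w * cos (c * D n j w) ^+ 2); last first.
  by apply/funext => w; rewrite /Pi big_ord_recr.
rewrite (brownian_cos2 uF bB (grid0le jn') (grid_lt n j st) (Pi_meas c jn') (Pi_bdd c jn'))//.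
by rewrite gridS (IH jn') [RHS]exprS.
Qed.

(* The squared cosines of the increments multiply to a small expectation, whereas
   on a path of vanishing quadratic variation their product tends to 1. *)
Lemma brownian_infinite_variation (A N : set Omega) : P.-negligible N ->
  (forall w, A w -> ~ N w ->
    (fun n => \sum_(k < n.+1)
      dotv u (B (grid s t n k.+1) w - B (grid s t n k) w) ^+ 2) @ \oo --> (0 : R)) ->
  P.-negligible A.
Proof.
move=> nN hA; apply: (negligible_small nN) => r r0.
(* [c] is a frequency: by Markov's inequality the mean of the product of squared cosines will give
   the bound [2 * exp(- c^2 (t - s) / 2)] on every fine grid. *)
have [c c0 hc] : exists2 c : R, 0 < c & 2 * expR (- (c ^+ 2 * (t - s) / 2)) <= r.
  have ts : 0 < t - s by rewrite subr_gt0.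
  pose a := (2 / r + 1) * (2 / (t - s)) + 1.
  have r20 : 0 < 2 / r by rewrite divr_gt0.
  have ts2 : 0 < 2 / (t - s) by rewrite divr_gt0.
  have a0 : 1 <= a by rewrite /a; nra.
  exists a; first by lra.
  rewrite expRN ler_pdivrMr ?expR_gt0// -ler_pdivrMl// mulrC.
  apply: le_trans (expR_ge1Dx _).
  have : 2 / r <= a * ((t - s) / 2).
    have -> : a * ((t - s) / 2) = 2 / r + 1 + (t - s) / 2.
      by rewrite /a; field; rewrite !gt_eqF.
    lra.
  have := sqr_ge0 (a - 1); have : a <= a ^+ 2 by rewrite expr2; nra.
  by move=> h1 h2 h3; nra.
pose E n := [set w | 1 / 2 <= Pi c n n.+1 w].
have mE n : measurable (E n).
  have -> : E n = Pi c n n.+1 @^-1` `[1 / 2, +oo[.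
    by apply/seteqP; split => w /=; rewrite in_itv/= andbT.
  rewrite -[X in measurable X]setTI.
  exact: ((Pi_bdd c (leqnn n.+1)).1 measurableT).
(* From this index on [x = 2 c^2 h] is at most 1, where [(1 + exp(-x)) / 2 <= 1 - x / 4 <= exp(- x /
   4)]; the [n.+1] factors then multiply to at most [exp(- c^2 (t - s) / 2)]. *)
have [n0 _ hn0] : \forall n \near \oo, (t - s) / n.+1%:R < 1 / (2 * c ^+ 2).
  by apply: grid_mesh; rewrite divr_gt0// mulr_gt0// exprn_gt0.
apply: (@liminf_cover _ _ _ _ _ E n0) => //.
  move=> n nn0.
  rewrite -[X in (X <= _)%E]fineK ?fin_num_measure// lee_fin -esp_indic//.
  apply: le_trans hc.
  set h := (t - s) / n.+1%:R.
  have h0 : 0 < h by rewrite divr_gt0// subr_gt0.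
  have c2 : 0 < 2 * c ^+ 2 by rewrite mulr_gt0// exprn_gt0.
  have hx : 2 * c ^+ 2 * h <= 1.
    by have := hn0 n nn0; rewrite ltr_pdivlMr// mulrC => /ltW.
  apply: (@le_trans _ _ (esp P (fun w => 2 * Pi c n n.+1 w))).
    apply: le_esp; first exact: bddmeas_indic.
      by apply: bddmeasM; [exact: bddmeas_cst|exact: Pi_bdd].
    move=> w; rewrite indicE; case: (boolP (w \in E n)) => [|_].
      by rewrite inE /E/=; lra.
    by have /andP[? _] := Pi01 c n n.+1 w; rewrite mulr_ge0.
  rewrite espZ; last exact: Pi_bdd.
  rewrite esp_Pi// ler_wpM2l//.
  have -> : - (c ^+ 2 * (t - s) / 2) = - (2 * c ^+ 2 * h / 4) *+ n.+1.
    rewrite -mulr_natr /h; field.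
    by rewrite nat1r pnatr_eq0.
  rewrite -[X in _ <= expR X]mulr_natr expRM_natr; apply: lerXn2r; rewrite ?nnegrE ?expR_ge0//.
  apply: le_trans (expR_ge1Dx _).
  have : expR (- (2 * c ^+ 2 * h)) <= 1 - 2 * c ^+ 2 * h / 2.
    rewrite expRN invf_ple ?posrE ?expR_gt0//; last by lra.
    have x0 : 0 < 2 * c ^+ 2 * h by rewrite mulr_gt0.
    apply: le_trans (expR_ge1Dx _).
    rewrite -[X in X <= _]mul1r ler_pdivrMr; last by lra.
    nra.
  lra.
(* On a path of [A] the sum of squares is eventually below [1 / (2 c^2)], so that the product
   inequality leaves at least 1/2. *)
move=> w [Aw Nw].
have h20 : 0 < 1 / (2 * c ^+ 2) by rewrite divr_gt0// mulr_gt0// exprn_gt0.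
have /cvgrPdist_lt/(_ _ h20) := hA w Aw Nw.
apply: filterS => n; rewrite sub0r normrN => hS.
rewrite /E/=.
apply: le_trans (prod_ge_sum n.+1 (b := fun k => cos (c * D n k w) ^+ 2) _).2; last first.
  by move=> k; exact: cos_sqr_le1.
have : \sum_(k < n.+1) (1 - cos (c * D n k w) ^+ 2) <=
   c ^+ 2 * \sum_(k < n.+1) D n k w ^+ 2.
  rewrite mulr_sumr; apply: ler_sum => k _; rewrite -sin2cos2 -exprMn.
  by rewrite -[leLHS]real_normK ?num_real// -[leRHS]real_normK ?num_real// ler_sqr ?nnegrE// norm_sin_le.
have := ler_norm (\sum_(k < n.+1) D n k w ^+ 2).
move: hS; rewrite /D ltr_pdivlMr; last by rewrite mulr_gt0// exprn_gt0.
have := exprn_gt0 2 c0.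
nra.
Qed.

End InfiniteVariation.

(** * Pathwise consequences of the equation *)

Section RealIntegrable.
Context {R : realType} {dT : measure_display} {T : measurableType dT}
  (mu : {measure set T -> \bar R}) (D : set T).
Hypothesis mD : measurable D.
Implicit Types f g : T -> R.

Definition rintegrable f := mu.-integrable D (EFin \o f).

Lemma rintegrableD f g : rintegrable f -> rintegrable g ->
  rintegrable (fun x => f x + g x).
Proof. by move=> rf rg; have := integrableD mD rf rg. Qed.

Lemma rintegrableZ (k : R) f : rintegrable f -> rintegrable (fun x => k * f x).
Proof. by move=> rf; have := integrableZl mD k rf. Qed.

Lemma rintegrable_sum (I : Type) (r : seq I) (f : I -> T -> R) :
  (forall i, rintegrable (f i)) -> rintegrable (fun x => \sum_(i <- r) f i x).
Proof.
move=> rf; have := @integrable_sum _ _ _ mu D mD _ r xpredT (fun i => EFin \o f i)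
  (fun i _ => rf i).
by congr (mu.-integrable D _); apply/funext => x /=; rewrite sumEFin.
Qed.

Lemma Rintegral_sum (I : Type) (r : seq I) (f : I -> T -> R) :
  (forall i, rintegrable (f i)) ->
  \int[mu]_(x in D) (\sum_(i <- r) f i x) = \sum_(i <- r) \int[mu]_(x in D) f i x.
Proof.
move=> rf; elim: r => [|i r IH].
  rewrite big_nil; under eq_Rintegral do rewrite big_nil.
  by rewrite Rintegral_cst// mul0r.
rewrite big_cons -IH -RintegralD//; [|exact: rf|exact: rintegrable_sum].
by apply: eq_Rintegral => x _; rewrite big_cons.
Qed.

(** The difference agrees almost everywhere with its absolute value, whose integral is
    nonnegative. *)
Lemma le_Rintegral_ae f g : rintegrable f -> rintegrable g ->
  {ae mu, forall x, D x -> f x <= g x} ->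
  \int[mu]_(x in D) f x <= \int[mu]_(x in D) g x.
Proof.
move=> rf rg fg; rewrite -subr_ge0 -RintegralB//.
have rh : rintegrable (fun x => g x - f x).
  have := rintegrableD rg (rintegrableZ (-1) rf).
  by congr rintegrable; apply/funext => x; rewrite mulN1r.
rewrite /Rintegral (@ae_eq_integral _ _ _ mu D (fun x => `|g x - f x|%:E))//.
- by apply: fine_ge0; apply: integral_ge0 => x _; rewrite lee_fin.
- exact: measurable_int rh.
- exact: measurable_int (integrable_norm rh).
- apply: filterS fg => x h Dx; rewrite ger0_norm// subr_ge0; exact: h.
Qed.

End RealIntegrable.

Lemma Rintegral_cc_split {R : realType} (mu : {measure set (measurableTypeR R) -> \bar R})
  (f : R -> R) (s t : R) : 0 <= s -> s <= t -> rintegrable mu `[0, t] f ->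
  rintegrable mu `]s, t] f /\
  \int[mu]_(x in `[0, t]) f x = \int[mu]_(x in `[0, s]) f x + \int[mu]_(x in `]s, t]) f x.
Proof.
move=> s0 st rf.
have E : `[0, t]%classic = `[0, s]%classic `|` `]s, t]%classic.
  by rewrite -itv_bndbnd_setU// bnd_simp.
split.
  by apply: integrableS rf => //; rewrite E; exact: subsetUr.
rewrite E Rintegral_setU//; first by rewrite -E.
apply/disj_setPS => y [/=]; rewrite !in_itv/= => /andP[_ ys] /andP[].
by rewrite ltNge ys.
Qed.

Section PathControl.
Context {R : realType} (d m : nat) (phi : 'I_m -> R -> \bar R)
  (n : 'I_m -> 'rV[R]_d) (a : 'I_m -> R).

Definition norm1 (v : 'rV[R]_d) : R := \sum_j `|v ord0 j|.

Lemma dotv_norm1 (e : R) (c v : 'rV[R]_d) : (forall j, `|c ord0 j| <= e) ->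
  `|dotv c v| <= e * norm1 v.
Proof.
move=> ce; apply: le_trans (ler_norm_sum _ _ _) _.
rewrite mulr_sumr; apply: ler_sum => j _; rewrite normrM ler_wpM2r//.
Qed.

(* What survives of the equation along one path [x], driven by [b]: a bound on the
   increments of the bounded variation part [x - b] against constant vectors. *)
Definition path_control (x b : R -> 'rV[R]_d) (W : R -> R) :=
  (forall s t : R, 0 <= s -> s <= t -> W s <= W t) /\
  forall s t : R, 0 <= s -> s <= t -> forall (c : 'rV[R]_d) (al e : R),
    (forall u : R, s < u <= t ->
      dotv c (- gradPhi phi n a (x u)) <= al + e * (1 + norm1 (gradPhi phi n a (x u)))) ->
    (forall (u : R) v, s < u <= t -> unit_inward_normal n a v (x u) ->
      dotv c v <= e * norm1 v) ->
    dotv c (x t - b t - (x s - b s)) <= al * (t - s) + e * (W t - W s).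

(** [W] is elapsed time plus the integrals of [norm1] of the drift and, against [lam], of the
    normal. The vector [c] is constant on []s, t]], so it passes through both integrals; [e]
    measures the error made by freezing it. The 1 in [1 + norm1] is paid by the time component of
    [W]. *)
Lemma path_control_exists (lam : {measure set (measurableTypeR R) -> \bar R})
  (x b nv : R -> 'rV[R]_d) :
  {ae lam, forall s, 0 <= s -> unit_inward_normal n a (nv s) (x s)} ->
  (forall t, 0 <= t -> forall j : 'I_d,
    rintegrable lebesgue_measure `[0, t] (fun s => gradPhi phi n a (x s) ord0 j) /\
    rintegrable lam `[0, t] (fun s => nv s ord0 j) /\
    x t ord0 j = x 0 ord0 j + b t ord0 j
      - \int[lebesgue_measure]_(s in `[0, t]) gradPhi phi n a (x s) ord0 j
      + \int[lam]_(s in `[0, t]) nv s ord0 j) ->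
  exists W, path_control x b W.
Proof.
move=> nvn eqx.
pose g u := gradPhi phi n a (x u).
have rnorm (mu : {measure set (measurableTypeR R) -> \bar R}) D (h : R -> 'rV[R]_d) :
    measurable D -> (forall j, rintegrable mu D (fun s => h s ord0 j)) ->
    rintegrable mu D (fun s => norm1 (h s)).
  by move=> mD rh; apply: rintegrable_sum => // j; exact: integrable_norm (rh j).
have rdot (mu : {measure set (measurableTypeR R) -> \bar R}) D (h : R -> 'rV[R]_d) c :
    measurable D -> (forall j, rintegrable mu D (fun s => h s ord0 j)) ->
    rintegrable mu D (fun s => dotv c (h s)) /\
    \int[mu]_(s in D) dotv c (h s) = \sum_j c ord0 j * \int[mu]_(s in D) h s ord0 j.
  move=> mD rh; split.
    by apply: rintegrable_sum => // j; exact: rintegrableZ.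
  rewrite Rintegral_sum//; last by move=> j; exact: rintegrableZ.
  by apply: eq_bigr => j _; rewrite RintegralZl//; exact: rh.
have rg t (t0 : 0 <= t) j : rintegrable lebesgue_measure `[0, t] (fun s => g s ord0 j).
  by have [] := eqx t t0 j.
have rn t (t0 : 0 <= t) j : rintegrable lam `[0, t] (fun s => nv s ord0 j).
  by have [_ []] := eqx t t0 j.
pose W t := t + \int[lebesgue_measure]_(s in `[0, t]) norm1 (g s)
  + \int[lam]_(s in `[0, t]) norm1 (nv s).
have WB s t : 0 <= s -> s <= t -> W t - W s = (t - s)
    + \int[lebesgue_measure]_(s in `]s, t]) norm1 (g s)
    + \int[lam]_(s in `]s, t]) norm1 (nv s).
  move=> s0 st; have t0 := le_trans s0 st; rewrite /W.
  have [_ ->] := Rintegral_cc_split s0 st (rnorm _ _ _ (measurable_itv _) (rg t t0)).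
  have [_ ->] := Rintegral_cc_split s0 st (rnorm _ _ _ (measurable_itv _) (rn t t0)).
  ring.
have n1ge0 v : 0 <= norm1 v by apply: sumr_ge0.
exists W; split.
  move=> s t s0 st; rewrite -subr_ge0 WB//.
  apply: addr_ge0; last by apply: Rintegral_ge0 => u _.
  by apply: addr_ge0; [rewrite subr_ge0|apply: Rintegral_ge0 => u _].
move=> s t s0 st c al e hg hn; have t0 := le_trans s0 st.
have mst : measurable (`]s, t]%classic : set (measurableTypeR R)) by exact: measurable_itv.
have rg' j : rintegrable lebesgue_measure `]s, t] (fun s => g s ord0 j).
  by have [] := Rintegral_cc_split s0 st (rg t t0 j).
have rn' j : rintegrable lam `]s, t] (fun s => nv s ord0 j).
  by have [] := Rintegral_cc_split s0 st (rn t t0 j).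
have -> : dotv c (x t - b t - (x s - b s)) =
    \int[lebesgue_measure]_(u in `]s, t]) (- dotv c (g u)) +
    \int[lam]_(u in `]s, t]) dotv c (nv u).
  have [rc ic] := rdot lebesgue_measure _ g c mst rg'.
  have -> : \int[lebesgue_measure]_(u in `]s, t]) (- dotv c (g u)) =
      - \int[lebesgue_measure]_(u in `]s, t]) dotv c (g u).
    by under eq_Rintegral do rewrite -mulN1r; rewrite RintegralZl// mulN1r.
  rewrite ic (rdot lam _ nv c mst rn').2 -sumrN -big_split/=.
  apply: eq_bigr => j _; rewrite !mxE.
  have [_ [_ ->]] := eqx t t0 j; have [_ [_ ->]] := eqx s s0 j.
  have [_ ->] := Rintegral_cc_split s0 st (rg t t0 j).
  have [_ ->] := Rintegral_cc_split s0 st (rn t t0 j).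
  by rewrite /g; ring.
have r1 : rintegrable lebesgue_measure `]s, t] (fun=> 1 : R).
  apply: measurable_bounded_integrable => //.
  - by rewrite /= lebesgue_measure_itv/= lte_fin; case: ifP => _; rewrite -?EFinD ltry.
  - exists 1; split; first exact: num_real.
    by move=> y y1 z _; rewrite normr1 ltW.
have rgn := rnorm _ _ _ mst rg'.
have rnn := rnorm _ _ _ mst rn'.
have rA : rintegrable lebesgue_measure `]s, t] (fun u => al * 1 + e * (1 + norm1 (g u))).
  by apply: rintegrableD => //; apply: rintegrableZ => //; exact: rintegrableD.
rewrite WB//.
have -> : al * (t - s) + e * (t - s + \int[lebesgue_measure]_(s in `]s, t]) norm1 (g s)
    + \int[lam]_(s in `]s, t]) norm1 (nv s)) =
    \int[lebesgue_measure]_(u in `]s, t]) (al * 1 + e * (1 + norm1 (g u))) +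
    \int[lam]_(u in `]s, t]) (e * norm1 (nv u)).
  rewrite RintegralD//; [|exact: rintegrableZ|by apply: rintegrableZ => //; exact: rintegrableD].
  rewrite !RintegralZl//; last exact: rintegrableD.
  rewrite RintegralD// Rintegral_cst// /= lebesgue_measure_itv/= lte_fin.
  have -> : fine (if s < t then (t%:E - s%:E)%E else 0%E) = t - s.
    case: ltP => //= ts; apply/esym/eqP; rewrite subr_eq0; apply/eqP/le_anti.
    by rewrite ts st.
  ring.
apply: lerD.
- apply: le_Rintegral => //.
    have := rintegrableZ mst (-1) (rdot lebesgue_measure _ g c mst rg').1.
    by congr (_.-integrable _ _); apply/funext => u /=; rewrite mulN1r.
  move=> u; rewrite /= in_itv/= => ust; rewrite mulr1 -dotvNr; exact: hg.
- apply: le_Rintegral_ae => //.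
  + exact: (rdot lam _ nv c mst rn').1.
  + exact: rintegrableZ.
  + apply: (@filterS _ _ (ae_filter_ringOfSetsType lam) _ _ _ nvn) => u hu.
    rewrite /= in_itv/= => ust; apply: (hn u) => //.
    by apply: hu; case/andP: ust => su _; apply: le_trans s0 (ltW su).
Qed.

End PathControl.

(** * Expansion over one time step *)

Section StepEstimates.
Context {R : realType}.

Lemma kappa_bounds (h : R) : 0 <= h -> h - 2 * h ^+ 2 <= kappa h <= h.
Proof.
move=> h0; rewrite /kappa; apply/andP; split; last first.
  by have := expR_ge1Dx (- (2 * h)); lra.
have : expR (- (2 * h)) <= 1 - 2 * h + 4 * h ^+ 2.
  rewrite expRN invf_ple ?posrE ?expR_gt0//; last by have := sqr_ge0 (2 * h - 1); nra.
  apply: le_trans (expR_ge1Dx _).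
  rewrite -[X in X <= _]mul1r ler_pdivrMr; last by have := sqr_ge0 (2 * h - 1); nra.
  have := sqr_ge0 h; have : 0 <= h ^+ 3 by rewrite exprn_ge0.
  by rewrite !exprS expr0; nra.
lra.
Qed.

Lemma sqr_sum_le (q : nat) (a : 'I_q -> R) :
  (\sum_l a l) ^+ 2 <= q%:R * \sum_l a l ^+ 2.
Proof.
rewrite expr2 big_distrlr/=.
have E l : \sum_l' (a l ^+ 2 / 2 + a l' ^+ 2 / 2) =
    q%:R * (a l ^+ 2 / 2) + (\sum_l' a l' ^+ 2) / 2.
  by rewrite big_split/= sumr_const card_ord mulr_suml mulr_natl.
apply: (@le_trans _ _ (\sum_l \sum_l' (a l ^+ 2 / 2 + a l' ^+ 2 / 2))).
  apply: ler_sum => l _; apply: ler_sum => l' _.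
  by have := sqr_ge0 (a l - a l'); nra.
rewrite (eq_bigr _ (fun l _ => E l)).
rewrite big_split/= -mulr_sumr sumr_const card_ord -mulr_suml -mulr_natl.
by lra.
Qed.

Lemma MVT_between (f df : R -> R) (lo hi z z' : R) :
  (forall y : R, lo <= y <= hi -> is_derive y 1 f (df y)) ->
  lo <= z <= hi -> lo <= z' <= hi ->
  exists2 w, `|z - w| <= `|z - z'| /\ lo <= w <= hi &
    f z' - f z = df w * (z' - z).
Proof.
move=> fdf zI z'I.
have cf x y : lo <= x <= hi -> lo <= y <= hi -> {within `[x, y], continuous f}.
  move=> xI yI; apply: derivable_within_continuous => w; rewrite in_itv/= => wI.
  have : lo <= w <= hi by lra.
  by move=> /fdf[].
have fdf' x y w : lo <= x <= hi -> lo <= y <= hi -> w \in `]x, y[ -> is_derive w 1 f (df w).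
  by move=> xI yI; rewrite in_itv/= => wI; apply: fdf; lra.
have [zz'|z'z] := leP z z'.
  have [w] := @MVT_segment R f df z z' zz' (fun y => fdf' z z' y zI z'I) (cf _ _ zI z'I).
  rewrite in_itv/= => wI ->; exists w => //; split; last by lra.
  by rewrite !ler0_norm; lra.
have [w] := @MVT_segment R f df z' z (ltW z'z) (fun y => fdf' z' z y z'I zI) (cf _ _ z'I zI).
rewrite in_itv/= => wI h; exists w; last by lra.
split; last by lra.
by rewrite !ger0_norm; lra.
Qed.

(** The difference [H] between [F] and its second-order polynomial at [z] is estimated by two mean
    values: its derivative at [w] is [(g2 w' - g2 z) * (w - z)], small by uniform continuity of
    [g2]. Hence one radius serves all pairs [z], [z']. *)
Lemma taylor2 (F g1 g2 : R -> R) (lo hi eta : R) :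
  (forall z : R, lo <= z <= hi -> is_derive z 1 F (g1 z)) ->
  (forall z : R, lo <= z <= hi -> is_derive z 1 g1 (g2 z)) ->
  (forall z : R, lo <= z <= hi -> {for z, continuous g2}) -> 0 < eta ->
  \forall r \near 0^'+, forall z z', lo <= z <= hi -> lo <= z' <= hi ->
    `|z - z'| < r ->
    F z' - F z <= g1 z * (z' - z) + g2 z / 2 * (z' - z) ^+ 2 + eta * (z' - z) ^+ 2.
Proof.
move=> dF dg cg eta0.
have [r r0 hr] := segment_unif_cont cg eta0.
near=> r' => z z' zI z'I zz'.
have zz'r : `|z - z'| < r by apply: lt_trans zz' _; near: r'; exact: nbhs_right_lt.
pose H w := F w - (g1 z * (w - z) + g2 z / 2 * (w - z) ^+ 2).
have dH (w : R) : lo <= w <= hi ->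
    is_derive w 1 H (g1 w - (g1 z + g2 z * (w - z))).
  move=> wI; have dFw := dF w wI.
  apply: is_derive_eq; rewrite /GRing.scale/=.
  by field.
have [w [zw wI] hw] := MVT_between dH zI z'I.
have [w' [zw' w'I] hw'] := MVT_between dg zI wI.
have hg : `|g2 z - g2 w'| < eta by apply: hr => //; lra.
have -> : F z' - F z = H z' - H z + (g1 z * (z' - z) + g2 z / 2 * (z' - z) ^+ 2).
  by rewrite /H !subrr expr0n/= !mulr0 addr0 subr0; ring.
rewrite hw.
have -> : g1 w - (g1 z + g2 z * (w - z)) = (g2 w' - g2 z) * (w - z) by lra.
rewrite addrC lerD2l; apply: le_trans (ler_norm _) _.
rewrite !normrM -(real_normK (num_real (z' - z))) expr2 mulrA ler_pM ?mulr_ge0//.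
rewrite ler_pM//; first by rewrite distrC; exact: ltW.
by rewrite distrC (distrC z').
Unshelve. all: by end_near. Qed.
(** 350 = 6 + 80 + 264 adds the coefficients of the three remainders in [step_algebra]; as [1 <= K]
    there, the cube dominates the lower powers of [K]. *)
Definition step_const (K : R) (q : nat) : R := 350 * K ^+ 3 * q.+1%:R.

Lemma step_const_gt0 (K : R) (q : nat) : 0 < K -> 0 < step_const K q.
Proof.
move=> K0; rewrite /step_const; apply: mulr_gt0; last by rewrite ltr0n.
by apply: mulr_gt0; [rewrite ltr0n|exact: exprn_gt0].
Qed.

(** Each coordinate moves by the sine [s] of the Brownian increment, its cubic defect [tau] and the
    bounded variation part [dv]. In [dZ] only [2 * A + S + 2 * Bv] is kept, and in its square only
    [4 * A ^+ 2]; all other terms contain a factor [om] or [eta] besides a factor of order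
    [S + V]. *)
Lemma step_algebra (q : nat) (K om eta G1 G2 : R) (xi s tau dv : 'I_q -> R) :
  1 <= K -> 0 <= om <= 1 -> 0 <= eta ->
  (forall l, `|xi l| <= K) -> `|G1| <= K -> `|G2| <= K ->
  (forall l, `|s l| <= om) -> (forall l, `|dv l| <= om) ->
  (forall l, `|tau l| <= om * s l ^+ 2) ->
  let dZ := \sum_l ((xi l + (s l + tau l + dv l)) ^+ 2 - xi l ^+ 2) in
  G1 * dZ + G2 / 2 * dZ ^+ 2 + eta * dZ ^+ 2 <=
  2 * G1 * \sum_l xi l * s l + G1 * \sum_l s l ^+ 2 +
  2 * G2 * (\sum_l xi l * s l) ^+ 2 + 2 * G1 * \sum_l xi l * dv l +
  step_const K q * (om + eta) * (\sum_l s l ^+ 2 + \sum_l `|dv l|).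
Proof.
move=> K1 /andP[om0 om1] eta0 xiK G1K G2K som dvom tauom /=.
set dZ := \sum_l _; set A := \sum_l xi l * s l; set S := \sum_l s l ^+ 2.
set Bv := \sum_l xi l * dv l; set V := \sum_l `|dv l|.
have K0 : 0 <= K by lra.
pose Q : R := q%:R; have Q0 : 0 <= Q by rewrite /Q.
have S0 : 0 <= S by apply: sumr_ge0 => l _; exact: sqr_ge0.
have V0 : 0 <= V by apply: sumr_ge0.
have QE : \sum_(l < q) om = Q * om by rewrite sumr_const card_ord mulr_natl.
have s2om l : s l ^+ 2 <= om.
  rewrite -real_normK ?num_real// expr2; have := som l; have := normr_ge0 (s l); nra.
have Som : S <= Q * om by rewrite -QE; apply: ler_sum => l _.
have Vom : V <= Q * om by rewrite -QE; apply: ler_sum => l _.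
have Aom : `|A| <= Q * K * om.
  apply: le_trans (ler_norm_sum _ _ _) _.
  rewrite -mulrA mulrCA -QE mulr_sumr; apply: ler_sum => l _.
  by rewrite normrM ler_pM.
have A2 : A ^+ 2 <= Q * K ^+ 2 * S.
  apply: le_trans (sqr_sum_le _) _; rewrite -mulrA ler_wpM2l// mulr_sumr.
  apply: ler_sum => l _; rewrite exprMn ler_wpM2r ?sqr_ge0//.
  by rewrite -(real_normK (num_real (xi l))) ler_sqr ?nnegrE.
have Bv1 : `|Bv| <= K * V.
  apply: le_trans (ler_norm_sum _ _ _) _; rewrite mulr_sumr.
  by apply: ler_sum => l _; rewrite normrM ler_wpM2r.
pose del := dZ - (2 * A + S + 2 * Bv).
have delom : `|del| <= 6 * K * om * (S + V).
  have -> : del = \sum_l (2 * (xi l * tau l) + (2 * s l + (tau l + dv l)) * (tau l + dv l)).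
    rewrite /del /dZ /A /S /Bv !mulr_sumr -!big_split/= -sumrB.
    by apply: eq_bigr => l _; ring.
  apply: le_trans (ler_norm_sum _ _ _) _.
  rewrite /S /V -big_split mulr_sumr/=; apply: ler_sum => l _.
  have h1 := tauom l; have h2 := dvom l; have h3 := som l; have h4 := s2om l.
  have h5 : `|tau l| <= om by apply: le_trans h1 _; have := sqr_ge0 (s l); nra.
  have h6 : `|tau l + dv l| <= om * s l ^+ 2 + `|dv l|.
    by apply: le_trans (ler_normD _ _) _; rewrite lerD2r.
  have h7 : `|2 * s l + (tau l + dv l)| <= 4 * om.
    apply: le_trans (ler_normD _ _) _; rewrite normrM ger0_norm//.
    have := ler_normD (tau l) (dv l); lra.
  have h8 : `|xi l * tau l| <= K * (om * s l ^+ 2) by rewrite normrM ler_pM.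
  have h9 : `|(2 * s l + (tau l + dv l)) * (tau l + dv l)| <=
      4 * om * (om * s l ^+ 2 + `|dv l|).
    by rewrite normrM ler_pM.
  apply: le_trans (ler_normD _ _) _; rewrite normrM ger0_norm//.
  have s20 := sqr_ge0 (s l).
  have h10 : om * s l ^+ 2 <= s l ^+ 2 by nra.
  have h11 : 4 * om * (om * s l ^+ 2 + `|dv l|) <= 4 * om * (s l ^+ 2 + `|dv l|).
    by rewrite ler_wpM2l ?lerD2r// mulr_ge0.
  have h12 : 0 <= om * (s l ^+ 2 + `|dv l|) by rewrite mulr_ge0// addr_ge0.
  have h13 : 4 * (om * (s l ^+ 2 + `|dv l|)) <= 4 * (K * (om * (s l ^+ 2 + `|dv l|))).
    by rewrite ler_wpM2l// ler_peMl.
  have h14 : 0 <= K * om * `|dv l| by rewrite !mulr_ge0.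
  by nra.
have SV0 : 0 <= S + V by rewrite addr_ge0.
(* As [dZ = 2 * A + E], the square differs from [4 * A ^+ 2] by [E * (4 * A + E)], whose first
   factor is of order [S + V] and whose second is of order [om]. *)
pose E := S + 2 * Bv + del.
have E1 : `|E| <= 8 * K * (S + V).
  apply: le_trans (ler_normD _ _) _.
  have := ler_normD S (2 * Bv); rewrite normrM (ger0_norm S0) (@ger0_norm _ 2)// => hS.
  have : 6 * K * om * (S + V) <= 6 * K * (S + V).
    by rewrite ler_wpM2r// ler_piMr ?mulr_ge0.
  have : S <= K * S by rewrite ler_peMl.
  have := mulr_ge0 K0 S0; have := mulr_ge0 K0 V0; nra.
have SVom : S + V <= 2 * (Q * om) by lra.
have E2 : `|E| <= 16 * K * (Q * om).
  by apply: le_trans E1 _; have := ler_wpM2l K0 SVom; lra.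
have QKom : 0 <= K * (Q * om) by rewrite !mulr_ge0.
have E3 : `|4 * A + E| <= 20 * K * (Q * om).
  apply: le_trans (ler_normD _ _) _; rewrite normrM ger0_norm//.
  by move: Aom E2; lra.
have dZE : dZ = 2 * A + E by rewrite /E /del; ring.
have EE : `|E * (4 * A + E)| <= 8 * K * (S + V) * (20 * K * (Q * om)).
  by rewrite normrM ler_pM.
have Esq : E ^+ 2 <= 8 * K * (S + V) * (16 * K * (Q * om)).
  by rewrite -real_normK ?num_real// expr2 ler_pM.
have G1d : G1 * del <= K * (6 * K * om * (S + V)).
  by apply: le_trans (ler_norm _) _; rewrite normrM ler_pM.
have G2E : G2 * (E * (4 * A + E)) <= K * (8 * K * (S + V) * (20 * K * (Q * om))).
  by apply: le_trans (ler_norm _) _; rewrite normrM ler_pM.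
pose X := K ^+ 3 * (S + V).
have K2 : K ^+ 2 * (S + V) <= X.
  by rewrite /X ler_wpM2r// (exprS K 2) ler_peMl ?sqr_ge0.
have dZ2 : dZ ^+ 2 <= 264 * Q * X.
  have : dZ ^+ 2 <= 8 * A ^+ 2 + 2 * E ^+ 2.
    by rewrite dZE; have := sqr_ge0 (2 * A - E); lra.
  have : K ^+ 2 * S <= K ^+ 2 * (S + V) by rewrite ler_wpM2l ?sqr_ge0// lerDl.
  have := ler_wpM2l Q0 K2.
  have : 0 <= Q * (K ^+ 2 * (S + V)) by rewrite !mulr_ge0// sqr_ge0.
  move=> c1 c2 c3 c4.
  have c5 := ler_wpM2l Q0 c3.
  have c6 : 8 * K * (S + V) * (16 * K * (Q * om)) <= 128 * (Q * (K ^+ 2 * (S + V))).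
    have -> : 8 * K * (S + V) * (16 * K * (Q * om)) =
      128 * (om * (Q * (K ^+ 2 * (S + V)))) by ring.
    by rewrite ler_wpM2l// ler_piMl.
  lra.
have X0 : 0 <= X by rewrite /X mulr_ge0// exprn_ge0.
have QS : q.+1%:R = Q + 1 by rewrite /Q -natr1.
have -> : G1 * dZ + G2 / 2 * dZ ^+ 2 + eta * dZ ^+ 2 =
  2 * G1 * A + G1 * S + 2 * G2 * A ^+ 2 + 2 * G1 * Bv
  + (G1 * del + G2 * (E * (4 * A + E)) / 2 + eta * dZ ^+ 2).
  by rewrite dZE /E; field.
rewrite lerD2l /step_const QS.
have -> : 350 * K ^+ 3 * (Q + 1) * (om + eta) * (S + V) =
  350 * (Q * (om * X) + om * X + Q * (eta * X) + eta * X) by rewrite /X; ring.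
have t1 : K * (6 * K * om * (S + V)) <= 6 * (om * X).
  have -> : K * (6 * K * om * (S + V)) = 6 * (om * (K ^+ 2 * (S + V))) by ring.
  by rewrite !ler_wpM2l.
have t2 : K * (8 * K * (S + V) * (20 * K * (Q * om))) = 160 * (Q * (om * X)).
  by rewrite /X; ring.
have t3 := ler_wpM2l eta0 dZ2.
have t4 : 0 <= Q * (om * X) by rewrite !mulr_ge0.
have t5 : 0 <= om * X by rewrite !mulr_ge0.
have t6 : 0 <= Q * (eta * X) by rewrite !mulr_ge0.
have t7 : 0 <= eta * X by rewrite !mulr_ge0.
by lra.
Qed.

End StepEstimates.

Section Zeta.
Context {R : realType} (q : nat).

(* Second-order increment of a function of [sqdist] with first and second derivatives
   [G1] and [G2], centred. The coordinate increments of the Brownian motion enter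
   through their sines [s], whose moments come from the characteristic function. *)
Definition zeta (G1 G2 kap : R) (xi s : 'I_q -> R) : R :=
  2 * G1 * \sum_l xi l * s l + G1 * \sum_l (s l ^+ 2 - kap) +
  2 * G2 * \sum_l \sum_l' xi l * xi l' * (s l * s l' - (l == l')%:R * kap).

(** Centring subtracts [kap] times the Ito correction [q * G1 + 2 * G2 * |xi|^2], the very term that
    appears beside the drift in the supermartingale condition. *)
Lemma zetaE (G1 G2 kap : R) (xi s : 'I_q -> R) : zeta G1 G2 kap xi s =
  2 * G1 * \sum_l xi l * s l + G1 * \sum_l s l ^+ 2 +
  2 * G2 * (\sum_l xi l * s l) ^+ 2 -
  kap * (q%:R * G1 + 2 * G2 * \sum_l xi l ^+ 2).
Proof.
rewrite /zeta sumrB sumr_const card_ord -[kap *+ q]mulr_natl.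
have -> : \sum_l \sum_l' xi l * xi l' * (s l * s l' - (l == l')%:R * kap) =
    (\sum_l xi l * s l) ^+ 2 - kap * \sum_l xi l ^+ 2.
  rewrite expr2 big_distrlr/= mulr_sumr -sumrB; apply: eq_bigr => l _.
  rewrite (eq_bigr (fun l' => xi l * s l * (xi l' * s l') -
      (l == l')%:R * kap * (xi l * xi l'))); last by move=> l' _; ring.
  rewrite sumrB; congr (_ - _).
  rewrite (bigD1 l)//= eqxx big1 => [|l' /negPf h]; last by rewrite eq_sym h !mul0r.
  by rewrite addr0 mul1r expr2.
by ring.
Qed.

End Zeta.

Lemma for_continuous_sum {R : realType} (T : topologicalType) (I : Type) (r : seq I)
  (f : I -> T -> R) (u : T) :
  (forall i, {for u, continuous (f i)}) ->
  {for u, continuous (fun x => \sum_(i <- r) f i x)}.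
Proof.
move=> cf; elim: r => [|i r IH].
  rewrite (_ : (fun _ => _) = fun=> 0); first exact: cst_continuous.
  by apply/funext => x; rewrite big_nil.
rewrite (_ : (fun _ => _) = fun x => f i x + \sum_(j <- r) f j x).
  by apply: continuousD; [exact: cf|exact: IH].
by apply/funext => x; rewrite big_cons.
Qed.

Section StepArithmetic.
Context {R : realType}.
Implicit Types (h T eta om : R).

(** Exchanging the step length [h] for the variance [kappa h] costs at most [2 * h ^+ 2] per unit of
    [T], which is [o(h)]. *)
Lemma kappa_error h T T0 eta : 0 <= h -> `|T| <= 2 * T0 -> h * (8 * T0) <= eta ->
  - T * h <= - kappa h * T + eta / 2 * h.
Proof.
move=> h0 hT hr; have /andP[k1 k2] := kappa_bounds h0.
have t1 : `|(h - kappa h) * T| <= 2 * h ^+ 2 * (2 * T0).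
  by rewrite normrM ler_pM// ger0_norm; lra.
have t2 := ler_wpM2l h0 hr.
have := ler_norm (- ((h - kappa h) * T)); rewrite normrN; nra.
Qed.

Lemma quarter_sum om x y : x < om / 4 -> y < om / 4 -> 0 < om -> x + y <= om.
Proof. lra. Qed.

Lemma quarter_half om x : x < om / 4 -> om <= 1 -> x <= 1 / 2.
Proof. lra. Qed.

Lemma cube_le_sqr om x y : 0 <= x -> 0 <= y -> x < om / 4 -> x ^+ 2 <= 2 ^+ 2 * y ->
  x ^+ 3 <= om * y.
Proof. by move=> x0 y0 xom xy; rewrite exprS; nra. Qed.

Lemma sum_le_mul Q S V W : 0 <= Q -> 0 <= S -> 0 <= W -> V <= Q * W ->
  S + V <= (Q + 1) * (S + W) :> R.
Proof. by move=> Q0 S0 W0 VW; have := mulr_ge0 Q0 S0; lra. Qed.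

Lemma norm_drift_le Q G1 G2 z X K : 0 <= Q -> Q * `|G1| <= X -> 0 <= X ->
  `|G2| <= K -> `|z| <= K -> `|Q * G1 + 2 * G2 * z| <= 2 * (X + K * K) :> R.
Proof.
move=> Q0 G1X X0 G2K zK; apply: le_trans (ler_normD _ _) _; rewrite !normrM.
rewrite (ger0_norm Q0) (@ger0_norm _ 2)//.
have := ler_pM (normr_ge0 G2) (normr_ge0 z) G2K zK; lra.
Qed.

Lemma step_combine (D Z1 Z2 A T E S W h kap eta : R) :
  D <= Z1 + A + E ->
  Z1 = Z2 + kap * T ->
  A <= - T * h + eta / 2 * W ->
  E <= eta / 2 * (S + W) -> 0 <= eta * S ->
  - T * h <= - kap * T + eta / 2 * h -> 0 <= eta * h ->
  D <= Z2 + eta * (W + h + S).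
Proof. lra. Qed.

End StepArithmetic.

(** * Increment of the Lyapunov function along a path *)

Section PathStep.
Context {R : realType} (d m : nat) (phi : 'I_m -> R -> \bar R)
  (n : 'I_m -> 'rV[R]_d) (a : 'I_m -> R) (q : nat) (e : 'I_q -> 'rV[R]_d)
  (x0 : 'rV[R]_d).

Definition coord_to (l : 'I_q) (x : 'rV[R]_d) : R := dotv (e l) (x - x0).
Definition sqdist (x : 'rV[R]_d) : R := \sum_l coord_to l x ^+ 2.
(** Half the gradient of [sqdist] and, for orthonormal [e], the orthogonal projection of [x - x0] on
    their span. *)
Definition projto (x : 'rV[R]_d) : 'rV[R]_d := \sum_l coord_to l x *: e l.

Context (F g1 g2 : R -> R) (U U' : set 'rV[R]_d) (N eps : R).
Hypothesis ee : forall l l', dotv (e l) (e l') = (l == l')%:R.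
Hypothesis dF : forall z : R, 0 < z -> is_derive z 1 F (g1 z).
Hypothesis dg1 : forall z : R, 0 < z -> is_derive z 1 g1 (g2 z).
Hypothesis cg2 : forall z : R, 0 < z -> {for z, continuous g2}.
Hypothesis UN : forall x, U' x -> sqdist x <= N.
Hypothesis drift : forall x, U' x -> Dbar n a x -> 0 < sqdist x ->
  2 * g1 (sqdist x) * dotv (projto x) (- gradPhi phi n a x) +
  (q%:R * g1 (sqdist x) + 2 * g2 (sqdist x) * sqdist x) <= 0.
Hypothesis normal : forall x v, U' x -> Dbar n a x -> unit_inward_normal n a v x ->
  dotv (projto x) v = 0.
Hypothesis eps0 : 0 < eps.

(* The derivatives of the Lyapunov function blow up at 0. *)
Definition clip (g : R -> R) (z : R) : R := g (Num.max z (eps / 2)).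

Lemma clipE g z : eps / 2 <= z -> clip g z = g z.
Proof. by move=> h; rewrite /clip max_l. Qed.

Lemma clip_continuous g : (forall z : R, 0 < z -> {for z, continuous g}) ->
  continuous (clip g).
Proof.
move=> cg z; apply: (@continuous_comp _ _ _ (fun z => Num.max z (eps / 2)) g).
  apply: continuous_max; [exact: cvg_id|exact: cst_continuous].
apply: cg; rewrite lt_max; apply/orP; right; by rewrite divr_gt0.
Qed.

Lemma cg1 (z : R) : 0 < z -> {for z, continuous g1}.
Proof. by move=> /dg1[dgz _]; exact/differentiable_continuous/derivable1_diffP. Qed.

(** [clip g z] depends only on [Num.max z (eps / 2)], so the values [z <= N] reduce to a compact
    segment. *)
Lemma clip_bounded : exists2 K : R, 1 <= K & forall z, z <= N ->
  `|clip g1 z| <= K /\ `|clip g2 z| <= K.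
Proof.
have bd g : (forall z : R, 0 < z -> {for z, continuous g}) ->
    exists2 K : R, 0 <= K & forall z, z <= N -> `|clip g z| <= K.
  move=> cg; pose N' := Num.max N (eps / 2).
  have cn : continuous (fun z => `|clip g z|).
    move=> z; apply: (@continuous_comp _ _ _ (clip g) Num.norm).
      exact: clip_continuous.
    exact: norm_continuous.
  have [|c _ hc] := @EVT_max R (fun z => `|clip g z|) (eps / 2) N' _ (continuous_subspaceT cn).
    by rewrite /N' le_max lexx orbT.
  exists `|clip g c|; first exact: normr_ge0.
  move=> z zN; have -> : clip g z = clip g (Num.max z (eps / 2)).
    by rewrite /clip -maxA maxxx.
  apply: hc; rewrite in_itv/= le_max lexx orbT/= /N'.
  by rewrite ge_max !le_max zN lexx orbT.
have [K1 K10 h1] := bd g1 cg1; have [K2 K20 h2] := bd g2 cg2.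
exists (K1 + K2 + 1); first by lra.
move=> z zN; have := h1 z zN; have := h2 z zN; lra.
Qed.

Lemma e_coord_le1 l j : `|e l ord0 j| <= 1.
Proof.
have := ee l l; rewrite eqxx /dotv (bigD1 j)//= => h.
have : 0 <= \sum_(i | i != j) e l ord0 i * e l ord0 i.
  by apply: sumr_ge0 => i _; rewrite -expr2 sqr_ge0.
by move=> h0; rewrite -ler_sqr ?nnegrE// real_normK ?num_real// expr1n expr2; lra.
Qed.

Lemma coord_to_le x l : sqdist x <= N -> `|coord_to l x| <= N + 1.
Proof.
move=> h; have : coord_to l x ^+ 2 <= N.
  apply: le_trans h; rewrite /sqdist (bigD1 l)//= lerDl.
  by apply: sumr_ge0 => i _; exact: sqr_ge0.
move=> h2; have N0 : 0 <= N by apply: le_trans h2; exact: sqr_ge0.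
rewrite -ler_sqr ?nnegrE//; last by lra.
rewrite real_normK ?num_real//; nra.
Qed.

Context (x b : R -> 'rV[R]_d) (W : R -> R) (s t : R).
Hypothesis s0 : 0 <= s.
Hypothesis pW : path_control phi n a x b W.
Hypothesis xD : forall u, s <= u <= t -> Dbar n a (x u).
Hypothesis cx : forall l u, s <= u <= t ->
  {for u, continuous (fun u => dotv (e l) (x u))}.
Hypothesis cb : forall l u, s <= u <= t ->
  {for u, continuous (fun u => dotv (e l) (b u))}.
Hypothesis xU : \forall r \near 0^'+, forall u v : R, s <= u <= t -> s <= v <= t ->
  `|u - v| < r -> U (x u) -> U' (x v).

Let near_unif (f : R -> R) (eta : R) :
  (forall u, s <= u <= t -> {for u, continuous f}) -> 0 < eta ->
  \forall r \near 0^'+, forall u v : R, s <= u <= t -> `|u - v| < r -> `|f u - f v| < eta.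
Proof.
move=> cf eta0; have [r r0 hr] := segment_unif_cont cf eta0.
near=> r' => u v uI uv; apply: hr => //; apply: lt_trans uv _.
near: r'; exact: nbhs_right_lt.
Unshelve. all: by end_near. Qed.

Let ccoord l u : s <= u <= t -> {for u, continuous (fun u => coord_to l (x u))}.
Proof.
move=> uI; rewrite (_ : (fun _ => _) = fun u => dotv (e l) (x u) - dotv (e l) x0); last first.
  by apply/funext => w; rewrite /coord_to dotvBr.
by apply: continuousB; [exact: cx|exact: cst_continuous].
Qed.

Let csq u : s <= u <= t -> {for u, continuous (fun u => sqdist (x u))}.
Proof.
move=> uI; apply: (@for_continuous_sum _ _ _ _ (fun l u => coord_to l (x u) ^+ 2)) => l.
apply: (@continuous_comp _ _ _ (fun u => coord_to l (x u)) (fun z => z ^+ 2)).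
  exact: ccoord.
exact: exprn_continuous.
Qed.

Let cl l u := 2 * clip g1 (sqdist (x u)) * coord_to l (x u).
Let ell u := q%:R * clip g1 (sqdist (x u)) + 2 * clip g2 (sqdist (x u)) * sqdist (x u).

Let cclip g u : (forall z : R, 0 < z -> {for z, continuous g}) -> s <= u <= t ->
  {for u, continuous (fun u => clip g (sqdist (x u)))}.
Proof.
move=> cg uI; apply: (@continuous_comp _ _ _ (fun u => sqdist (x u)) (clip g)).
  exact: csq.
exact: clip_continuous.
Qed.

Let ccl l u : s <= u <= t -> {for u, continuous (cl l)}.
Proof.
move=> uI; apply: continuousM; last exact: ccoord.
apply: continuousM; [exact: cst_continuous|exact: (cclip cg1)].
Qed.

Let cell u : s <= u <= t -> {for u, continuous ell}.
Proof.
move=> uI; apply: continuousD.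
  by apply: continuousM; [exact: cst_continuous|exact: (cclip cg1)].
apply: continuousM; last exact: csq.
by apply: continuousM; [exact: cst_continuous|exact: (cclip cg2)].
Qed.

(** [path_control] with [al = 0] and [e = 1], for [e l] and its opposite, whose coordinates are
    bounded by 1. *)
Lemma increment_le_control l (u v : R) : 0 <= u -> u <= v ->
  `|dotv (e l) (x v - b v - (x u - b u))| <= W v - W u.
Proof.
move=> u0 uv; have [_ hW] := pW.
have n1 (w : 'rV[R]_d) : 0 <= norm1 w :> R by apply: sumr_ge0.
have n1N (w : 'rV[R]_d) : norm1 (- w) = norm1 w.
  by apply: eq_bigr => j _; rewrite mxE normrN.
have cP (c : 'rV[R]_d) : (forall j, `|c ord0 j| <= 1) ->
    dotv c (x v - b v - (x u - b u)) <= W v - W u.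
  move=> hc; have := hW u v u0 uv c 0 1; rewrite mul0r add0r mul1r; apply.
    move=> w _; have := dotv_norm1 (- gradPhi phi n a (x w)) hc; rewrite n1N.
    have := ler_norm (dotv c (- gradPhi phi n a (x w))); lra.
  move=> w y _ _; apply: le_trans (ler_norm _) _; exact: dotv_norm1.
rewrite ler_norml lerNl -dotvNl !cP// => j; rewrite ?mxE ?normrN; exact: e_coord_le1.
Qed.

(** The vector [c u], the gradient of the Lyapunov function frozen at the start of the step, is
    compared with [c w] at later times. At [w] itself the reflection is orthogonal to [c w] and the
    drift contributes at most [- ell w]; the difference [c u - c w] is uniformly small and is
    charged to [W]. *)
Let drift_step (eta : R) : 0 < eta ->
  \forall r \near 0^'+, forall u v : R, s <= u -> u < v -> v <= t -> v - u < r ->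
    U (x u) -> eps <= sqdist (x u) ->
    2 * clip g1 (sqdist (x u)) *
      \sum_l coord_to l (x u) * dotv (e l) (x v - b v - (x u - b u)) <=
    - ell u * (v - u) + eta * (W v - W u).
Proof.
move=> eta0.
(* Each of the [q] coefficients moves by at most [e1], so every coordinate of [c] moves by at most
   [eta]. *)
pose e1 := eta / q.+1%:R.
have e10 : 0 < e1 by rewrite divr_gt0.
have e2 : 0 < eps / 2 by rewrite divr_gt0.
have h1 := near_unif csq e2.
have h2 : \forall r \near 0^'+, forall l (u v : R), s <= u <= t -> `|u - v| < r ->
    `|cl l u - cl l v| < e1.
  by apply: filter_forall => l; apply: near_unif => // u; exact: ccl.
have h3 := near_unif cell eta0.
apply: filterS (filterI (filterI h1 h2) (filterI h3 xU)) => r [[H1 H2] [H3 H4]] u v su uv vt vur Uu epsu.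
have uI : s <= u <= t by lra.
rewrite mulr_sumr.
pose c w := \sum_l cl l w *: e l.
have -> : \sum_l 2 * clip g1 (sqdist (x u)) *
    (coord_to l (x u) * dotv (e l) (x v - b v - (x u - b u))) =
    dotv (c u) (x v - b v - (x u - b u)).
  by rewrite /c dotv_suml; apply: eq_bigr => l _; rewrite dotvZl mulrA.
have [_ hW] := pW.
have n1N (w : 'rV[R]_d) : norm1 (- w) = norm1 w.
  by apply: eq_bigr => j _; rewrite mxE normrN.
have key (w : R) : u < w <= v -> [/\ U' (x w) /\ Dbar n a (x w), (0 < sqdist (x w))%R,
    c w = (2 * g1 (sqdist (x w))) *: projto (x w),
    ell w = q%:R * g1 (sqdist (x w)) + 2 * g2 (sqdist (x w)) * sqdist (x w) &
    (`|ell u - ell w| < eta)%R /\ (forall j, `|(c u - c w) ord0 j| <= eta)%R].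
  move=> wI; have uw : `|u - w| < r by rewrite ler0_norm; lra.
  have wI' : s <= w <= t by lra.
  have zw : eps / 2 <= sqdist (x w).
    have : `|sqdist (x u) - sqdist (x w)| < eps / 2 by exact: H1.
    by rewrite ltr_distl; lra.
  split.
  - split; last exact: xD.
    exact: (H4 u w).
  - by lra.
  - rewrite /c /projto scaler_sumr; apply: eq_bigr => l _.
    by rewrite /cl clipE// scalerA.
  - by rewrite /ell !clipE.
  - split; first exact: H3.
    move=> j; have -> : (c u - c w) ord0 j = \sum_l (cl l u - cl l w) * e l ord0 j.
      rewrite !mxE !summxE -sumrB; apply: eq_bigr => l _; rewrite !mxE; ring.
    apply: le_trans (ler_norm_sum _ _ _) _.
    apply: (@le_trans _ _ (\sum_(l < q) e1)); last first.
      rewrite sumr_const card_ord -mulr_natl /e1 mulrCA ler_piMr ?ltW//.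
      by rewrite ltr_pdivrMr// mul1r ltr_nat.
    apply: ler_sum => l _; rewrite normrM -[leRHS]mulr1 ler_pM ?e_coord_le1//.
    exact/ltW/H2.
apply: hW; first exact: le_trans su.
- exact: ltW.
- move=> w /key[[U'w Dw] zw cw ellw [ellu cu]].
  have -> : dotv (c u) (- gradPhi phi n a (x w)) =
    dotv (c u - c w) (- gradPhi phi n a (x w)) + dotv (c w) (- gradPhi phi n a (x w)).
    by rewrite dotvBl subrK.
  have t1 := dotv_norm1 (- gradPhi phi n a (x w)) cu; rewrite n1N in t1.
  have t2 := ler_norm (dotv (c u - c w) (- gradPhi phi n a (x w))).
  have t3 := drift U'w Dw zw.
  rewrite -ellw -dotvZl -cw in t3.
  move: ellu; rewrite ltr_distl; lra.
- move=> w y /key[[U'w Dw] zw cw ellw [ellu cu]] ny.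
  have -> : dotv (c u) y = dotv (c u - c w) y.
    by rewrite dotvBl cw dotvZl (normal U'w Dw ny) mulr0 subr0.
  apply: le_trans (ler_norm _) _; exact: dotv_norm1.
Qed.

(** Taylor expansion in [sqdist]: [drift_step] bounds the bounded variation part of the first-order
    term, and the Ito correction it yields cancels the centring of [zeta]. Drift and normals are
    understood on [U'] only, so the step starts in [U] and is short enough to remain in [U']. *)
Lemma path_step (eta : R) : 0 < eta ->
  \forall r \near 0^'+, forall u v : R, s <= u -> u < v -> v <= t -> v - u < r ->
    U (x u) -> eps <= sqdist (x u) ->
    [/\ U' (x v), eps / 2 <= sqdist (x v) &
     F (sqdist (x v)) - F (sqdist (x u)) <=
       zeta (clip g1 (sqdist (x u))) (clip g2 (sqdist (x u))) (kappa (v - u))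
         (coord_to ^~ (x u)) (fun l => sin (dotv (e l) (b v - b u))) +
       eta * (W v - W u + (v - u) + \sum_l sin (dotv (e l) (b v - b u)) ^+ 2)].
Proof.
move=> eta0.
have [K [K1 hKN hK0]] : exists K, [/\ 1 <= K, `|N| + 1 <= K &
    forall z, z <= N -> `|clip g1 z| <= K /\ `|clip g2 z| <= K].
  have [K0 K01 hK0] := clip_bounded.
  have N0 := normr_ge0 N; exists (K0 + `|N| + 1); split; [lra|lra|].
  by move=> z /hK0; lra.
have K0 : 0 < K by exact: lt_le_trans K1.
have [C C0 CE] : exists2 C, 0 < C & step_const K q * q.+1%:R = C.
  by exists (step_const K q * q.+1%:R) => //; rewrite mulr_gt0// step_const_gt0.
(* [om] bounds all increments of the step. The remainder carries [om + om], and passing from the sum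
   of the [|dv l|] to [W] costs the factor [q.+1] contained in [C]; the outcome is at most
   [eta / 2]. *)
have [om [om0 om1 omC]] : exists om, [/\ 0 < om, om <= 1 & C * om <= eta / 4].
  have C4 : 0 < 4 * C by rewrite mulr_gt0.
  exists (Num.min 1 (eta / (4 * C))); split.
  - by rewrite lt_min ltr01/= divr_gt0.
  - by rewrite ge_min lexx.
  - have : Num.min 1 (eta / (4 * C)) <= eta / (4 * C) by rewrite ge_min lexx orbT.
    by rewrite ler_pdivlMr//; lra.
have om4 : 0 < om / 4 by rewrite divr_gt0.
have e20 : 0 < eps / 2 by rewrite divr_gt0.
have eta2 : 0 < eta / 2 by rewrite divr_gt0.
have [T0 T00 T0E] : exists2 T0, 0 < T0 & q.+1%:R * K + K * K = T0.
  by exists (q.+1%:R * K + K * K) => //; rewrite addr_gt0// mulr_gt0.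
have KN : 0 < 8 * T0 by rewrite mulr_gt0.
have hT : \forall r \near 0^'+, forall z z', eps / 2 <= z <= N -> eps / 2 <= z' <= N ->
    `|z - z'| < r ->
    F z' - F z <= g1 z * (z' - z) + g2 z / 2 * (z' - z) ^+ 2 + om * (z' - z) ^+ 2.
  apply: (@taylor2 R F g1 g2 (eps / 2) N) => // z zI; [apply: dF|apply: dg1|apply: cg2];
  by lra.
have [r1 [r10 hr1]] := filter_ex (filterI (nbhs_right_gt 0) hT).
have h1 := near_unif csq r10.
have h2 := near_unif csq e20.
have h3 : \forall r \near 0^'+, forall l (u v : R), s <= u <= t -> `|u - v| < r ->
    `|(fun u => coord_to l (x u)) u - (fun u => coord_to l (x u)) v| < om / 4.
  by apply: filter_forall => l; apply: near_unif => // u; exact: ccoord.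
have h4 : \forall r \near 0^'+, forall l (u v : R), s <= u <= t -> `|u - v| < r ->
    `|(fun u => dotv (e l) (b u)) u - (fun u => dotv (e l) (b u)) v| < om / 4.
  by apply: filter_forall => l; apply: near_unif => // u; exact: cb.
have h5 := drift_step eta2.
have h6 : \forall r \near 0^'+, r < eta / (8 * T0).
  by apply: nbhs_right_lt; rewrite divr_gt0.
apply: filterS (filterI (filterI (filterI h1 h2) (filterI h3 h4))
  (filterI (filterI h5 h6) xU)) => r [[[H1 H2] [H3 H4]] [[H5 H6] H7]].
move=> u v su uv vt vur Uu epsu.
have uI : s <= u <= t by rewrite su (le_trans (ltW uv)).
have vI : s <= v <= t by rewrite vt (le_trans su (ltW uv)).
have uvr : `|u - v| < r by rewrite distrC ger0_norm ?subr_ge0 ?(ltW uv).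
have uur : `|u - u| < r by rewrite subrr normr0; apply: le_lt_trans vur; rewrite subr_ge0 ltW.
have U'v : U' (x v) by exact: (H7 u v).
have U'u : U' (x u) by exact: (H7 u u).
have zuN := UN U'u; have zvN := UN U'v.
have zv : eps / 2 <= sqdist (x v).
  have : `|sqdist (x u) - sqdist (x v)| < eps / 2 by exact: H2.
  by rewrite ltr_distl; lra.
split => //.
set zu := sqdist (x u) in epsu zuN *; set z' := sqdist (x v) in zv zvN *.
have zz' : `|zu - z'| < r1 by exact: H1.
have Cu : eps / 2 <= zu.
  by apply: le_trans epsu; rewrite ler_pdivrMr// ler_peMr ?ler1n// ltW.
apply: le_trans (hr1 zu z' _ _ zz') _; [by apply/andP|by apply/andP|].
rewrite -(clipE g1 Cu) -(clipE g2 Cu).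
set G1 := clip g1 zu; set G2 := clip g2 zu.
have [G1K G2K] : `|G1| <= K /\ `|G2| <= K.
  exact: hK0.
pose db l := dotv (e l) (b v - b u).
pose dv l := dotv (e l) (x v - b v - (x u - b u)).
have dbE l : db l = dotv (e l) (b v) - dotv (e l) (b u) by rewrite /db dotvBr.
have xiE l : coord_to l (x v) = coord_to l (x u) + (sin (db l) + (db l - sin (db l)) + dv l).
  by rewrite /coord_to /db /dv !dotvBr; ring.
have db4 l : `|db l| < om / 4.
  by rewrite dbE distrC; exact: H4.
have om4le : om / 4 <= om by rewrite ler_pdivrMr// ler_peMr ?ler1n ?ltW.
have dbom l : `|db l| <= om by exact/ltW/(lt_le_trans (db4 l)).
have dx4 l : `|coord_to l (x u) - coord_to l (x v)| < om / 4.
  exact: H3.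
have V1 l : `|dv l| <= W v - W u by apply: increment_le_control; [exact: le_trans su|exact: ltW].
have := @step_algebra R q K om om G1 G2 (coord_to ^~ (x u)) (fun l => sin (db l))
  (fun l => db l - sin (db l)) dv K1.
have -> : \sum_l ((coord_to l (x u) + (sin (db l) + (db l - sin (db l)) + dv l)) ^+ 2
    - coord_to l (x u) ^+ 2) = z' - zu.
  rewrite sumrB; congr (_ - _); apply: eq_bigr => l _; by rewrite -xiE.
move=> /(_ _ (ltW om0) _ G1K G2K) hA.
apply: le_trans (hA _ _ _ _ _) _.
- by rewrite ltW.
- move=> l; apply: le_trans (coord_to_le l zuN) _; apply: le_trans hKN.
  by rewrite lerD2r ler_norm.
- move=> l; exact: le_trans (norm_sin_le _) (dbom l).
- move=> l; have -> : dv l = coord_to l (x v) - coord_to l (x u) - db l.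
    by rewrite xiE; ring.
  apply: le_trans (ler_normB _ _) _; rewrite (distrC (coord_to _ _)).
  by rewrite quarter_sum.
(* The defect is at most the cube of [|db l|], while [|db l| <= 2 * |sin (db l)|]; the remaining
   factor [|db l| < om / 4] absorbs the 4. *)
- move=> l; apply: le_trans (sin_dist _) _.
  have h := db4 l; have : `|db l| <= 2 * `|sin (db l)|.
    by apply: norm_le_sin; exact: quarter_half om1.
  rewrite -ler_sqr ?nnegrE ?mulr_ge0// exprMn (real_normK (num_real (sin (db l)))) => hs.
  by apply: cube_le_sqr h hs => //; exact: sqr_ge0.
have hd : 2 * G1 * \sum_l coord_to l (x u) * dv l <=
    - (q%:R * G1 + 2 * G2 * zu) * (v - u) + eta / 2 * (W v - W u).
  exact: H5.
set S := \sum_l sin (db l) ^+ 2.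
have SE : \sum_l sin (dotv (e l) (b v - b u)) ^+ 2 = S by [].
have S0 : 0 <= S by apply: sumr_ge0 => l _; exact: sqr_ge0.
set V := \sum_l `|dv l|.
have VW : V <= q%:R * (W v - W u).
  rewrite mulr_natl -[X in _ *+ X](card_ord q) -sumr_const; exact: ler_sum.
have W0 : 0 <= W v - W u.
  by have [hW _] := pW; rewrite subr_ge0; apply: hW; [exact: le_trans su|exact: ltW].
have hV : S + V <= q.+1%:R * (S + (W v - W u)).
  by rewrite -natr1 sum_le_mul.
have hE : step_const K q * (om + om) * (S + V) <= eta / 2 * (S + (W v - W u)).
  have k0 : 0 <= step_const K q * (om + om).
    by rewrite ltW// mulr_gt0// ?step_const_gt0// addr_gt0.
  apply: le_trans (ler_wpM2l k0 hV) _.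
  rewrite mulrA ler_wpM2r//; first exact: addr_ge0.
  have -> : step_const K q * (om + om) * q.+1%:R = 2 * (C * om) by rewrite -CE; ring.
  rewrite -ler_pdivlMl// (le_trans omC)// le_eqVlt; apply/orP; left; apply/eqP.
  by field.
have hvu : 0 <= v - u by rewrite subr_ge0 ltW.
have hk : - (q%:R * G1 + 2 * G2 * zu) * (v - u) <=
   - kappa (v - u) * (q%:R * G1 + 2 * G2 * zu) + eta / 2 * (v - u).
  set T := q%:R * G1 + 2 * G2 * zu.
  have hT' : `|T| <= 2 * T0.
    have z0 : 0 <= zu by exact: le_trans (ltW eps0) epsu.
    have zK : `|zu| <= K.
      rewrite ger0_norm//; apply: le_trans hKN; apply: le_trans zuN _.
      by apply: le_trans (ler_norm N) _; rewrite lerDl.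
    by rewrite -T0E norm_drift_le// ?mulr_ge0 ?ler_pM ?ler_nat// ltW.
  apply: (kappa_error hvu hT').
  by rewrite -ler_pdivlMr//; exact/ltW/(lt_trans vur).
apply: (step_combine (lexx _) _ hd hE _ hk); last 2 first.
- by rewrite mulr_ge0// ltW.
- by rewrite mulr_ge0// ltW.
- by rewrite zetaE -/(sqdist (x u)) -/zu -/S subrK.
Qed.

End PathStep.

(** * The discrete supermartingale *)

Section StoppedSum.
Context {R : realType}.

(* Partial sums of [zt], frozen as soon as [cond] fails or the sum drops below [- c0];
   the boolean tells whether the sum is still running. *)
Fixpoint stopped_sum (c0 : R) (cond : nat -> bool) (zt : nat -> R) (k : nat) : R * bool :=
  if k is k'.+1 then
    let: (N, b) := stopped_sum c0 cond zt k' in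
    let N' := N + (if b then zt k' else 0) in
    (N', [&& b, cond k & - c0 <= N'])
  else (0, cond 0%N).

Context (c0 : R) (cond : nat -> bool) (zt : nat -> R).
Hypothesis c00 : 0 <= c0.
Let N k := (stopped_sum c0 cond zt k).1.
Let alive k := (stopped_sum c0 cond zt k).2.

Lemma stopped_sumS k : N k.+1 = N k + (if alive k then zt k else 0) /\
  alive k.+1 = [&& alive k, cond k.+1 & - c0 <= N k.+1].
Proof. by rewrite /N /alive /=; case: (stopped_sum _ _ _ k). Qed.

Let NS k := (stopped_sumS k).1.
Let aS k := (stopped_sumS k).2.

Lemma alive_cond k : alive k -> cond k /\ - c0 <= N k.
Proof.
case: k => [|k]; first by rewrite /alive/= => h; split=> //; rewrite /N/= oppr_le0.
by rewrite aS => /and3P[].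
Qed.

(** A running sum is at least [- c0], so only its last increment can take it lower. This holds on
    every path, even where the grid is still too coarse for [step]. *)
Lemma stopped_sum_lower (C : R) k : 0 <= C -> (forall k, cond k -> `|zt k| <= C) ->
  - c0 - C <= N k.
Proof.
move=> C0 hC; elim: k => [|k IH]; first by rewrite /N/=; have := c00; lra.
rewrite NS; case: (boolP (alive k)) => [/alive_cond[ck hk]|_]; last by rewrite addr0.
by have := hC k ck; have := c00; rewrite ler_norml; lra.
Qed.

Context (y err : nat -> R) (n : nat) (Y0 Y1 Ymin : R).
Hypothesis step : forall k, (k < n)%N -> cond k ->
  y k.+1 - y k <= zt k + (err k.+1 - err k).
Hypothesis err0 : err 0%N = 0.
Hypothesis err1 : forall k, (k < n)%N -> cond k -> err k.+1 <= 1.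
Hypothesis y0 : cond 0%N -> y 0%N <= Y0.
Hypothesis ymin : forall k, (k < n)%N -> cond k -> Ymin <= y k.+1.
Hypothesis c0E : Y0 - Ymin + 1 <= c0.

(** Telescoping of [step]: while it runs, the sum dominates the growth of [y] up to the accumulated
    error. *)
Let below k : (k <= n)%N -> alive k -> y k - Y0 - err k <= N k.
Proof.
elim: k => [_ a0|k IH kn].
  by rewrite /N/= err0; have := y0 a0; lra.
rewrite aS => /and3P[ak _ _]; have [ck _] := alive_cond ak.
rewrite NS ak; have := IH (ltnW kn) ak; have := step kn ck; lra.
Qed.

(** Covers also the step at which the sum stops, because that increment is still added. *)
Let belowS k : (k < n)%N -> alive k -> y k.+1 - Y0 - 1 <= N k.+1.
Proof.
move=> kn ak; have [ck _] := alive_cond ak; rewrite NS ak.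
have := below (ltnW kn) ak; have := step kn ck; have := err1 kn ck; lra.
Qed.

(** Since [y] stays above [Ymin], the threshold [- c0] is never what stops the sum once [step]
    holds. *)
Lemma stopped_sum_ge k : (k <= n)%N -> - c0 <= N k.
Proof.
elim: k => [_|k IH kn]; first by rewrite /N/= oppr_le0.
case: (boolP (alive k)) => [ak|/negbTE nak].
  have [ck _] := alive_cond ak.
  by have := belowS kn ak; have := ymin kn ck; have := c0E; lra.
by rewrite NS nak addr0; apply: IH; exact: ltnW.
Qed.

(** The first failure of [cond] freezes the sum just after the step to [k.+1], where [y] has reached
    [Y1]. *)
Lemma stopped_sum_hit k : (k < n)%N -> (forall j, (j <= k)%N -> cond j) ->
  ~~ cond k.+1 -> Y1 <= y k.+1 -> Y1 - Y0 - 1 <= N n.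
Proof.
move=> kn ck nck Yk.
have al j : (j <= k)%N -> alive j.
  elim: j => [_|j IH jk]; first exact: ck.
  by rewrite aS IH ?(ltnW jk)//= ck//= stopped_sum_ge// (leq_trans jk)// ltnW.
have := belowS kn (al k (leqnn k)) => hk.
have dead j : (k < j)%N -> alive j = false /\ N j = N k.+1.
  elim: j => // j IH; rewrite ltnS leq_eqVlt => /predU1P[<-|kj].
    by split => //; rewrite aS (negbTE nck) andbF.
  have [aj Nj] := IH kj.
  by rewrite aS aj NS aj addr0.
by rewrite (dead n kn).2; lra.
Qed.

End StoppedSum.

Lemma grid_near {R : realType} (s t u : R) (n : nat) : s < t -> s <= u <= t ->
  exists2 k, (k <= n.+1)%N & `|u - grid s t n k| <= (t - s) / n.+1%:R.
Proof.
move=> st uI; pose h := (t - s) / n.+1%:R.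
have h0 : 0 < h by rewrite divr_gt0// subr_gt0.
have x0 : 0 <= (u - s) / h by rewrite divr_ge0//; lra.
exists (Num.truncn ((u - s) / h)).
  rewrite -(ler_nat R); apply: (@le_trans _ _ ((u - s) / h)); first by rewrite truncn_le.
  rewrite ler_pdivrMr// /h mulrC -mulrA mulVf ?pnatr_eq0// mulr1; lra.
have /andP[] := truncn_itv x0.
set T := Num.truncn _; rewrite -(natr1 T) ler_pdivlMr// ltr_pdivrMr//.
rewrite -/h; have -> : grid s t n T = s + T%:R * h.
  by rewrite /grid /h; ring.
by rewrite ler_norml => h1 h2; apply/andP; split; lra.
Qed.

Section ZetaBound.
Context {R : realType} (q : nat).

Lemma norm_sum_le (f : 'I_q -> R) (c : R) : (forall l, `|f l| <= c) ->
  `|\sum_l f l| <= q%:R * c.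
Proof.
move=> fc; apply: le_trans (ler_norm_sum _ _ _) _.
rewrite mulr_natl -[X in _ *+ X](card_ord q) -sumr_const; exact: ler_sum.
Qed.

Lemma kappa01 (h : R) : 0 <= h -> 0 <= kappa h <= 1.
Proof.
move=> h0; rewrite /kappa.
have : expR (- (2 * h)) <= 1 by rewrite expR_le1; lra.
have := expR_ge0 (- (2 * h)); lra.
Qed.

Lemma zeta_bound (K G1 G2 kap : R) (xi s : 'I_q -> R) : 1 <= K ->
  `|G1| <= K -> `|G2| <= K -> (forall l, `|xi l| <= K) -> (forall l, `|s l| <= 1) ->
  0 <= kap <= 1 ->
  `|zeta G1 G2 kap xi s| <= 2 * K * (q%:R * (K * 1)) + K * (q%:R * 1) +
    2 * K * (q%:R * (q%:R * (K * K * 2))).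
Proof.
move=> K1 G1K G2K xiK s1 /andP[kap0 kap1].
have K0 : 0 <= K by lra.
have s2 l : 0 <= s l ^+ 2 <= 1.
  by rewrite sqr_ge0/= -(real_normK (num_real (s l))) exprn_ile1.
rewrite /zeta; apply: le_trans (ler_normD _ _) _; apply: lerD.
  apply: le_trans (ler_normD _ _) _; apply: lerD.
    rewrite normrM; apply: ler_pM => //; first by rewrite normrM (@ger0_norm _ 2)// ler_wpM2l.
    by apply: norm_sum_le => l; rewrite normrM ler_pM.
  rewrite normrM; apply: ler_pM => //; apply: norm_sum_le => l.
  by have := s2 l; rewrite ler_norml; lra.
rewrite normrM; apply: ler_pM => //; first by rewrite normrM (@ger0_norm _ 2)// ler_wpM2l.
apply: norm_sum_le => l; apply: norm_sum_le => l'.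
rewrite normrM; apply: ler_pM => //; first by rewrite normrM ler_pM.
apply: le_trans (ler_normB _ _) _; rewrite (_ : 2 = 1 + 1)//; apply: lerD.
  by rewrite normrM mulr_ile1.
by case: eqP => _; rewrite ?mul1r ?mul0r ?normr0// ger0_norm.
Qed.

End ZetaBound.

Section ZetaMean.
Context {R : realType} {dO : measure_display} {Omega : measurableType dO}
  (P : probability Omega R) (F : R -> set (set Omega)) (d : nat)
  (B : R -> Omega -> 'rV[R]_d) (q : nat) (e : 'I_q -> 'rV[R]_d) (s t K : R)
  (A : Omega -> bool) (G1 G2 : Omega -> R) (xi : 'I_q -> Omega -> R).
Hypothesis uF : usual_filtration P F.
Hypothesis bB : brownian P F B.
Hypothesis ee : forall l l', dotv (e l) (e l') = (l == l')%:R.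
Hypothesis s0 : 0 <= s.
Hypothesis st : s < t.
Hypothesis mA : Fmeas (F s) A.
Hypothesis mG1 : Fmeas (F s) G1.
Hypothesis mG2 : Fmeas (F s) G2.
Hypothesis mxi : forall l, Fmeas (F s) (xi l).
Hypothesis bdd : forall w, A w ->
  [/\ `|G1 w| <= K, `|G2 w| <= K & forall l, `|xi l w| <= K].

Let sn l w := sin (dotv (e l) (B t w - B s w)).

(** [zeta] combines centred sines and products of sines with coefficients known at time [s]. The cut
    by the event [A] of [F s] makes these coefficients bounded without destroying their
    measurability at [s]. *)
Lemma zeta_mean0 : esp P (fun w => if A w then
  zeta (G1 w) (G2 w) (kappa (t - s)) (xi ^~ w) (sn ^~ w) else 0) = 0.
Proof.
have bsn l : bddmeas (sn l) by exact: (bddmeas_trig uF bB (e l) s0 (ltW st)).1.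
have bss l l' c : bddmeas (fun w => sn l w * sn l' w - c).
  by apply: bddmeasB; [exact: bddmeasM|exact: bddmeas_cst].
pose cut (f : Omega -> R) w := if A w then f w else 0.
have mcut f : Fmeas (F s) f -> Fmeas (F s) (cut f).
  by move=> mf; apply: Fmeas_if => //; exact: Fmeas_cst.
have bcut (f : Omega -> R) (C : R) : Fmeas (F s) f -> (forall w, A w -> `|f w| <= C) -> bddmeas (cut f).
  move=> mf fC; apply: (Fmeas_bddmeas uF s0 (C := `|C|)); first exact: mcut.
  move=> w; rewrite /cut; case: ifP => [/fC h|_]; last by rewrite normr0.
  exact: le_trans h (ler_norm _).
pose f1 l w := 2 * G1 w * xi l w; pose f3 l l' w := 2 * G2 w * (xi l w * xi l' w).
have c2 : Fmeas (F s) (fun=> 2 : R) by exact: Fmeas_cst.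
have m1 l : Fmeas (F s) (f1 l) by apply: FmeasM => //; exact: FmeasM.
have m3 l l' : Fmeas (F s) (f3 l l') by apply: FmeasM; exact: FmeasM.
have b1 l : bddmeas (cut (f1 l)).
  apply: (bcut _ (2 * K * K)) => // w /bdd[g1 _ x1].
  by rewrite normrM ler_pM// normrM (@ger0_norm _ 2)// ler_wpM2l.
have b2 : bddmeas (cut G1) by apply: (bcut _ K) => // w /bdd[].
have b3 l l' : bddmeas (cut (f3 l l')).
  apply: (bcut _ (2 * K * (K * K))) => // w /bdd[_ g2 x1].
  by rewrite normrM ler_pM// normrM ?ler_pM// (@ger0_norm _ 2)// ler_wpM2l.
pose k := kappa (t - s).
rewrite (_ : (fun w => _) = fun w => (\sum_l cut (f1 l) w * sn l w +
    \sum_l cut G1 w * (sn l w * sn l w - k)) +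
    \sum_l \sum_l' cut (f3 l l') w * (sn l w * sn l' w - (l == l')%:R * k)); last first.
  apply/funext => w; rewrite /cut; case: (A w); last first.
    rewrite !big1 ?addr0// => [l _|l _|l _]; rewrite ?mul0r//.
    by rewrite big1// => l' _; rewrite mul0r.
  rewrite /zeta !mulr_sumr; congr (_ + _ + _); apply: eq_bigr => l _.
  - by rewrite /f1 mulrA.
  - by rewrite mulr_sumr; apply: eq_bigr => l' _; rewrite /f3 mulrA.
have z1 l : bddmeas (fun w => cut (f1 l) w * sn l w) by exact: bddmeasM.
have z2 l : bddmeas (fun w => cut G1 w * (sn l w * sn l w - k)) by exact: bddmeasM.
have z3 l l' : bddmeas (fun w => cut (f3 l l') w * (sn l w * sn l' w - (l == l')%:R * k)).
  exact: bddmeasM.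
have bs1 := bddmeas_sum (index_enum 'I_q) z1.
have bs2 := bddmeas_sum (index_enum 'I_q) z2.
have bs3 := bddmeas_sum (index_enum 'I_q) (fun l => bddmeas_sum (index_enum 'I_q) (z3 l)).
have ss l l' (f : Omega -> R) : Fmeas (F s) f -> bddmeas f ->
    esp P (fun w => f w * (sn l w * sn l' w - (l == l')%:R * k)) = 0.
  move=> mf bf; rewrite (_ : (fun w => _) = fun w => f w * (sn l w * sn l' w) -
    (l == l')%:R * k * f w); last by apply/funext => w; ring.
  rewrite espB; [|by apply: bddmeasM => //; exact: bddmeasM
    |by apply: bddmeasM => //; exact: bddmeas_cst].
  by rewrite (brownian_sinsin uF bB s0 st mf bf _ _ ee) espZ// subrr.
rewrite espD ?espD ?esp_sum//; last exact: bddmeasD.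
  rewrite !big1 ?addr0// => l _.
  - rewrite esp_sum// big1// => l' _; apply: ss => //; exact: mcut.
  - by have := ss l l (cut G1) (mcut _ mG1) b2; rewrite eqxx mul1r.
  - exact: (brownian_sin uF bB s0 st (mcut _ (m1 l)) (b1 l)).
by move=> l; exact: bddmeas_sum.
Qed.

End ZetaMean.

Section RegularPath.
Context {R : realType} (d m : nat) (phi : 'I_m -> R -> \bar R)
  (n : 'I_m -> 'rV[R]_d) (a : 'I_m -> R).

Definition dotv_continuous (x : R -> 'rV[R]_d) (s t : R) :=
  forall v u, s <= u <= t -> {for u, continuous (fun u => dotv v (x u))}.

Definition regular_path (x b : R -> 'rV[R]_d) (s t : R) :=
  [/\ dotv_continuous x s t, dotv_continuous b s t,
      forall u, s <= u <= t -> Dbar n a (x u) &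
      exists W, path_control phi n a x b W].

Lemma sqdist_continuous q (e : 'I_q -> 'rV[R]_d) (x0 : 'rV[R]_d) (x : R -> 'rV[R]_d) (s t u : R) :
  dotv_continuous x s t -> s <= u <= t ->
  {for u, continuous (fun u => sqdist e x0 (x u))}.
Proof.
move=> lx uI; apply: (@for_continuous_sum _ _ _ _ (fun l u => coord_to e x0 l (x u) ^+ 2)) => l.
apply: (@continuous_comp _ _ _ (fun u => coord_to e x0 l (x u)) (fun z => z ^+ 2)).
  rewrite (_ : (fun _ => _) = fun u => dotv (e l) (x u) - dotv (e l) x0); last first.
    by apply/funext => v; rewrite /coord_to dotvBr.
  by apply: continuousB; [exact: lx|exact: cst_continuous].
exact: exprn_continuous.
Qed.

End RegularPath.

(** * Probability of reaching the zero set of [sqdist] *)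

Section Hitting.
Context {R : realType} {dO : measure_display} {Omega : measurableType dO}
  (P : probability Omega R) (F : R -> set (set Omega)) (d m : nat)
  (B : R -> Omega -> 'rV[R]_d) (phi : 'I_m -> R -> \bar R)
  (n : 'I_m -> 'rV[R]_d) (a : 'I_m -> R) (X : R -> Omega -> 'rV[R]_d).
Hypothesis uF : usual_filtration P F.
Hypothesis bB : brownian P F B.
Hypothesis aX : adaptedv F X.
Context (q : nat) (e : 'I_q -> 'rV[R]_d) (x0 : 'rV[R]_d) (V v1 v2 : R -> R)
  (U : 'rV[R]_d -> bool) (U' : set 'rV[R]_d) (N : R).
Hypothesis ee : forall l l', dotv (e l) (e l') = (l == l')%:R.
Hypothesis dV : forall z : R, 0 < z -> is_derive z 1 V (v1 z).
Hypothesis dv1 : forall z : R, 0 < z -> is_derive z 1 v1 (v2 z).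
Hypothesis cv2 : forall z : R, 0 < z -> {for z, continuous v2}.
Hypothesis Vmono : forall z z' : R, 0 < z -> z <= z' -> V z' <= V z.
Hypothesis Vdiv : forall C : R, exists2 z, 0 < z & C <= V z.
Hypothesis UN : forall x, U' x -> sqdist e x0 x <= N.
Hypothesis drift : forall x, U' x -> Dbar n a x -> 0 < sqdist e x0 x ->
  2 * v1 (sqdist e x0 x) * dotv (projto e x0 x) (- gradPhi phi n a x) +
  (q%:R * v1 (sqdist e x0 x) + 2 * v2 (sqdist e x0 x) * sqdist e x0 x) <= 0.
Hypothesis normal : forall x v, U' x -> Dbar n a x -> unit_inward_normal n a v x ->
  dotv (projto e x0 x) v = 0.
Context (s t : R).
Hypothesis s0 : 0 <= s.
Hypothesis st : s < t.
Hypothesis mU : forall u, 0 <= u -> Fmeas (F u) (fun w => U (X u w)).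
Hypothesis UsubU' : forall x, U x -> U' x.
Hypothesis UU' : forall x : R -> 'rV[R]_d, dotv_continuous x s t ->
  \forall r \near 0^'+, forall u v, s <= u <= t -> s <= v <= t ->
    `|u - v| < r -> U (x u) -> U' (x v).

Let rho x := sqdist e x0 x.
Let tk nn k := grid s t nn k.
Let sv nn k w l := sin (dotv (e l) (B (tk nn k.+1) w - B (tk nn k) w)).
Let Qv nn k w := \sum_(j < k) \sum_l sv nn j w l ^+ 2.

Let tk0 nn k : (k <= nn.+1)%N -> 0 <= tk nn k.
Proof. by move=> /(grid_bounds st)/andP[h _]; exact: le_trans h. Qed.

Let tkS nn k : tk nn k <= tk nn k.+1.
Proof. exact/ltW/grid_lt. Qed.

Let mX u v : 0 <= u -> Fmeas (F u) (fun w => dotv v (X u w)).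
Proof. by move=> u0; apply: Fmeas_dotv => j; exact: (adapted_Fmeas uF (aX j)). Qed.

Let mcoord u l : 0 <= u -> Fmeas (F u) (fun w => coord_to e x0 l (X u w)).
Proof.
move=> u0; rewrite (_ : (fun w => _) = fun w => dotv (e l) (X u w) - dotv (e l) x0).
  by apply: FmeasB; [exact: mX|exact: Fmeas_cst].
by apply/funext => w; rewrite /coord_to dotvBr.
Qed.

Let mrho u : 0 <= u -> Fmeas (F u) (fun w => rho (X u w)).
Proof.
move=> u0; apply: Fmeas_sum => l.
by apply: (Fmeas_continuous (f := fun z => z ^+ 2)); [exact: exprn_continuous|exact: mcoord].
Qed.

Let msv nn k l : (k <= nn)%N -> Fmeas (F (tk nn k.+1)) (fun w => sv nn k w l).
Proof.
move=> kn; apply: (Fmeas_continuous (f := sin)); first exact: continuous_sin.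
by apply: (brownian_incr_Fmeas uF bB); [exact: tk0 (leqW kn)|exact: tkS].
Qed.

Let mQ nn k : (k <= nn.+1)%N -> Fmeas (F (tk nn k)) (Qv nn k).
Proof.
elim: k => [_|k IH kn].
  rewrite (_ : Qv nn 0 = fun=> 0); first exact: Fmeas_cst.
  by apply/funext => w; rewrite /Qv big_ord0.
rewrite (_ : Qv nn k.+1 = fun w => Qv nn k w + \sum_l sv nn k w l ^+ 2); last first.
  by apply/funext => w; rewrite /Qv big_ord_recr.
apply: FmeasD; first exact: (filtration_mono uF (tk0 (ltnW kn)) (tkS nn k) (IH (ltnW kn))).
apply: Fmeas_sum => l; apply: (Fmeas_continuous (f := fun z => z ^+ 2)).
  exact: exprn_continuous.
exact: msv.
Qed.

Let svle1 nn k w l : `|sv nn k w l| <= 1. Proof. exact: norm_sin_le1. Qed.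

Let sv2 nn k w : 0 <= \sum_l sv nn k w l ^+ 2 <= q%:R.
Proof.
rewrite sumr_ge0/=; last by move=> l _; exact: sqr_ge0.
rewrite -[q%:R]mulr1 mulr_natl -[X in _ *+ X](card_ord q) -sumr_const.
by apply: ler_sum => l _; rewrite -(real_normK (num_real (sv _ _ _ _))) exprn_ile1.
Qed.

Let Q_bdd nn k : (k <= nn.+1)%N -> bddmeas (Qv nn k).
Proof.
move=> kn; apply: (Fmeas_bddmeas uF (tk0 kn) (C := k%:R * q%:R)); first exact: mQ.
by move=> w; apply: norm_sum_le => j; rewrite ger0_norm; have /andP[] := sv2 nn j w.
Qed.

Let esp_Q nn : esp P (Qv nn nn.+1) <= q%:R * (t - s).
Proof.
have bsv (k : 'I_nn.+1) l : bddmeas (fun w => sv nn k w l ^+ 2).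
  apply: (Fmeas_bddmeas uF (tk0 (ltn_ord k)) (C := 1)).
    by apply: (Fmeas_continuous (f := fun z => z ^+ 2)); 
      [exact: exprn_continuous|by apply: msv; rewrite -ltnS].
  by move=> w; rewrite normrX exprn_ile1.
rewrite /Qv esp_sum; last by move=> k; exact: bddmeas_sum.
apply: (@le_trans _ _ (\sum_(k < nn.+1) q%:R * ((t - s) / nn.+1%:R))); last first.
  by rewrite sumr_const card_ord -mulrnAr -[X in _ * X]mulr_natr divfK ?pnatr_eq0.
apply: ler_sum => k _; rewrite esp_sum//.
rewrite mulr_natl -[X in _ *+ X](card_ord q) -sumr_const; apply: ler_sum => l _.
have kn : (k <= nn.+1)%N by exact: ltnW.
have m1 : Fmeas (F (tk nn k)) (fun=> 1 : R) by exact: Fmeas_cst.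
have := brownian_sinsin uF bB (tk0 kn) (grid_lt nn k st) m1 (bddmeas_cst 1) l l ee.
rewrite eqxx mul1r esp_cst mulr1 gridS.
rewrite (_ : (fun w => 1 * _) = fun w => sv nn k w l ^+ 2); last first.
  by apply/funext => w; rewrite mul1r expr2.
move=> ->; have h0 : 0 <= (t - s) / nn.+1%:R by rewrite divr_ge0// subr_ge0 ltW.
by have /andP[_] := kappa_bounds h0.
Qed.

Section Fixed.
Context (eps z0 M : R).
Hypothesis eps0 : 0 < eps.
Hypothesis epsz0 : eps <= z0.
Hypothesis M0 : 0 < M.

(** [V z0] bounds the initial value of the Lyapunov function, [V N] bounds the later ones from
    below, and 1 is left for the error. *)
Let c0 := `|V z0 - V N| + 1.
(** The bound [M] on the sum of squared sines limits the accumulated error of the expansion. The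
    starting condition is an event of [F s], hence of the past of every grid time. *)
Let cond nn w k := [&& U (X (tk nn k) w), eps <= rho (X (tk nn k) w),
  Qv nn k w <= M & z0 <= rho (X s w)].
Let zt nn w k := zeta (clip eps v1 (rho (X (tk nn k) w)))
  (clip eps v2 (rho (X (tk nn k) w))) (kappa ((t - s) / nn.+1%:R))
  (coord_to e x0 ^~ (X (tk nn k) w)) (sv nn k w).
Let run nn k w := stopped_sum c0 (cond nn w) (zt nn w) k.

Let mcond nn k : (k <= nn.+1)%N -> Fmeas (F (tk nn k)) (fun w => cond nn w k).
Proof.
move=> kn; have k0 := tk0 kn.
apply: Fmeas_and; first exact: mU.
apply: Fmeas_and; first by apply: Fmeas_le; [exact: Fmeas_cst|exact: mrho].
apply: Fmeas_and; first by apply: Fmeas_le; [exact: mQ|exact: Fmeas_cst].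
apply: Fmeas_le; first exact: Fmeas_cst.
apply: (filtration_mono uF s0 _ (mrho s0)).
by have /andP[] := grid_bounds st kn.
Qed.

Let mclip g u : (forall z : R, 0 < z -> {for z, continuous g}) -> 0 <= u ->
  Fmeas (F u) (fun w => clip eps g (rho (X u w))).
Proof.
move=> cg u0; apply: Fmeas_continuous; last exact: mrho.
exact: clip_continuous.
Qed.

Let cv1 (z : R) : 0 < z -> {for z, continuous v1}.
Proof. exact: (cg1 dv1). Qed.

Let mzt nn k : (k <= nn)%N -> Fmeas (F (tk nn k.+1)) (fun w => zt nn w k).
Proof.
move=> kn; have k0 := tk0 (leqW kn); have k1 := tk0 (kn : (k.+1 <= nn.+1)%N).
have m1 (G : Omega -> R) : Fmeas (F (tk nn k)) G -> Fmeas (F (tk nn k.+1)) G.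
  by move=> mG; exact: (filtration_mono uF k0 (tkS nn k) mG).
have mx l := m1 _ (mcoord l k0).
have ms l := msv l kn.
have mc (c : R) : Fmeas (F (tk nn k.+1)) (fun=> c) by exact: Fmeas_cst.
rewrite /zt /zeta; apply: FmeasD; first apply: FmeasD.
- apply: FmeasM; first by apply: FmeasM; [exact: mc|exact: m1 _ (mclip cv1 k0)].
  by apply: Fmeas_sum => l; exact: FmeasM.
- apply: FmeasM; first exact: m1 _ (mclip cv1 k0).
  apply: Fmeas_sum => l; apply: FmeasB; last exact: mc.
  by apply: (Fmeas_continuous (f := fun z => z ^+ 2)) => //; exact: exprn_continuous.
- apply: FmeasM; first by apply: FmeasM; [exact: mc|exact: m1 _ (mclip cv2 k0)].
  apply: Fmeas_sum => l; apply: Fmeas_sum => l'.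
  by apply: FmeasM; [exact: FmeasM|apply: FmeasB; [exact: FmeasM|exact: mc]].
Qed.

Let mrun nn k : (k <= nn.+1)%N ->
  Fmeas (F (tk nn k)) (fun w => (run nn k w).1) /\
  Fmeas (F (tk nn k)) (fun w => (run nn k w).2).
Proof.
elim: k => [_|k IH kn]; first by split; [exact: Fmeas_cst|exact: mcond].
have [mN ma] := IH (ltnW kn); have k0 := tk0 (ltnW kn).
have mN' := filtration_mono uF k0 (tkS nn k) mN.
have ma' := filtration_mono uF k0 (tkS nn k) ma.
have mNS : Fmeas (F (tk nn k.+1)) (fun w => (run nn k.+1 w).1).
  rewrite (_ : (fun w => _) = fun w => (run nn k w).1 +
    (if (run nn k w).2 then zt nn w k else 0)); last first.
    by apply/funext => w; exact: (stopped_sumS _ _ _ _).1.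
  apply: FmeasD => //; apply: Fmeas_if => //; last exact: Fmeas_cst.
  exact: mzt.
split => //.
rewrite (_ : (fun w => _) = fun w => [&& (run nn k w).2, cond nn w k.+1 &
  - c0 <= (run nn k.+1 w).1]); last first.
  by apply/funext => w; exact: (stopped_sumS _ _ _ _).2.
apply: Fmeas_and => //; apply: Fmeas_and; first exact: mcond.
by apply: Fmeas_le => //; exact: Fmeas_cst.
Qed.

Let c00 : 0 <= c0. Proof. by rewrite /c0 addr_ge0. Qed.


Let const_bound : exists K, [/\ 1 <= K, 0 <= K & forall nn k w, cond nn w k ->
  [/\ `|clip eps v1 (rho (X (tk nn k) w))| <= K,
      `|clip eps v2 (rho (X (tk nn k) w))| <= K &
      forall l, `|coord_to e x0 l (X (tk nn k) w)| <= K]].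
Proof.
have [K K1 hK] := clip_bounded N dv1 cv2 eps0.
have K0 : 0 <= K by apply: le_trans K1.
exists (K + `|N| + 1); split.
- by apply: le_trans K1 _; rewrite -addrA lerDl addr_ge0.
- by rewrite !addr_ge0.
move=> nn k w /and4P[/UsubU'/UN zN _ _ _].
have KK : K <= K + `|N| + 1 by rewrite -addrA lerDl addr_ge0.
have [h1 h2] := hK _ zN; split; [exact: le_trans KK|exact: le_trans KK|move=> l].
apply: le_trans (coord_to_le l zN) _; rewrite lerD2r.
by apply: le_trans (ler_norm N) _; rewrite lerDr.
Qed.

Let zt_bound : exists2 C, 0 <= C & forall nn w k, cond nn w k -> `|zt nn w k| <= C.
Proof.
have [K [K1 K0 hK]] := const_bound.
exists (2 * K * (q%:R * (K * 1)) + K * (q%:R * 1) + 2 * K * (q%:R * (q%:R * (K * K * 2)))).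
  by rewrite !addr_ge0// !mulr_ge0.
move=> nn w k /hK[h1 h2 h3]; apply: zeta_bound => //.
by apply: kappa01; rewrite divr_ge0// subr_ge0 ltW.
Qed.

Let run_bdd nn k : (k <= nn.+1)%N -> bddmeas (fun w => (run nn k w).1).
Proof.
have [C C0 hC] := zt_bound; move=> kn; have [mN _] := mrun kn.
elim: k kn mN => [|k IH] kn mN; first exact: bddmeas_cst.
have [mN' ma'] := mrun (ltnW kn).
have [_ [D hD]] := IH (ltnW kn) mN'.
apply: (Fmeas_bddmeas uF (tk0 kn) (C := D + C)) => // w.
have -> : (run nn k.+1 w).1 = (run nn k w).1 + (if (run nn k w).2 then zt nn w k else 0).
  exact: (stopped_sumS _ _ _ _).1.
apply: le_trans (ler_normD _ _) _; apply: lerD => //.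
case: ifP => [/(alive_cond c00)[/hC]|_]; rewrite ?normr0//.
Qed.

Let run_mean0 nn k : (k <= nn.+1)%N -> esp P (fun w => (run nn k w).1) = 0.
Proof.
elim: k => [_|k IH kn]; first exact: esp_cst.
have [mN ma] := mrun (ltnW kn); have k0 := tk0 (ltnW kn).
pose D w := if (run nn k w).2 then zt nn w k else 0.
have [C C0 hC] := zt_bound.
have bD : bddmeas D.
  apply: (Fmeas_bddmeas uF (tk0 kn) (C := C)).
    apply: Fmeas_if; [|exact: mzt|exact: Fmeas_cst].
    exact: (filtration_mono uF k0 (tkS nn k) ma).
  by move=> w; rewrite /D; case: ifP => [/(alive_cond c00)[/hC]|_]; rewrite ?normr0.
have -> : (fun w => (run nn k.+1 w).1) = fun w => (run nn k w).1 + D w.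
  by apply/funext => w; exact: (stopped_sumS _ _ _ _).1.
rewrite espD//; last exact: (run_bdd (ltnW kn)).
rewrite IH ?(ltnW kn)// add0r /D /zt -(gridS s t nn k).
have [K [_ _ hK]] := const_bound.
apply: (zeta_mean0 (K := K) uF bB ee k0 (grid_lt nn k st) ma).
- exact: mclip cv1 k0.
- exact: mclip cv2 k0.
- by move=> l; exact: mcoord.
- by move=> w /(alive_cond c00)[/hK].
Qed.

Let hit w := [/\ forall u, s <= u <= t -> U (X u w), z0 <= rho (X s w) &
  exists2 u, s <= u <= t & rho (X u w) = 0].

(** What the sum gains on a path that comes within [eps]: [V] rises from at most [V z0] to at least
    [V eps], less 1 for the error. *)
Let Khit := V eps - V z0 - 1.

(** The control [W] varies with the path without a uniform bound, so the expansion is valid only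
    below a mesh depending on [w]; hence a conclusion for all large [nn]. *)
Let pathwise w : regular_path phi n a (X ^~ w) (B ^~ w) s t ->
  \forall nn \near \oo, - c0 <= (run nn nn.+1 w).1 /\
    (hit w -> Qv nn nn.+1 w <= M -> Khit <= (run nn nn.+1 w).1).
Proof.
move=> [lx lb xD [W pW]].
have q0 : 0 <= q%:R :> R by [].
have W0 : 0 <= W t - W s by rewrite subr_ge0; apply: pW.1 => //; exact: ltW.
(* Division by [T] keeps the total error at most 1. The summand [q] allows for the squared sines of
   one more step, since [cond] bounds [Qv] only at the beginning of the step. *)
have [T T0 TE] : exists2 T, 0 < T & W t - W s + (t - s) + (M + q%:R) = T.
  exists (W t - W s + (t - s) + (M + q%:R)) => //.
  by apply: addr_gt0; [apply: ltr_wpDl; rewrite ?subr_gt0|apply: ltr_pwDl].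
have eta0 : 0 < T^-1 by rewrite invr_gt0.
have xU := UU' lx.
have pstep := path_step (U := fun x => is_true (U x)) ee dV dv1 cv2 UN drift normal eps0 s0 pW xD
  (fun l => lx (e l)) (fun l => lb (e l)) xU eta0.
have crho u : s <= u <= t -> {for u, continuous (fun u => rho (X u w))}.
  exact: sqdist_continuous lx.
have [r2 r20 hr2] := segment_unif_cont crho eps0.
have [r1 [r10 hr1]] := filter_ex (filterI (nbhs_right_gt 0) pstep).
near=> nn.
have m1 : (t - s) / nn.+1%:R < r1 by near: nn; exact: grid_mesh.
have m2 : (t - s) / nn.+1%:R < r2 by near: nn; exact: grid_mesh.
pose y k := V (rho (X (tk nn k) w)).
pose err k := T^-1 * (W (tk nn k) - W s + (tk nn k - s) + Qv nn k w).
have stp k : (k < nn.+1)%N -> cond nn w k ->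
    [/\ U' (X (tk nn k.+1) w), eps / 2 <= rho (X (tk nn k.+1) w) &
        y k.+1 - y k <= zt nn w k + (err k.+1 - err k)].
  move=> kn /and4P[Uk ek _ _].
  have /andP[sk kt] := grid_bounds st (ltnW kn).
  have /andP[sk' kt'] := grid_bounds st (kn : (k.+1 <= nn.+1)%N).
  have kk : tk nn k.+1 - tk nn k < r1 by rewrite gridS.
  have [h1 h2 h3] := hr1 _ _ sk (grid_lt nn k st) kt' kk Uk ek.
  split => //; apply: le_trans h3 _; rewrite /zt -(gridS s t nn k) lerD2l.
  rewrite /err -mulrBr; apply: ler_wpM2l; first exact: ltW.
  have -> : Qv nn k.+1 w = Qv nn k w + \sum_l sv nn k w l ^+ 2 by rewrite /Qv big_ord_recr.
  rewrite le_eqVlt; apply/orP; left; apply/eqP; rewrite /sv /tk; ring.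
have y0h : cond nn w 0 -> y 0%N <= V z0.
  move=> /and4P[_ _ _ zs]; rewrite /y /tk grid0; apply: Vmono => //.
  exact: lt_le_trans epsz0.
have yminh k : (k < nn.+1)%N -> cond nn w k -> V N <= y k.+1.
  move=> kn ck; have [/UN zN e2 _] := stp k kn ck.
  by apply: Vmono => //; apply: lt_le_trans e2; rewrite divr_gt0.
have err0h : err 0%N = 0.
  by rewrite /err /tk grid0 !subrr /Qv big_ord0 !addr0 mulr0.
have err1h k : (k < nn.+1)%N -> cond nn w k -> err k.+1 <= 1.
  move=> kn /and4P[_ _ Qk _]; rewrite /err mulrC ler_pdivrMr// mul1r -TE.
  have /andP[sk' kt'] := grid_bounds st (kn : (k.+1 <= nn.+1)%N).
  apply: lerD; first apply: lerD.
  - by rewrite lerD2r; apply: pW.1 => //; exact: le_trans sk'.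
  - by rewrite lerD2r.
  - rewrite /Qv big_ord_recr/=; apply: lerD => //.
    by have /andP[] := sv2 nn k w.
have c0E : V z0 - V N + 1 <= c0 by rewrite /c0 lerD2r ler_norm.
have stp' k (kn : (k < nn.+1)%N) (ck : cond nn w k) : y k.+1 - y k <= zt nn w k + (err k.+1 - err k).
  by have [] := stp k kn ck.
have low k := stopped_sum_ge c00 stp' err0h err1h y0h yminh c0E (k := k).
split; first exact: low.
move=> [Uall zs [u uI xu0]] QM.
have small : exists2 k, (k <= nn.+1)%N & rho (X (tk nn k) w) < eps.
  have [k kn uk] := grid_near nn st uI; exists k => //.
  have := hr2 u (tk nn k) uI (le_lt_trans uk m2).
  by rewrite xu0 sub0r normrN; apply: le_lt_trans; exact: ler_norm.
(* The first grid index with [rho < eps]: all parts of [cond] hold before it, and it is not 0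
   because [rho] starts from at least [z0 >= eps]. *)
have [k kn [ksm kmin]] : exists2 k, (k <= nn.+1)%N & rho (X (tk nn k) w) < eps /\
    forall j, (j < k)%N -> eps <= rho (X (tk nn j) w).
  have ex : exists k, (k <= nn.+1)%N && (rho (X (tk nn k) w) < eps).
    by have [k ? ?] := small; exists k; apply/andP.
  case: (ex_minnP ex) => k /andP[kn ksm] kmin; exists k => //; split => // j jk.
  rewrite leNgt; apply/negP => jsm; have := kmin j; rewrite jsm andbT.
  by move=> /(_ (leq_trans (ltnW jk) kn)); rewrite leqNgt jk.
have k_gt0 : (0 < k)%N.
  case: (k) ksm => // h; exfalso; move: h; rewrite /tk grid0 ltNge => /negP; apply.
  exact: le_trans zs.
have cj j : (j < k)%N -> cond nn w j.
  move=> jk; apply/and4P; split => //.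
  - apply: Uall; apply: grid_bounds => //; exact: leq_trans (ltnW jk) kn.
  - exact: kmin.
  - apply: le_trans QM; rewrite /Qv -!(big_mkord xpredT (fun j => \sum_l sv nn j w l ^+ 2)).
    rewrite [leRHS](@big_cat_nat _ _ _ j)//=; last exact: leq_trans (ltnW jk) kn.
    by rewrite lerDl sumr_ge0// => i _; have /andP[] := sv2 nn i w.
case: k k_gt0 kn ksm {kmin} cj => // k _ kn ksm cj.
apply: (stopped_sum_hit c00 stp' err0h err1h y0h yminh c0E kn) => //.
  by rewrite /cond (lt_geF ksm) andbF.
have [_ e2 _] := stp k kn (cj k (ltnSn k)).
apply: Vmono; last exact: ltW.
by apply: lt_le_trans e2; rewrite divr_gt0.
Unshelve. all: by end_near. Qed.


Let Fmeas_set u (b : Omega -> bool) : 0 <= u -> Fmeas (F u) b ->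
  measurable [set w | b w].
Proof.
move=> u0 /(FmeasP _ (filtration_subsigma uF u0)) /(_ [set true]) mb.
apply: (filtration_subsigma uF u0).2; have := mb I.
by congr (F u _); apply/seteqP; split => w /=; case: (b w).
Qed.

Context (Nul : set Omega).
Hypothesis nNul : P.-negligible Nul.
Hypothesis Nulreg : forall w, ~ Nul w -> regular_path phi n a (X ^~ w) (B ^~ w) s t.

(** The stopped sum has mean 0 and is above [- c0] outside a rare event, so it reaches [Khit] with
    probability at most [(c0 + 1) / (Khit + c0)]. The other term is Markov's inequality for the sum
    of squared sines, whose mean is at most [q * (t - s)]. *)
Lemma hitting_cover : 0 < Khit + c0 ->
  exists S, [/\ measurable S, [set w | hit w] `\` Nul `<=` S &
    (P S <= ((c0 + 1) / (Khit + c0) + q%:R * (t - s) / M)%:E)%E].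
Proof.
move=> K0.
have [C C0 hC] := zt_bound.
have t0 : 0 <= t by exact: le_trans (ltW st).
have tE nn : tk nn nn.+1 = t by exact: gridn.
have mrunt nn : Fmeas (F t) (fun w => (run nn nn.+1 w).1).
  by have [] := mrun (leqnn nn.+1); rewrite tE.
have mQt nn : Fmeas (F t) (Qv nn nn.+1) by have := mQ (leqnn nn.+1); rewrite tE.
have mc (c : R) : Fmeas (F t) (fun=> c) by exact: Fmeas_cst.
pose E1 nn := [set w | Khit <= (run nn nn.+1 w).1].
pose E2 nn := [set w | M < Qv nn nn.+1 w].
pose E3 nn := [set w | - c0 <= (run nn nn.+1 w).1].
have mE1 nn : measurable (E1 nn).
  by apply: (Fmeas_set t0 (b := fun w => Khit <= (run nn nn.+1 w).1)); exact: Fmeas_le.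
have mE2 nn : measurable (E2 nn).
  by apply: (Fmeas_set t0 (b := fun w => M < Qv nn nn.+1 w)); exact: Fmeas_lt.
have mE3 nn : measurable (E3 nn).
  by apply: (Fmeas_set t0 (b := fun w => - c0 <= (run nn nn.+1 w).1)); exact: Fmeas_le.
have near_path w : ~ Nul w -> \forall nn \near \oo, - c0 <= (run nn nn.+1 w).1 /\
    (hit w -> Qv nn nn.+1 w <= M -> Khit <= (run nn nn.+1 w).1).
  by move=> /Nulreg; exact: pathwise.
(* Where the grid is too coarse the sum may fall to [- c0 - C]; a probability of at most
   [1 / (C + 1)] limits the loss to 1 in the mean. *)
have p0 : 0 < (C + 1)^-1 by rewrite invr_gt0 ltr_wpDl.
have [n0 _ hn0] : \forall nn \near \oo, (P (~` E3 nn) <= ((C + 1)^-1)%:E)%E.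
  apply: ae_near_prob => //; move: nNul; apply: negligibleS => w /= nE.
  apply: contrapT => /near_path h; apply: nE.
  by apply: filterS h => nn [].
apply: (@liminf_cover _ _ _ P _ (fun nn => E1 nn `|` E2 nn) n0).
- by move=> nn; exact: measurableU.
- move=> nn /hn0 p3.
  apply: (le_trans (measureU2 _ _ _)) => //; rewrite EFinD; apply: leeD.
  + rewrite -[X in (X <= _)%E]fineK ?fin_num_measure// lee_fin -esp_indic//.
    rewrite ler_pdivlMr// mulrC.
    have b3 : bddmeas (\1_(~` E3 nn) : Omega -> R) by apply: bddmeas_indic; exact: measurableC.
    have b1 : bddmeas (\1_(E1 nn) : Omega -> R) by exact: bddmeas_indic.
    have q3 : esp P (\1_(~` E3 nn)) <= (C + 1)^-1.
      rewrite esp_indic; last exact: measurableC.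
      by rewrite -lee_fin fineK// fin_num_measure//; exact: measurableC.
    (* A lower bound of the stopped sum, affine in the two indicators; comparing means bounds the
       probability of [E1]. *)
    have bl : bddmeas (fun w => (Khit + c0) * \1_(E1 nn) w - C * \1_(~` E3 nn) w - c0).
      apply: bddmeasB; last exact: bddmeas_cst.
      by apply: bddmeasB; apply: bddmeasM => //; exact: bddmeas_cst.
    have := @le_esp _ _ _ P _ _ bl (run_bdd (leqnn nn.+1)).
    rewrite run_mean0// espB; [|by apply: bddmeasB; apply: bddmeasM => //; exact: bddmeas_cst
      |exact: bddmeas_cst].
    rewrite espB ?espZ ?esp_cst//; [|by apply: bddmeasM => //; exact: bddmeas_cst
      |by apply: bddmeasM => //; exact: bddmeas_cst].
    have hp : C * esp P (\1_(~` E3 nn)) <= 1.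
      apply: le_trans (ler_wpM2l C0 q3) _; rewrite ler_pdivrMr ?mul1r ?lerDl//.
      by rewrite ltr_wpDl.
    move=> h; suff : (Khit + c0) * esp P (\1_(E1 nn)) - C * esp P (\1_(~` E3 nn)) - c0 <= 0.
      by move: hp; lra.
    apply: h => w; rewrite !indicE.
    have low := stopped_sum_lower c00 (nn.+1) C0 (hC nn w).
    rewrite -/(run nn nn.+1 w) in low.
    have -> : (w \in E1 nn) = (Khit <= (run nn nn.+1 w).1) by apply/idP/idP; rewrite inE.
    have -> : (w \in ~` E3 nn) = ((run nn nn.+1 w).1 < - c0).
      by rewrite ltNge in_setC; congr negb; apply/idP/idP; rewrite inE.
    move: K0 C0 low; case: (leP Khit) => h1; case: (ltP _ (- c0)) => h2 /=;
      rewrite ?mulr1 ?mulr0; lra.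
  + rewrite -[X in (X <= _)%E]fineK ?fin_num_measure// lee_fin -esp_indic//.
    rewrite ler_pdivlMr// mulrC -espZ; last exact: bddmeas_indic.
    apply: le_trans (esp_Q nn); apply: le_esp.
    * by apply: bddmeasM; [exact: bddmeas_cst|exact: bddmeas_indic].
    * exact: Q_bdd.
    * move=> w; rewrite indicE; case: (boolP (w \in E2 nn)) => [|_].
        by rewrite inE /E2/= mulr1 => /ltW.
      by rewrite mulr0 sumr_ge0// => k _; have /andP[] := sv2 nn k w.
- move=> w [hw /near_path]; apply: filterS => nn [_ h]; rewrite /E1 /E2/=.
  by have [Q|Q] := leP (Qv nn nn.+1 w) M; [left; exact: h|right].
Qed.

End Fixed.

(** [c] does not involve [eps], so the divergence of [V] at 0 makes the first term of the cover
    small; a large [M] does it for the second. *)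
Lemma hitting_negligible (z0 : R) : 0 < z0 ->
  {ae P, forall w, regular_path phi n a (X ^~ w) (B ^~ w) s t} ->
  P.-negligible [set w | [/\ forall u, s <= u <= t -> U (X u w), z0 <= sqdist e x0 (X s w) &
    exists2 u, s <= u <= t & sqdist e x0 (X u w) = 0]].
Proof.
move=> z00 aereg; apply: (negligible_small aereg) => r r0.
pose c := `|V z0 - V N| + 1.
have c0 : 0 < c by rewrite ltr_wpDl.
have [eps eps0 hV] := Vdiv (V z0 + 1 + 4 * (c + 1) / r).
have Vpos : 0 < 4 * (c + 1) / r by rewrite divr_gt0// mulr_gt0// addr_gt0.
have epsz0 : eps <= z0.
  rewrite leNgt; apply/negP => /ltW /(Vmono z00); move: hV Vpos; lra.
have M0 : 0 < 4 * (q%:R * (t - s)) / r + 1.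
  apply: ltr_wpDl => //; apply: divr_ge0; last exact: ltW.
  by apply: mulr_ge0 => //; apply: mulr_ge0 => //; rewrite subr_ge0 ltW.
have K0 : 0 < V eps - V z0 - 1 + c by move: hV Vpos c0; lra.
have [w0 w1|S [mS hS PS]] := hitting_cover eps0 epsz0 M0 aereg _ K0.
  exact: contrapT.
exists S; split => //; apply: le_trans PS _; rewrite lee_fin.
have h1 : (c + 1) / (V eps - V z0 - 1 + c) <= r / 2.
  rewrite ler_pdivrMr//.
  have : 4 * (c + 1) / r <= V eps - V z0 - 1 + c by move: hV c0; lra.
  rewrite ler_pdivrMr// => h; rewrite mulrC mulrA ler_pdivlMr//; move: h c0; lra.
have h2 : q%:R * (t - s) / (4 * (q%:R * (t - s)) / r + 1) <= r / 2.
  rewrite ler_pdivrMr//.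
  have -> : r / 2 * (4 * (q%:R * (t - s)) / r + 1) = 2 * (q%:R * (t - s)) + r / 2.
    by field; rewrite gt_eqF.
  have : 0 <= q%:R * (t - s) by rewrite mulr_ge0// subr_ge0 ltW.
  by move: r0; lra.
by move: h1 h2; rewrite -/c; lra.
Qed.

End Hitting.

(** * Lyapunov functions with prescribed weight *)

Section ConvexDerivative.
Context {R : realType}.

(** Both derivatives are compared with the slope of the chord from [x] to [y]. A strict inequality
    the wrong way would pass to a difference quotient of step [h <= y - x], against convexity. *)
Lemma convex_derive1_mono (f : R -> \bar R) (x y : R) : econvex f ->
  (forall u, 0 < u -> f u \is a fin_num) ->
  (forall u : R, 0 < u -> derivable (fin_part f) u 1) ->
  0 < x -> x <= y -> derive1 (fin_part f) x <= derive1 (fin_part f) y.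
Proof.
move=> [_ cf] ff df x0; rewrite le_eqVlt => /predU1P[->//|xy].
set g := fin_part f.
have y0 : 0 < y by exact: lt_trans xy.
have conv (u v l : R) : 0 < u -> 0 < v -> 0 <= l <= 1 ->
    g (l * u + (1 - l) * v) <= l * g u + (1 - l) * g v.
  move=> u0 v0 l01; have := cf u v l l01.
  have w0 : 0 < l * u + (1 - l) * v by case/andP: l01 => l0 l1; nra.
  rewrite -(fineK (ff _ u0)) -(fineK (ff _ v0)) -(fineK (ff _ w0)).
  by rewrite -!EFinM -EFinD lee_fin.
have quot (u : R) : 0 < u -> (fun h : R => h^-1 *: (g (h + u) - g u)) @ 0^' --> derive1 g u.
  move=> u0; have := df u u0; rewrite /derivable => du.
  have -> : derive1 g u = 'D_1 g u by rewrite derive1E.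
  rewrite /derive; move: du.
  by under eq_fun do rewrite /GRing.scale/= mulr1.
pose sl := (g y - g x) / (y - x).
have yx : 0 < y - x by rewrite subr_gt0.
apply: (@le_trans _ _ sl).
  rewrite leNgt; apply/negP => sl1.
  have := quot x x0 => /cvgr_gt /(_ _ sl1).
  rewrite !near_withinE near_nbhs => /nbhs_ballP[r /= r0 hr].
  pose h := Num.min (r / 2) (y - x).
  have h0 : 0 < h by rewrite lt_min divr_gt0.
  have hr' : h < r by rewrite /h gt_min ltr_pdivrMr// ltr_pMr// ltr1n.
  have hyx : h <= y - x by rewrite /h ge_min lexx orbT.
  have := hr h _ _; rewrite /ball/= sub0r normrN gtr0_norm// => /(_ hr' (lt0r_neq0 h0)).
  apply/negP; rewrite -leNgt.
  have l01 : 0 <= 1 - h / (y - x) <= 1.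
    by rewrite subr_ge0 ler_pdivrMr// mul1r hyx/= lerBlDr lerDl divr_ge0// ltW.
  have := conv x y (1 - h / (y - x)) x0 y0 l01.
  have -> : (1 - h / (y - x)) * x + (1 - (1 - h / (y - x))) * y = h + x.
    by field; rewrite gt_eqF.
  move=> c; rewrite /GRing.scale/= mulrC ler_pdivrMr// /sl.
  have -> : (g y - g x) / (y - x) * h = h / (y - x) * (g y - g x) by ring.
  by move: c; lra.
rewrite leNgt; apply/negP => sl1.
have := quot y y0 => /cvgr_lt /(_ _ sl1).
rewrite !near_withinE near_nbhs => /nbhs_ballP[r /= r0 hr].
pose h := Num.min (r / 2) (y - x).
have h0 : 0 < h by rewrite lt_min divr_gt0.
have hr' : h < r by rewrite /h gt_min ltr_pdivrMr// ltr_pMr// ltr1n.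
have hyx : h <= y - x by rewrite /h ge_min lexx orbT.
have nh0 : - h != 0 by rewrite oppr_eq0 gt_eqF.
have := hr (- h) _ _; rewrite /ball/= sub0r opprK gtr0_norm// => /(_ hr' nh0).
apply/negP; rewrite -leNgt.
have l01 : 0 <= h / (y - x) <= 1 by rewrite divr_ge0 ?ler_pdivrMr ?mul1r// ltW.
have := conv x y (h / (y - x)) x0 y0 l01.
have -> : h / (y - x) * x + (1 - h / (y - x)) * y = - h + y.
  by field; rewrite gt_eqF.
move=> c; rewrite /GRing.scale/= invrN mulNr -mulrN mulrC ler_pdivlMr// /sl.
have -> : (g y - g x) / (y - x) * h = h / (y - x) * (g y - g x) by ring.
by move: c; lra.
Qed.

End ConvexDerivative.

Section Antiderivative.
Context {R : realType} (w : R -> R).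
Hypothesis cw : forall y : R, 0 < y -> {for y, continuous w}.

(** The signed integral from [y] to 1, one of the two intervals being empty. Values above 1 occur,
    the distance not being confined to the unit interval. *)
Definition tail_integral (y : R) : R :=
  \int[lebesgue_measure]_(u in `]y, 1]) w u - \int[lebesgue_measure]_(u in `]1, y]) w u.

Let integrable_cc (x y : R) : 0 < x ->
  lebesgue_measure.-integrable `[x, y] (EFin \o w).
Proof.
move=> x0; apply: continuous_compact_integrable; first exact: segment_compact.
apply: continuous_in_subspaceT => u; rewrite inE/= in_itv/= => /andP[xu _].
by apply: cw; exact: lt_le_trans xu.
Qed.

Let integrable_oc (x y : R) : 0 < x ->
  lebesgue_measure.-integrable `]x, y] (EFin \o w).
Proof.
move=> x0; apply: integrableS (integrable_cc y x0) => //.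
by apply: subset_itvr; rewrite bnd_simp.
Qed.

Let tail_integralE (x y : R) : 0 < x -> x < y -> x < 1 -> tail_integral y =
  \int[lebesgue_measure]_(u in `]x, 1]) w u - \int[lebesgue_measure]_(u in `]x, y]) w u.
Proof.
move=> x0 xy x1; rewrite /tail_integral.
have [y1|y1] := leP y 1.
  rewrite [`]1, y]%classic]set_itv_ge ?bnd_simp -?leNgt// Rintegral_set0 subr0.
  rewrite -(@Rintegral_itvB _ w (BRight x) (BRight 1) y)//; first exact: integrable_oc.
  by rewrite bnd_simp ltW.
rewrite [`]y, 1]%classic]set_itv_ge ?bnd_simp -?leNgt ?(ltW y1)// Rintegral_set0 sub0r.
rewrite -(@Rintegral_itvB _ w (BRight x) (BRight y) 1) ?bnd_simp ?ltW ?opprB//.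
exact: integrable_oc.
Qed.

Lemma is_derive_tail_integral (y : R) : 0 < y -> is_derive y 1 tail_integral (- w y).
Proof.
(* A base point below both [y] and 1 and away from 0, near which [w] may fail to be integrable. *)
move=> y0; pose x := Num.min y 1 / 2.
have m0 : 0 < Num.min y 1 by rewrite lt_min y0 ltr01.
have x0 : 0 < x by rewrite divr_gt0.
have xm : x < Num.min y 1 by rewrite ltr_pdivrMr// ltr_pMr// ltr1n.
have xy : x < y by apply: lt_le_trans xm _; rewrite ge_min lexx.
have x1 : x < 1 by apply: lt_le_trans xm _; rewrite ge_min lexx orbT.
have yy1 : y < y + 1 by rewrite ltrDl.
have xy' : (BRight x < BRight y)%O by rewrite bnd_simp.
have [dF F'] := @continuous_FTC1 R w (BRight x) y (y + 1) yy1
  (integrable_oc (y + 1) x0) xy' (cw y0).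
have idF : is_derive y 1 (fun y => \int[lebesgue_measure]_(u in `]x, y]) w u) (w y).
  by apply: DeriveDef; [exact: dF|rewrite -derive1E; exact: F'].
apply: (@near_eq_is_derive _ _ _ (fun y =>
  \int[lebesgue_measure]_(u in `]x, 1]) w u - \int[lebesgue_measure]_(u in `]x, y]) w u)).
  have : \forall z \near y, x < z by exact: lt_nbhsr.
  by apply: filterS => z xz; rewrite (tail_integralE x0 xz x1).
by apply: is_derive_eq; rewrite add0r mul1r.
Qed.

(** Monotone convergence along the intervals from [1 / (i + 1)] to 1. *)
Lemma tail_integral_diverges : (forall y, 0 < y -> 0 <= w y) ->
  (\int[lebesgue_measure]_(u in `]0%R, 1%R]) (w u)%:E = +oo)%E ->
  forall C : R, exists2 y : R, 0 < y & C <= tail_integral y.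
Proof.
move=> w0 wdiv C.
pose I (i : nat) : set R := `]i.+1%:R^-1, 1]%classic.
have iv0 (i : nat) : 0 < i.+1%:R^-1 :> R by rewrite invr_gt0.
have Iint i : lebesgue_measure.-integrable (I i) (EFin \o w) by exact: integrable_oc.
have ndI : nondecreasing_seq I.
  move=> i j ij; rewrite subsetEset /I; apply: subset_itvr; rewrite bnd_simp.
  by rewrite lef_pV2 ?posrE// ler_nat ltnS.
have UI : \bigcup_i I i = `]0, 1]%classic.
  apply/seteqP; split => u /=.
    move=> [i _]; rewrite /I/= !in_itv/= => /andP[iu ->]; rewrite andbT.
    exact: lt_trans iu.
  rewrite in_itv/= => /andP[u0 u1]; exists (Num.truncn u^-1) => //.
  rewrite /I/= in_itv/= u1 andbT -[ltRHS]invrK ltf_pV2 ?posrE ?invr_gt0//.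
  exact: truncnS_gt.
have Ipos i u : I i u -> (0 <= (EFin \o w) u)%E.
  rewrite /I/= in_itv/= lee_fin => /andP[iu _]; apply: w0; exact: lt_trans iu.
have : (fun i => \int[lebesgue_measure]_(u in I i) (w u)%:E)%E @ \oo --> +oo%E.
  rewrite -wdiv -UI; exact: (@ge0_nondecreasing_set_cvg_integral _ (measurableTypeR R) R I
    (EFin \o w) lebesgue_measure ndI (fun i => measurable_itv _)
    (fun i => measurable_int _ (Iint i)) Ipos).
move=> /cvgeyPge /(_ C)[k _ /(_ k (leqnn k))] h.
exists k.+1%:R^-1; first exact: iv0.
have k1 : k.+1%:R^-1 <= 1 :> R by rewrite invf_le1// ler1n.
rewrite /tail_integral [`]1, _]%classic]set_itv_ge ?bnd_simp -?leNgt// Rintegral_set0 subr0.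
rewrite -lee_fin /Rintegral fineK//.
by apply: integrable_fin_num => //; exact: Iint.
Qed.

End Antiderivative.

Section Lyapunov.
Context {R : realType} (w w1 G : R -> R).
Hypothesis w0 : forall y : R, 0 < y -> 0 < w y.
Hypothesis dw : forall y : R, 0 < y -> is_derive y 1 w (w1 y).
Hypothesis cw1 : forall y : R, 0 < y -> {for y, continuous w1}.
Hypothesis dG : forall y : R, 0 < y -> is_derive y 1 G (- w y).
Hypothesis Gdiv : forall C : R, exists2 y : R, 0 < y & C <= G y.

Let V z := 2 * G (Num.sqrt z).
Let v1 z := - w (Num.sqrt z) / Num.sqrt z.
Let v2 z := - (w1 (Num.sqrt z) - w (Num.sqrt z) / Num.sqrt z) / (2 * Num.sqrt z ^+ 2).

(** The factor 2 in [V] cancels the one in the derivative [1 / (2 y)] of the square root. The last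
    clause gives the derivatives at [y ^+ 2] in the form in which they enter the generator. *)
Lemma lyapunov_exists : exists V v1 v2 : R -> R,
  [/\ forall z : R, 0 < z -> is_derive z 1 V (v1 z) /\ is_derive z 1 v1 (v2 z),
      forall z : R, 0 < z -> {for z, continuous v2},
      forall z z' : R, 0 < z -> z <= z' -> V z' <= V z,
      forall C : R, exists2 z, 0 < z & C <= V z &
      forall y : R, 0 < y -> v1 (y ^+ 2) = - w y / y /\
        2 * v2 (y ^+ 2) * y ^+ 2 = - (w1 y - w y / y)].
Proof.
have sq (z : R) : 0 < z -> 0 < Num.sqrt z by move=> z0; rewrite sqrtr_gt0.
have sqK (y : R) : 0 < y -> Num.sqrt (y ^+ 2) = y by move=> y0; rewrite sqrtr_sqr gtr0_norm.
have dsq (z : R) : 0 < z -> is_derive z 1 Num.sqrt (2 * Num.sqrt z)^-1.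
  by move=> z0; exact: is_derive1_sqrt.
have dV (z : R) : 0 < z -> is_derive z 1 V (v1 z).
  move=> z0; have d1 := dG (sq z z0); have d2 := dsq z z0.
  have d3 := @is_derive1_comp R G Num.sqrt z _ _ d1 d2.
  apply: is_derive_eq; rewrite /GRing.scale/= /v1 /=.
  by field; rewrite gt_eqF// sq.
have dv1 (z : R) : 0 < z -> is_derive z 1 v1 (v2 z).
  move=> z0; have d1 := dw (sq z z0); have d2 := dsq z z0.
  have d3 := @is_derive1_comp R w Num.sqrt z _ _ d1 d2.
  have nz : Num.sqrt z != 0 by rewrite gt_eqF// sq.
  have d4 := @is_deriveV R Num.sqrt z _ 1 nz d2.
  apply: is_derive_eq; rewrite /GRing.scale/= /v2 /=.
  by field.
exists V, v1, v2; split.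
- by move=> z z0; split; [exact: dV|exact: dv1].
- move=> z z0; have csq : {for z, continuous (@Num.sqrt R)} by exact: sqrt_continuous.
  have cw : {for Num.sqrt z, continuous w}.
    by have [d _] := dw (sq z z0); exact/differentiable_continuous/derivable1_diffP.
  have ci : {for z, continuous (fun z => (Num.sqrt z)^-1)}.
    by apply: continuousV; [rewrite gt_eqF// sq|exact: csq].
  have cc1 : {for z, continuous (fun z => w1 (Num.sqrt z))}.
    by apply: continuous_comp => //; apply: cw1; exact: sq.
  have cc : {for z, continuous (fun z => w (Num.sqrt z))}.
    exact: continuous_comp.
  apply: continuousM.
    apply: continuousN; apply: continuousB => //; exact: continuousM.
  apply: continuousV; first by rewrite mulf_neq0// expf_neq0// gt_eqF// sq.
  apply: continuousM; first exact: cst_continuous.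
  apply: (@continuous_comp _ _ _ Num.sqrt (fun z => z ^+ 2)) => //.
  exact: exprn_continuous.
- move=> z z' z0 zz'.
  have dV' (u : R) : z <= u <= z' -> is_derive u 1 V (v1 u).
    by case/andP => zu _; apply: dV; exact: lt_le_trans zu.
  have zI : z <= z <= z' by rewrite lexx.
  have z'I : z <= z' <= z' by rewrite lexx andbT.
  have [u [_ /andP[zu _]]] := MVT_between dV' zI z'I.
  move=> h; rewrite -subr_le0 h; apply: mulr_le0_ge0; last by rewrite subr_ge0.
  have u0 : 0 < u by exact: lt_le_trans zu.
  by rewrite /v1 mulNr oppr_le0 divr_ge0// ltW// ?w0// sq.
- move=> C; have [y y0 hy] := Gdiv (C / 2).
  exists (y ^+ 2); first exact: exprn_gt0.
  by rewrite /V sqK// mulrC -ler_pdivrMr.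
- move=> y y0; rewrite /v1 /v2 sqK//; split=> //.
  by field; rewrite gt_eqF.
Qed.

End Lyapunov.

(** * Strata of the boundary *)

Section Stratum.
Context {R : realType} (d m : nat) (phi : 'I_m -> R -> \bar R)
  (n : 'I_m -> 'rV[R]_d) (a : 'I_m -> R).
Hypothesis dphi_mono : forall k (x y : R), 0 < x -> x <= y ->
  derive1 (fin_part (phi k)) x <= derive1 (fin_part (phi k)) y.
Hypothesis n1 : forall k, dotv (n k) (n k) = 1.

Definition gap k (x : 'rV[R]_d) : R := dotv x (n k) - a k.

Context (q : nat) (e : 'I_q -> 'rV[R]_d) (x0 : 'rV[R]_d) (S : {set 'I_m}).
Hypothesis ee : forall l l', dotv (e l) (e l') = (l == l')%:R.
Hypothesis ne : forall k w, k \in S ->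
  dotv (n k) w = \sum_l dotv (n k) (e l) * dotv (e l) w.
Hypothesis x0S : forall k, k \in S -> dotv x0 (n k) = a k.

Lemma projto_face k x : k \in S -> dotv (projto e x0 x) (n k) = gap k x.
Proof.
move=> kS; rewrite /projto dotv_suml /gap -(x0S kS) -dotvBl dotvC (ne _ kS).
by apply: eq_bigr => l _; rewrite dotvZl mulrC (dotvC (n k)).
Qed.

Lemma projto_sqdist x : dotv (projto e x0 x) (projto e x0 x) = sqdist e x0 x.
Proof.
rewrite /projto dotv_suml; apply: eq_bigr => l _; rewrite dotvZl dotvC dotv_suml.
rewrite (bigD1 l)//= big1 => [|l' /negPf h]; last by rewrite dotvZl ee h mulr0.
by rewrite dotvZl ee eqxx mulr1 addr0 expr2.
Qed.

Lemma projto_le k x : `|dotv (projto e x0 x) (n k)| <= Num.sqrt (sqdist e x0 x).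
Proof.
rewrite -sqrtr_sqr ler_wsqrtr// -projto_sqdist dotvC.
exact: dotv_le_sqr.
Qed.

(** The bounds on the faces outside [S] keep these away and confine the arguments of their [phi_k']
    to a compact part of the half-line. A boolean, so that it can serve as a stopping condition. *)
Definition stratum_nbhd (r : R) (x : 'rV[R]_d) : bool :=
  all (fun k => (k \in S) || ((r < gap k x) && (gap k x < r^-1))) (enum 'I_m) &&
  (sqdist e x0 x < r^-1).

Lemma stratum_nbhdP r x : reflect
  ((forall k, k \notin S -> r < gap k x < r^-1) /\ sqdist e x0 x < r^-1)
  (stratum_nbhd r x).
Proof.
apply: (iffP andP) => -[h1 h2]; split => //.
  by move=> k kS; have /allP/(_ k) := h1; rewrite mem_enum (negPf kS) => /(_ isT).
by apply/allP => k _; case: (boolP (k \in S)) => //= kS; exact: h1.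
Qed.

(** A small move along [p], in either direction, multiplies the gaps of [S] by a nonnegative factor
    and changes the others by at most [r]. An inward normal is therefore both nonnegative and
    nonpositive on [p]. *)
Lemma stratum_normal (r : R) x v : 0 < r -> stratum_nbhd r x -> Dbar n a x ->
  unit_inward_normal n a v x -> dotv (projto e x0 x) v = 0.
Proof.
move=> r0 /stratum_nbhdP[hS _] Dx [_ hv].
set p := projto e x0 x; set y := Num.sqrt (sqdist e x0 x).
have y0 : 0 <= y by exact: sqrtr_ge0.
have y10 : 0 < y + 1 by rewrite ltr_wpDl.
(* [c <= 1] serves the faces of [S] and [c * y <= r] the others; [y + 1] avoids a division by 0. *)
have [c [c0 c1 cy]] : exists c, [/\ 0 < c, c <= 1 & c * y <= r].
  exists (Num.min 1 (r / (y + 1))); split.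
  - by rewrite lt_min ltr01/= divr_gt0.
  - by rewrite ge_min lexx.
  - have : Num.min 1 (r / (y + 1)) <= r / (y + 1) by rewrite ge_min lexx orbT.
    rewrite ler_pdivlMr// mulrDr mulr1; apply: le_trans.
    by rewrite lerDl le_min ler01 divr_ge0// ltW.
(* Both [x + c *: p] and [x - c *: p] stay in the polyhedron. *)
have inD s : `|s| <= c -> Dbar n a (x + s *: p).
  move=> sc k; rewrite dotvDl dotvZl.
  have [kS|kS] := boolP (k \in S).
    rewrite projto_face// /gap; have := Dx k.
    by move: sc; rewrite ler_norml => /andP[]; nra.
  have /andP[h _] := hS k kS.
  have hp : `|s * dotv p (n k)| <= c * y by rewrite normrM ler_pM// projto_le.
  by move: h hp; rewrite /gap ler_norml => h /andP[]; lra.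
have cc : `|c| <= c by rewrite ger0_norm// ltW.
have cN : `|- c| <= c by rewrite normrN.
have := hv _ (inD c cc); have := hv _ (inD (- c) cN).
have E s : dotv v (x - (x + s *: p)) = - (s * dotv p v).
  by rewrite dotvBr dotvDr dotvZr (dotvC v p); ring.
rewrite !E => h1 h2; have h3 : c * dotv p v = 0 by lra.
by move/eqP: h3; rewrite mulf_eq0 (gt_eqF c0)/= => /eqP.
Qed.

(** The values at [r] and [r^-1] bound the derivative outside [S]. The one at [r^-1 + 1] is for [S],
    where the gap is at most the square root of [r^-1], hence below [r^-1 + 1] whatever [r] is. *)
Definition drift_const (r : R) k : R :=
  let f := derive1 (fin_part (phi k)) in `|f r| + `|f r^-1| + `|f (r^-1 + 1)|.

Lemma mono_norm_le k (x y z : R) : 0 < x -> x <= y -> y <= z ->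
  `|derive1 (fin_part (phi k)) y| <=
  `|derive1 (fin_part (phi k)) x| + `|derive1 (fin_part (phi k)) z|.
Proof.
move=> xp xy yz; have y0 := lt_le_trans xp xy.
have := dphi_mono k xp xy; have := dphi_mono k y0 yz.
set f := derive1 _; rewrite ler_norml => h1 h2.
have := ler_norm (f z); have := normr_ge0 (f z); have := normr_ge0 (f x).
have := ler_norm (- f x); rewrite normrN => *.
by apply/andP; split; lra.
Qed.

(** For [k] in [S] the second factor is the gap, nonnegative and at most the distance, so
    monotonicity suffices even if the derivative tends to [-oo] at 0. Outside [S] the derivative is
    bounded on both sides. *)
Lemma drift_term_le (r : R) x k : 0 < r -> stratum_nbhd r x -> Dbar n a x ->
  derive1 (fin_part (phi k)) (gap k x) * dotv (projto e x0 x) (n k) <=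
  drift_const r k * Num.sqrt (sqdist e x0 x).
Proof.
move=> r0 /stratum_nbhdP[hS hz] Dx.
have z0 : 0 <= sqdist e x0 x by apply: sumr_ge0 => l _; exact: sqr_ge0.
have pk := projto_le k x; move: pk; rewrite /drift_const.
set y := Num.sqrt _; set f := derive1 _ => pk.
have y0 : 0 <= y by exact: sqrtr_ge0.
have [kS|kS] := boolP (k \in S); last first.
  have /andP[h1 h2] := hS k kS.
  have h := mono_norm_le k r0 (ltW h1) (ltW h2).
  apply: le_trans (ler_norm _) _; rewrite normrM; apply: ler_pM => //.
  by apply: le_trans h _; rewrite lerDl.
rewrite projto_face// in pk *.
have g0 : 0 <= gap k x by rewrite /gap subr_ge0; exact: Dx.
rewrite ger0_norm// in pk.
have ri : 0 < r^-1 by rewrite invr_gt0.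
have yr : y <= r^-1 + 1.
  rewrite -[leRHS]gtr0_norm ?addr_gt0// -sqrtr_sqr ler_wsqrtr//.
  by apply: (le_trans (ltW hz)); nra.
(* At gap 0 the value of the derivative carries no meaning, but it is multiplied by the gap. *)
move: g0; rewrite le_eqVlt => /predU1P[<-|g0].
  by rewrite mulr0 mulr_ge0// !addr_ge0.
have fle : f (gap k x) <= f (r^-1 + 1) by apply: dphi_mono => //; exact: le_trans yr.
apply: (@le_trans _ _ (`|f (r^-1 + 1)| * gap k x)).
  by apply: ler_wpM2r; [exact: ltW|exact: le_trans fle (ler_norm _)].
by apply: ler_pM => //; [exact: ltW|rewrite lerDr addr_ge0].
Qed.

Lemma stratum_nbhdS (r : R) x : 0 < r -> stratum_nbhd r x -> stratum_nbhd (r / 2) x.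
Proof.
move=> r0 /stratum_nbhdP[hS hz]; have ri : 0 < r^-1 by rewrite invr_gt0.
have E : (r / 2)^-1 = r^-1 * 2 by field; rewrite gt_eqF.
apply/stratum_nbhdP; rewrite E; split; last by lra.
by move=> k /hS; lra.
Qed.

(** Halving [r] doubles the upper bounds; as [r <= 1], a displacement below [r / 2] respects upper
    and lower bounds alike. *)
Lemma stratum_nbhd_near (r s t : R) (x : R -> 'rV[R]_d) : 0 < r -> r <= 1 ->
  dotv_continuous x s t ->
  \forall r' \near 0^'+, forall u v : R, s <= u <= t -> s <= v <= t ->
    `|u - v| < r' -> stratum_nbhd r (x u) -> stratum_nbhd (r / 2) (x v).
Proof.
move=> r0 r1 lx; have r20 : 0 < r / 2 by rewrite divr_gt0.
have ri : 1 <= r^-1 by rewrite invf_ge1.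
have E : (r / 2)^-1 = r^-1 * 2 by field; rewrite gt_eqF.
have nu (f : R -> R) : (forall u, s <= u <= t -> {for u, continuous f}) ->
    \forall r' \near 0^'+, forall u v : R, s <= u <= t -> `|u - v| < r' -> `|f u - f v| < r / 2.
  move=> cf; have [r2 r2p hr2] := segment_unif_cont cf r20.
  have : \forall r' \near 0^'+, r' < r2 by exact: nbhs_right_lt.
  by apply: filterS => r' r'r2 u v uI uv; apply: hr2 => //; exact: lt_trans r'r2.
have h1 : \forall r' \near 0^'+, forall k (u v : R), s <= u <= t -> `|u - v| < r' ->
    `|gap k (x u) - gap k (x v)| < r / 2.
  apply: filter_forall => k; apply: (nu (fun u => gap k (x u))) => u uI.
  rewrite (_ : (fun _ => _) = fun u => dotv (n k) (x u) - a k); last first.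
    by apply/funext => v; rewrite /gap dotvC.
  by apply: continuousB; [exact: lx|exact: cst_continuous].
have h2 := nu (fun u => sqdist e x0 (x u)) (fun u uI => sqdist_continuous lx uI).
apply: filterS (filterI h1 h2) => r' [H1 H2] u v uI vI uv /stratum_nbhdP[hS hz].
apply/stratum_nbhdP; rewrite E; split.
  move=> k /hS; have := H1 k u v uI uv; rewrite ltr_distl; lra.
by have := H2 u v uI uv; rewrite ltr_distl; lra.
Qed.

Section Negligible.
Context {dO : measure_display} {Omega : measurableType dO}
  (P : probability Omega R) (F : R -> set (set Omega))
  (B : R -> Omega -> 'rV[R]_d) (X : R -> Omega -> 'rV[R]_d).
Hypothesis uF : usual_filtration P F.
Hypothesis bB : brownian P F B.
Hypothesis aX : adaptedv F X.

Lemma stratum_nbhd_Fmeas (r u : R) : 0 <= u -> Fmeas (F u) (fun w => stratum_nbhd r (X u w)).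
Proof.
move=> u0.
have mX v : Fmeas (F u) (fun w => dotv v (X u w)).
  by apply: Fmeas_dotv => j; exact: (adapted_Fmeas uF (aX j)).
have mc (c : R) : Fmeas (F u) (fun=> c) by exact: Fmeas_cst.
apply: Fmeas_and.
  apply: (Fmeas_all (enum 'I_m) (a := fun k w => (k \in S) ||
    ((r < gap k (X u w)) && (gap k (X u w) < r^-1)))) => k.
  case: (k \in S); first exact: measurable_cst.
  have mg : Fmeas (F u) (fun w => gap k (X u w)).
    rewrite (_ : (fun w => _) = fun w => dotv (n k) (X u w) - a k).
      exact: FmeasB.
    by apply/funext => w; rewrite /gap dotvC.
  by apply: Fmeas_and; exact: Fmeas_lt.
apply: Fmeas_lt => //; apply: Fmeas_sum => l.
apply: (Fmeas_continuous (f := fun z => z ^+ 2)); first exact: exprn_continuous.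
rewrite (_ : (fun w => _) = fun w => dotv (e l) (X u w) - dotv (e l) x0).
  exact: FmeasB.
by apply/funext => w; rewrite /coord_to dotvBr.
Qed.

Context (w w1 G : R -> R) (r : R).
Hypothesis w0 : forall y : R, 0 < y -> 0 < w y.
Hypothesis dw : forall y : R, 0 < y -> is_derive y 1 w (w1 y).
Hypothesis cw1 : forall y : R, 0 < y -> {for y, continuous w1}.
Hypothesis dG : forall y : R, 0 < y -> is_derive y 1 G (- w y).
Hypothesis Gdiv : forall C : R, exists2 y : R, 0 < y & C <= G y.
Hypothesis r0 : 0 < r.
Hypothesis r1 : r <= 1.
Hypothesis wdrift : forall x, stratum_nbhd (r / 2) x -> Dbar n a x ->
  0 < sqdist e x0 x ->
  2 * dotv (projto e x0 x) (gradPhi phi n a x) <=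
  q%:R - 1 + Num.sqrt (sqdist e x0 x) * w1 (Num.sqrt (sqdist e x0 x)) /
    w (Num.sqrt (sqdist e x0 x)).

Lemma stratum_negligible (s t z0 : R) : 0 <= s -> s < t -> 0 < z0 ->
  {ae P, forall w, regular_path phi n a (X ^~ w) (B ^~ w) s t} ->
  P.-negligible [set w | [/\ forall u, s <= u <= t -> stratum_nbhd r (X u w),
    z0 <= sqdist e x0 (X s w) &
    exists2 u, s <= u <= t & sqdist e x0 (X u w) = 0]].
Proof.
move=> s0 st z00 reg.
have [V [v1 [v2 [dV cv2 Vmono Vdiv Vw]]]] := lyapunov_exists w0 dw cw1 dG Gdiv.
have r20 : 0 < r / 2 by rewrite divr_gt0.
apply: (hitting_negligible (phi := phi) (V := V) (v1 := v1) (v2 := v2)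
  (U' := stratum_nbhd (r / 2)) (N := (r / 2)^-1) uF bB aX ee) => //.
- by move=> z /dV[].
- by move=> z /dV[].
- by move=> x /stratum_nbhdP[_ /ltW].
- move=> x Ux Dx z0'; have y0 : 0 < Num.sqrt (sqdist e x0 x) by rewrite sqrtr_gt0.
  have h := wdrift Ux Dx z0'; have [E1 E2] := Vw _ y0; move: h E1 E2.
  have -> : sqdist e x0 x = Num.sqrt (sqdist e x0 x) ^+ 2 by rewrite sqr_sqrtr// ltW.
  set y := Num.sqrt _ in y0 *; rewrite sqrtr_sqr gtr0_norm// => h -> ->.
  have wy := w0 y0; rewrite dotvNr.
  set Dd := dotv _ _ in h *.
  (* The generator of [V] factored by [- w y / y]; the other factor is nonnegative by [wdrift]. *)
  have -> : 2 * (- w y / y) * - Dd + (q%:R * (- w y / y) + - (w1 y - w y / y)) =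
      - (w y / y * (q%:R - 1 + y * w1 y / w y - 2 * Dd)).
    by field; rewrite !gt_eqF.
  by rewrite oppr_le0 mulr_ge0 ?subr_ge0// divr_ge0// ltW.
- by move=> x v Ux Dx; exact: (stratum_normal r20 Ux Dx).
- by move=> u; exact: stratum_nbhd_Fmeas.
- by move=> x; exact: stratum_nbhdS.
- by move=> x; exact: stratum_nbhd_near.
- exact: reg.
Qed.

End Negligible.
End Stratum.

(** * Weights *)

Section Weights.
Context {R : realType}.

Lemma is_derive_for_continuous (f : R -> R) (x df : R) : is_derive x 1 f df ->
  {for x, continuous f}.
Proof. by move=> [d _]; exact/differentiable_continuous/derivable1_diffP. Qed.

Lemma continuous_pos_measurable (f : R -> R) :
  (forall y : R, 0 < y -> {for y, continuous f}) ->
  measurable_fun (`]0, 1]%classic : set R) f.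
Proof.
move=> cf; apply: subspace_continuous_measurable_fun => //.
apply: continuous_in_subspaceT => y; rewrite inE/= in_itv/= => /andP[y0 _].
exact: cf.
Qed.

(** Without [C], [w] is the derivative of the scale function [p_i], so [w'/w] reproduces the drift
    of face [i]; [C] absorbs the other faces. The integral still diverges because
    [exp(C y) >= 1]. *)
Lemma face_weight (f : R -> R) (C : R) : 0 <= C ->
  (forall u : R, 0 < u -> derivable f u 1) ->
  (forall u : R, 0 < u -> {for u, continuous (derive1 f)}) ->
  (\int[lebesgue_measure]_(u in `]0%R, 1%R]) (expR (2 * (f u - f 1)))%:E = +oo)%E ->
  exists w w1 G : R -> R,
  [/\ forall y : R, 0 < y -> 0 < w y,
      forall y : R, 0 < y -> is_derive y 1 w (w1 y) /\ is_derive y 1 G (- w y),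
      forall y : R, 0 < y -> {for y, continuous w1},
      forall c : R, exists2 y : R, 0 < y & c <= G y &
      forall y : R, 0 < y -> y * w1 y / w y = y * (2 * derive1 f y + C)].
Proof.
move=> C0 df cdf div.
pose w y := expR (2 * (f y - f 1) + C * y).
pose w1 y := (2 * derive1 f y + C) * w y.
have idf (y : R) : 0 < y -> is_derive y 1 f (derive1 f y).
  by move=> y0; apply: DeriveDef; [exact: df|rewrite derive1E].
have dw (y : R) : 0 < y -> is_derive y 1 w (w1 y).
  move=> y0; have d1 := idf y y0.
  have d2 : is_derive y 1 (fun y => 2 * (f y - f 1) + C * y) (2 * derive1 f y + C).
    apply: is_derive_eq; rewrite /GRing.scale/=; ring.
  have d3 := @is_derive1_comp R expR (fun y => 2 * (f y - f 1) + C * y) y _ _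
    (is_derive_expR _) d2.
  by apply: is_derive_eq; rewrite /w1 /w mulrC.
have cw (y : R) : 0 < y -> {for y, continuous w}.
  by move=> y0; exact: is_derive_for_continuous (dw y y0).
have cf (y : R) : 0 < y -> {for y, continuous f}.
  by move=> y0; exact: is_derive_for_continuous (idf y y0).
exists w, w1, (tail_integral w); split.
- by move=> y _; exact: expR_gt0.
- by move=> y y0; split; [exact: dw|exact: is_derive_tail_integral].
- move=> y y0; apply: continuousM; last exact: cw.
  apply: continuousD; last exact: cst_continuous.
  by apply: continuousM; [exact: cst_continuous|exact: cdf].
- apply: tail_integral_diverges => //; first by move=> y _; exact: expR_ge0.
  apply/eqP; rewrite -leye_eq -div; apply: ge0_le_integral => //.
  + apply/measurable_EFinP; apply: continuous_pos_measurable => y y0.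
    apply: (@continuous_comp _ _ _ (fun y => 2 * (f y - f 1)) expR).
      apply: continuousM; first exact: cst_continuous.
      by apply: continuousB; [exact: cf|exact: cst_continuous].
    exact: continuous_expR.
  + by apply/measurable_EFinP; exact: continuous_pos_measurable.
  + move=> y; rewrite /= in_itv/= => /andP[y0 _].
    by rewrite lee_fin ler_expR lerDl mulr_ge0// ltW.
- by move=> y y0; rewrite /w1 mulrA mulfK// gt_eqF// expR_gt0.
Qed.

(** Up to [exp(C y)], the derivative of the logarithm, which is the scale function of the Bessel
    process of dimension 2. *)
Lemma edge_weight (C : R) : 0 <= C -> exists w w1 G : R -> R,
  [/\ forall y : R, 0 < y -> 0 < w y,
      forall y : R, 0 < y -> is_derive y 1 w (w1 y) /\ is_derive y 1 G (- w y),
      forall y : R, 0 < y -> {for y, continuous w1},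
      forall c : R, exists2 y : R, 0 < y & c <= G y &
      forall y : R, 0 < y -> y * w1 y / w y = C * y - 1].
Proof.
move=> C0; pose w (y : R) := expR (C * y) * y^-1.
pose w1 (y : R) := (C - y^-1) * w y.
have dw (y : R) : 0 < y -> is_derive y 1 w (w1 y).
  move=> y0; have d2 : is_derive y 1 (fun y : R => C * y) C.
    by apply: is_derive_eq; rewrite /GRing.scale/=; ring.
  have d3 := @is_derive1_comp R expR (fun y => C * y) y _ _ (is_derive_expR _) d2.
  have y1 : (id y : R) != 0 by rewrite gt_eqF.
  have d4 := @is_deriveV R id y 1 1 y1 (is_derive_id _ _).
  apply: is_derive_eq; rewrite /GRing.scale/= /w1 /w.
  by field; rewrite gt_eqF.
have cw (y : R) : 0 < y -> {for y, continuous w}.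
  by move=> y0; exact: is_derive_for_continuous (dw y y0).
have wp (y : R) : 0 < y -> 0 < w y.
  by move=> y0; rewrite mulr_gt0 ?invr_gt0// expR_gt0.
have dG (y : R) : 0 < y -> is_derive y 1 (tail_integral w) (- w y).
  exact: is_derive_tail_integral.
exists w, w1, (tail_integral w); split => //.
- by move=> y y0; split; [exact: dw|exact: dG].
- move=> y y0; apply: continuousM; last exact: cw.
  apply: continuousB; first exact: cst_continuous.
  by apply: continuousV; [rewrite gt_eqF|exact: cvg_id].
- move=> c; pose b := `|c - tail_integral w 1|; pose y := expR (- b).
  have y0 : 0 < y by exact: expR_gt0.
  have y1 : y <= 1 by rewrite expR_le1 oppr_le0 normr_ge0.
  exists y => //.
  (* [H] is nonincreasing on the segment, as [w z >= z^-1], so the tail integral grows at least like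
     [- ln]; this explains the witness [expR (- b)]. *)
  pose H z := tail_integral w z + ln z.
  have dH (z : R) : y <= z <= 1 -> is_derive z 1 H (- w z + z^-1).
    move=> /andP[yz _]; have z0 := lt_le_trans y0 yz.
    have d1 := dG z z0; have d2 := is_derive1_ln z0.
    by apply: is_derive_eq.
  have yI : y <= y <= 1 by apply/andP.
  have oI : y <= (1 : R) <= 1 by apply/andP.
  have [z [_ /andP[yz z1]] hz] := MVT_between dH yI oI.
  have z0 := lt_le_trans y0 yz.
  have : H 1 - H y <= 0.
    rewrite hz; apply: mulr_le0_ge0; last by rewrite subr_ge0.
    rewrite addrC subr_le0 /w ler_peMl//; first by rewrite invr_ge0 ltW.
    by rewrite (le_trans _ (expR_ge1Dx _))// lerDl mulr_ge0// ltW.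
  rewrite /H ln1 addr0 /y expRK; have := ler_norm (c - tail_integral w 1).
  by rewrite -/b; lra.
- move=> y y0; rewrite /w1 mulrA mulfK ?gt_eqF ?wp//.
  by field; rewrite gt_eqF.
Qed.

End Weights.

(** * Avoidance of the face *)

Section Solution.
Context {R : realType} {dO : measure_display} {Omega : measurableType dO}
  (P : probability Omega R) (F : R -> set (set Omega)) (d m : nat)
  (B : R -> Omega -> 'rV[R]_d) (phi : 'I_m -> R -> \bar R)
  (n : 'I_m -> 'rV[R]_d) (a : 'I_m -> R) (X : R -> Omega -> 'rV[R]_d)
  (L : R -> Omega -> R).
Hypothesis uF : usual_filtration P F.
Hypothesis bB : brownian P F B.
Hypothesis hphi : forall k, econvex (phi k) /\ elsc (phi k) /\
     (forall u, u < 0 -> phi k u = +oo%E) /\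
     (forall u, 0 < u -> phi k u \is a fin_num) /\
     (forall u, 0 < u -> derivable (fin_part (phi k)) u 1) /\
     (forall u, 0 < u -> {for u, continuous (derive1 (fin_part (phi k)))}).
Hypothesis n1 : forall k, dotv (n k) (n k) = 1.
Hypothesis n_inj : injective n.
Hypothesis D0 : exists x, Dopen n a x.
Hypothesis sol : msde_solution P F B phi n a X L.

Let dphi_mono k (x y : R) : 0 < x -> x <= y ->
  derive1 (fin_part (phi k)) x <= derive1 (fin_part (phi k)) y.
Proof.
have [ck [_ [_ [fk [dk _]]]]] := hphi k; exact: convex_derive1_mono.
Qed.

Lemma dotv_path_continuous (x : R -> 'rV[R]_d) (s t : R) :
  {in `[0, +oo[, continuous x} -> 0 <= s -> dotv_continuous x s t.
Proof.
move=> cx s0 v u /andP[su _].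
have cu : {for u, continuous x}.
  by apply: cx; rewrite in_itv/= andbT (le_trans s0).
apply: (@for_continuous_sum _ _ _ _ (fun j u => v ord0 j * x u ord0 j)) => j.
apply: continuousM; first exact: cst_continuous.
apply: (@continuous_comp _ _ _ x (fun y : 'rV[R]_d => y ord0 j)) => //.
exact: coord_continuous.
Qed.

Lemma solution_regular_path :
  {ae P, forall w, forall s t, 0 <= s -> regular_path phi n a (X ^~ w) (B ^~ w) s t}.
Proof.
have [aeB _] := bB; have [_ [_ aeX]] := sol.
apply: filterS2 aeB aeX => w [_ cB] [cX [_ [_ [xD [nv [hn hx]]]]]] s t s0; split.
- exact: dotv_path_continuous.
- exact: dotv_path_continuous.
- by move=> u /andP[su _]; apply: xD; exact: le_trans su.
- apply: (path_control_exists hn) => u u0 j.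
  by have [_ /(_ j)[h1 [h2 h3]]] := hx u u0.
Qed.

Lemma negligible_exists (T : countType) (A : T -> set Omega) :
  (forall x, P.-negligible (A x)) -> P.-negligible [set w | exists x, A x w].
Proof.
move=> nA; have nU : P.-negligible
    (\bigcup_k (if @unpickle T k is Some x then A x else set0)).
  apply: negligible_bigcup => k.
  by case: unpickle => [x|]; [exact: nA|exact: negligible_set0].
by apply: negligibleS nU => w [x Ax]; exists (pickle x) => //; rewrite pickleK.
Qed.

(** On such a path the increments of [n_i.B] are opposite to those of the bounded variation part.
    Their squares sum to at most the largest increment times the growth of [W], which tends to 0
    with the mesh. *)
Lemma flat_negligible i (s t : R) : 0 <= s -> s < t ->
  P.-negligible [set w | forall u, s <= u <= t -> dotv (X u w) (n i) = a i].
Proof.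
move=> s0 st.
have nreg : P.-negligible (~` [set w | forall s t, 0 <= s ->
  regular_path phi n a (X ^~ w) (B ^~ w) s t]) by exact: solution_regular_path.
apply: (brownian_infinite_variation uF bB s0 st (n1 i) nreg) => w flat reg.
have {}reg : regular_path phi n a (X ^~ w) (B ^~ w) s t.
  by apply: contrapT => h; apply: reg => /(_ s t s0).
have [_ lb _ [W pW]] := reg.
have ee (l l' : 'I_1) : dotv (n i) (n i) = (l == l')%:R by rewrite n1 !ord1.
have incr k nn : (k <= nn)%N ->
    `|dotv (n i) (B (grid s t nn k.+1) w - B (grid s t nn k) w)| <=
    W (grid s t nn k.+1) - W (grid s t nn k).
  move=> kn; have /andP[h1 h2] := grid_bounds st (leqW kn).
  have /andP[h3 h4] := grid_bounds st (kn : (k.+1 <= nn.+1)%N).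
  have := increment_le_control (e := fun _ : 'I_1 => n i) ee pW ord0
    (le_trans s0 h1) (ltW (grid_lt nn k st)).
  rewrite !dotvBr (dotvC _ (X _ w)) (dotvC _ (X (grid s t nn k) w)).
  rewrite !flat ?h1 ?h2 ?h3 ?h4// -normrN.
  by congr (`|_| <= _); ring.
have W0 : 0 <= W t - W s by rewrite subr_ge0; apply: pW.1 => //; exact: ltW.
have W1 : 0 < W t - W s + 1 by rewrite ltr_wpDl.
apply/cvgrPdist_lt => r r0.
have r10 : 0 < r / (W t - W s + 1) by rewrite divr_gt0.
have [r2 r20 hr2] := segment_unif_cont (lb (n i)) r10.
near=> nn.
have mesh : (t - s) / nn.+1%:R < r2 by near: nn; exact: grid_mesh.
rewrite sub0r normrN ger0_norm; last by apply: sumr_ge0 => k _; exact: sqr_ge0.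
have cr : r / (W t - W s + 1) * (W t - W s) < r.
  by rewrite mulrAC ltr_pdivrMr// ltr_pM2l// ltrDl.
apply: le_lt_trans cr; move: r10 hr2; set c := r / _ => r10 hr2.
have -> : W t - W s = \sum_(k < nn.+1) (W (grid s t nn k.+1) - W (grid s t nn k)).
  rewrite -(big_mkord xpredT (fun k => W (grid s t nn k.+1) - W (grid s t nn k))).
  by rewrite telescope_sumr// gridn grid0.
rewrite mulr_sumr; apply: ler_sum => k _; rewrite -real_normK ?num_real// expr2.
apply: ler_pM => //; last by apply: incr; rewrite -ltnS.
have kn : (k <= nn)%N by rewrite -ltnS.
apply: ltW; rewrite dotvBr distrC; apply: hr2; first exact: grid_bounds st (leqW kn).
by rewrite distrC gridS ger0_norm// divr_ge0// subr_ge0 ltW.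
Unshelve. all: by end_near. Qed.

(** In rank 1, two distinct unit normals are opposite. As [x0] lies on both hyperplanes, these
    coincide, and the strict inequalities at a point of [D] contradict each other. *)
Lemma edge_rank q (e : 'I_q -> 'rV[R]_d) (S : seq 'I_m) (x0 : 'rV[R]_d) i k :
  (forall k w, k \in S -> dotv (n k) w = \sum_l dotv (n k) (e l) * dotv (e l) w) ->
  (forall k, k \in S -> dotv x0 (n k) = a k) ->
  i \in S -> k \in S -> k != i -> 2 <= q%:R :> R.
Proof.
move=> ne x0S iS kS ki; rewrite ler_nat.
case: q e ne => [|[|q]]// e ne.
  by have := ne i (n i) iS; rewrite n1 big_ord0 => /eqP; rewrite oner_eq0.
exfalso.
have := ne i (n i) iS; have := ne k (n k) kS; have := ne k (n i) kS.
rewrite !n1 !big_ord1 !(dotvC (e ord0)).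
set al := dotv (n i) (e _); set be := dotv (n k) (e _) => ki1 be1 al1.
have ab1 : (be * al - 1) * (be * al + 1) = 0.
  have -> : (be * al - 1) * (be * al + 1) = (be * be) * (al * al) - 1 by ring.
  by rewrite -be1 -al1 mulr1 subrr.
move/eqP: ab1; rewrite mulf_eq0 subr_eq0 addr_eq0 => /orP[/eqP|/eqP] h.
  suff : n k = n i by move/n_inj/eqP; exact/negP.
  apply/eqP; rewrite -subr_eq0; apply/eqP/dotv_eq0.
  by rewrite !(dotvBl, dotvBr) !n1 (dotvC (n i)) ki1 h; ring.
have nki : n k = - n i.
  apply/eqP; rewrite -addr_eq0; apply/eqP/dotv_eq0.
  by rewrite !(dotvDl, dotvDr) !n1 (dotvC (n i)) ki1 h; ring.
have [z zD] := D0; have := zD i; have := zD k.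
by rewrite -(x0S k kS) -(x0S i iS) nki !dotvNr; lra.
Qed.

Context (i : 'I_m).
Hypothesis idiv : (\int[lebesgue_measure]_(u in `]0%R, 1%R])
  (expR (2 * (fin_part (phi i) u - fin_part (phi i) 1)))%:E = +oo)%E.

(* With a single active face ([q = 1]) the weight compensates the singular drift of
   that face; with several ([2 <= q]) monotonicity bounds the drift, and the dimension
   term [q%:R - 1] alone pays for a weight of order [y^-1]. *)
Lemma stratum_weight (S : {set 'I_m}) (x0 : 'rV[R]_d) : i \in S ->
  (forall k, k \in S -> dotv x0 (n k) = a k) ->
  exists q (e : 'I_q -> 'rV[R]_d),
  [/\ forall l l', dotv (e l) (e l') = (l == l')%:R,
      forall k w, k \in S ->
        dotv (n k) w = \sum_l dotv (n k) (e l) * dotv (e l) w,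
      forall w, (forall k, k \in S -> dotv (n k) w = 0) -> forall l, dotv (e l) w = 0 &
      forall r : R, 0 < r -> exists w w1 G : R -> R,
      [/\ forall y : R, 0 < y -> 0 < w y,
          forall y : R, 0 < y -> is_derive y 1 w (w1 y) /\ is_derive y 1 G (- w y),
          forall y : R, 0 < y -> {for y, continuous w1},
          forall c : R, exists2 y : R, 0 < y & c <= G y &
          forall x, stratum_nbhd n a e x0 S r x -> Dbar n a x ->
            0 < sqdist e x0 x ->
            2 * dotv (projto e x0 x) (gradPhi phi n a x) <=
            q%:R - 1 + Num.sqrt (sqdist e x0 x) * w1 (Num.sqrt (sqdist e x0 x)) /
              w (Num.sqrt (sqdist e x0 x))]].
Proof.
move=> iS x0S.
have gradE q (e : 'I_q -> 'rV[R]_d) x : dotv (projto e x0 x) (gradPhi phi n a x) =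
    \sum_k derive1 (fin_part (phi k)) (gap n a k x) * dotv (projto e x0 x) (n k).
  rewrite dotvC dotv_suml; apply: eq_bigr => k _.
  by rewrite dotvZl (dotvC (n k)).
have C0 (A : pred 'I_m) (r : R) : 0 <= 2 * \sum_(k | A k) drift_const phi r k.
  by rewrite mulr_ge0// sumr_ge0// => k _; rewrite /drift_const !addr_ge0.
have [Si|/existsP[k /andP[kS ki]]] : S = [set i]%SET \/ [exists k, (k \in S) && (k != i)].
  have [|h] := boolP [exists k, (k \in S) && (k != i)]; [by right|left].
  apply/setP => k; rewrite inE; apply/idP/eqP => [kS|->//].
  apply/eqP/negPn/negP => ki; move/negP: h; apply; apply/existsP; exists k.
  by rewrite kS.
- have ee (l l' : 'I_1) : dotv (n i) (n i) = (l == l')%:R by rewrite n1 !ord1.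
  have ne k w : k \in S -> dotv (n k) w = \sum_(l < 1) dotv (n k) (n i) * dotv (n i) w.
    by rewrite Si inE => /eqP ->; rewrite big_ord1 n1 mul1r.
  exists 1%N, (fun=> n i); split => //; first by move=> w h l; exact: h.
  move=> r r0; have [_ [_ [_ [_ [di ci]]]]] := hphi i.
  (* [C] is twice the sum of the bounds for the faces other than [i]; face [i] is matched exactly by
     the weight. *)
  have [w [w1 [G [w0 dw cw1 Gdiv wE]]]] :=
    face_weight (C0 (predC1 i) r) di ci idiv.
  exists w, w1, G; split => // x Ux Dx z0.
  have y0 : 0 < Num.sqrt (sqdist (fun _ : 'I_1 => n i) x0 x) by rewrite sqrtr_gt0.
  rewrite wE// subrr add0r gradE (bigD1 i)//= (projto_face ne x0S x iS).
  have gy : gap n a i x = Num.sqrt (sqdist (fun _ : 'I_1 => n i) x0 x).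
    rewrite /sqdist big_ord1 sqrtr_sqr /coord_to dotvBr (dotvC _ x0) x0S// dotvC.
    by rewrite ger0_norm// subr_ge0; exact: Dx.
  rewrite -gy [leRHS]mulrDr [leLHS]mulrDr lerD//.
    by rewrite le_eqVlt; apply/orP; left; apply/eqP; ring.
  rewrite mulrCA ler_pM2l// mulr_sumr ler_sum// => k ki.
  rewrite [leRHS]mulrC gy.
  exact: (drift_term_le (e := fun _ : 'I_1 => n i) dphi_mono n1 ee ne x0S k r0 Ux Dx).
- have [q [e [ee ne en]]] := orthonormal_basis n (enum S).
  have {}ne k' w : k' \in S -> dotv (n k') w = \sum_l dotv (n k') (e l) * dotv (e l) w.
    by move=> h; apply: ne; rewrite mem_enum.
  exists q, e; split => //.
    by move=> w h l; apply: en => k'; rewrite mem_enum; exact: h.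
  have q2 := @edge_rank q e (enum S) x0 i k.
  have {}q2 : 2 <= q%:R :> R.
    apply: q2; rewrite ?mem_enum// => k'; rewrite mem_enum; [exact: ne|exact: x0S].
  move=> r r0.
  have [w [w1 [G [w0 dw cw1 Gdiv wE]]]] := edge_weight (C0 predT r).
  exists w, w1, G; split => // x Ux Dx z0.
  have y0 : 0 < Num.sqrt (sqdist e x0 x) by rewrite sqrtr_gt0.
  rewrite wE// gradE.
  have h : \sum_k derive1 (fin_part (phi k)) (gap n a k x) * dotv (projto e x0 x) (n k)
      <= (\sum_k drift_const phi r k) * Num.sqrt (sqdist e x0 x).
    rewrite mulr_suml; apply: ler_sum => k' _.
    exact: (drift_term_le dphi_mono n1 ee ne x0S k' r0 Ux Dx).
  (* The right-hand side is [q - 1 + (C * y - 1)], at least [C * y] because [2 <= q]. *)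
  have := h; have := q2; rewrite -mulrA; lra.
Qed.

(** Hides the orthonormal family behind one function [rho], so that a single [rho] can be chosen for
    each [S]. *)
Lemma stratum_hitting (S : {set 'I_m}) (x0 : 'rV[R]_d) : i \in S ->
  (forall k, k \in S -> dotv x0 (n k) = a k) ->
  exists rho : 'rV[R]_d -> R,
  [/\ forall x, 0 <= rho x,
      forall x, (forall k, k \in S -> dotv x (n k) = a k) -> rho x = 0,
      forall x, rho x = 0 -> dotv x (n i) = a i,
      forall (x : R -> 'rV[R]_d) s t u, dotv_continuous x s t -> s <= u <= t ->
        {for u, continuous (fun u => rho (x u))} &
      forall r s t z0 : R, 0 < r -> r <= 1 -> 0 <= s -> s < t -> 0 < z0 ->
        P.-negligible [set w | [/\ forall u, s <= u <= t ->
            (forall k, k \notin S -> r < gap n a k (X u w) < r^-1) /\ rho (X u w) < r^-1,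
          z0 <= rho (X s w) & exists2 u, s <= u <= t & rho (X u w) = 0]]].
Proof.
move=> iS x0S; have [q [e [ee ne en hw]]] := stratum_weight iS x0S.
exists (sqdist e x0); split.
- by move=> x; apply: sumr_ge0 => l _; exact: sqr_ge0.
- move=> x xS; rewrite /sqdist big1// => l _; rewrite /coord_to en ?expr0n// => k kS.
  by rewrite dotvC dotvBl xS// x0S// subrr.
- move=> x /eqP; rewrite psumr_eq0; last by move=> l _; exact: sqr_ge0.
  move=> /allP h; apply/eqP; rewrite -subr_eq0 -(x0S i iS) -dotvBl dotvC (ne _ _ iS).
  rewrite big1// => l _; have /eqP := h l (mem_index_enum l).
  by rewrite /coord_to => /eqP; rewrite sqrf_eq0 => /eqP ->; rewrite mulr0.
- by move=> x s t u lx uI; exact: sqdist_continuous lx uI.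
- move=> r s t z0 r0 r1 s0 st z00.
  have r20 : 0 < r / 2 by rewrite divr_gt0.
  have [w [w1 [G [w0 dw cw1 Gdiv wd]]]] := hw _ r20.
  have [aX _] := sol.
  have reg : {ae P, forall w, regular_path phi n a (X ^~ w) (B ^~ w) s t}.
    by apply: filterS solution_regular_path => w'; exact.
  have := stratum_negligible n1 ee ne x0S uF bB aX w0
    (fun y y0 => (dw y y0).1) cw1 (fun y y0 => (dw y y0).2) Gdiv r0 r1 wd s0 st z00 reg.
  apply: negligibleS => w' [hU hz hu]; split => // u uI.
  by apply/stratum_nbhdP; exact: hU.
Qed.

(** The exceptional set has to be a countable union: it is indexed by [S], rational interval ends,
    and reciprocals of integers for [r] and [z0]. The reference point is fixed with [S],
    independently of the path; [rho S] vanishes at the hitting point nonetheless, as that point lies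
    on all hyperplanes of [S]. *)
Lemma face_not_hit :
  {ae P, forall w t, 0 < t -> dotv (X t w) (n i) <> a i}.
Proof.
pose feas (S : {set 'I_m}) := exists x0, forall k, k \in S -> dotv x0 (n k) = a k.
pose bad (rho : 'rV[R]_d -> R) (S : {set 'I_m}) (r s t z0 : R) := [set w |
  [/\ forall u, s <= u <= t ->
        (forall k, k \notin S -> r < gap n a k (X u w) < r^-1) /\ rho (X u w) < r^-1,
      z0 <= rho (X s w) & exists2 u, s <= u <= t & rho (X u w) = 0]].
have /choice[rho hrho] : forall S : {set 'I_m}, exists rho : 'rV[R]_d -> R,
    i \in S -> feas S ->
    [/\ forall x, 0 <= rho x,
      forall x, (forall k, k \in S -> dotv x (n k) = a k) -> rho x = 0,
      forall x, rho x = 0 -> dotv x (n i) = a i,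
      forall (x : R -> 'rV[R]_d) s t u, dotv_continuous x s t -> s <= u <= t ->
        {for u, continuous (fun u => rho (x u))} &
      forall r s t z0 : R, 0 < r -> r <= 1 -> 0 <= s -> s < t -> 0 < z0 ->
        P.-negligible (bad rho S r s t z0)].
  move=> S; have [[iS [x0 x0S]]|h] := pselect (i \in S /\ feas S); last first.
    by exists (fun=> 0) => iS fS; exfalso; apply: h.
  by have [rho h] := stratum_hitting iS x0S; exists rho.
pose rN (k : nat) : R := k.+1%:R^-1.
have rN0 k : 0 < rN k by rewrite invr_gt0.
have rN1 k : rN k <= 1 by rewrite invf_le1// ler1n.
have nbad : P.-negligible [set w | exists z : {set 'I_m} * (rat * rat) * (nat * nat),
    [/\ i \in z.1.1, feas z.1.1, 0 <= ratr z.1.2.1 :> R, ratr z.1.2.1 < ratr z.1.2.2 :> R &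
    bad (rho z.1.1) z.1.1 (rN z.2.1) (ratr z.1.2.1) (ratr z.1.2.2) (rN z.2.2) w]].
  apply: negligible_exists => -[[S [p q]] [k l]] /=.
  have [[iS fS p0 pq]|h] := pselect [/\ i \in S, feas S, 0 <= ratr p :> R & ratr p < ratr q :> R].
    have [_ _ _ _ h] := hrho S iS fS.
    by apply: negligibleS (h (rN k) (ratr p) (ratr q) (rN l) _ _ _ _ _) => // w [].
  by apply: negligibleS (@negligible_set0 _ _ _ P) => w [h1 h2 h3 h4 _]; apply: h.
have nflat : P.-negligible [set w | exists z : rat * rat,
    [/\ 0 <= ratr z.1 :> R, ratr z.1 < ratr z.2 :> R &
    forall u : R, ratr z.1 <= u <= ratr z.2 -> dotv (X u w) (n i) = a i]].
  apply: negligible_exists => -[p q] /=.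
  have [[p0 pq]|h] := pselect (0 <= ratr p :> R /\ ratr p < ratr q :> R).
    by apply: negligibleS (flat_negligible i p0 pq) => w [].
  by apply: negligibleS (@negligible_set0 _ _ _ P) => w [h1 h2 _]; apply: h.
have nreg := solution_regular_path.
apply: negligibleS (negligibleU nreg (negligibleU nbad nflat)).
move=> w /= H; apply: contrapT => Hw; apply: H => t t0 Xt.
have reg : forall s t, 0 <= s -> regular_path phi n a (X ^~ w) (B ^~ w) s t.
  by apply: contrapT => h; apply: Hw; left.
apply: Hw; right.
pose S := [set k | gap n a k (X t w) == 0]%SET.
have kS k : k \in S -> dotv (X t w) (n k) = a k.
  by rewrite inE /gap subr_eq0 => /eqP.
have iS : i \in S by rewrite inE /gap Xt subrr.
have fS : feas S by exists (X t w).
have [rho0 rhoS rhoi crho _] := hrho S iS fS.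
have lx s : 0 <= s -> dotv_continuous (X ^~ w) 0 s by move=> s0; have [] := reg 0 s (lexx _).
have cgap k u : 0 <= u -> {for u, continuous (fun u => gap n a k (X u w))}.
  move=> u0; rewrite (_ : (fun _ => _) = fun u => dotv (n k) (X u w) - a k); last first.
    by apply/funext => v; rewrite /gap dotvC.
  apply: continuousB; last exact: cst_continuous.
  by apply: (lx u u0); rewrite u0 lexx.
have crho' : {for t, continuous (fun u => rho S (X u w))}.
  by apply: (crho (X ^~ w) 0 t t (lx t (ltW t0))); rewrite ltW// lexx.
(* The gaps outside [S] are positive at time [t], so one [N] serves all of them; continuity then
   extends the bounds to a neighbourhood of [t]. *)
have : \forall N \near \oo, forall k, k \notin S ->
    rN N < gap n a k (X t w) < (rN N)^-1.
  apply: filter_forall => k.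
  have [kS'|kS'] := boolP (k \in S); first by apply: nearW.
  have g0 : 0 < gap n a k (X t w).
    have [_ _ Dx _] := reg 0 t (lexx _); have := Dx t _ k.
    rewrite lexx (ltW t0) => /(_ isT); move: kS'; rewrite inE /gap => h1 h2.
    by rewrite lt_neqAle eq_sym h1 subr_ge0.
  near=> N => _; apply/andP; split.
    by near: N; exact: (near_infty_natSinv_lt (PosNum g0)).
  rewrite /rN invrK; apply: (@lt_trans _ _ N%:R); last by rewrite ltr_nat.
  by near: N; exact: nbhs_infty_gtr.
move=> /filter_ex[N hN].
have FF : Filter (nbhs t) := nbhs_filter t.
have near0 (k : 'I_m) : \forall u \near t, k \notin S ->
    rN N < gap n a k (X u w) < (rN N)^-1.
  case: (boolP (k \in S)) => kS'.
    by apply: (@filterS _ _ FF setT) => //; exact: filterT.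
  have /andP[h1 h2] := hN k kS'.
  have h3 : \forall u \near t, rN N < gap n a k (X u w) :=
    @cvgr_gt _ _ _ FF _ _ (cgap k t (ltW t0)) _ h1.
  have h4 : \forall u \near t, gap n a k (X u w) < (rN N)^-1 :=
    @cvgr_lt _ _ _ FF _ _ (cgap k t (ltW t0)) _ h2.
  apply: (@filterS _ _ FF _ _ _ (@filterI _ _ FF _ _ h3 h4)) => u [h5 h6] _.
  by apply/andP.
have near1 := @filter_forall R 'I_m _ (nbhs t) FF near0.
have z0 : rho S (X t w) < (rN N)^-1 by rewrite (rhoS _ kS) invr_gt0.
have near2 : \forall u \near t, rho S (X u w) < (rN N)^-1 :=
    @cvgr_lt _ _ _ FF _ _ crho' _ z0.
have /nbhs_ballP[e /= e0 he] := @filterI _ _ FF _ _ near1 near2.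
have {}he u : t - e < u -> u < t + e ->
    (forall k, k \notin S -> rN N < gap n a k (X u w) < (rN N)^-1) /\
    rho S (X u w) < (rN N)^-1.
  by move=> h1 h2; apply: he; rewrite /ball/= ltr_distl; lra.
pose c := Num.max 0 (t - e).
have ct : c < t by rewrite gt_max t0/= ltrBlDr ltrDl.
have c0 : 0 <= c by rewrite le_max lexx.
have ce : t - e <= c by rewrite le_max lexx orbT.
have [[p /andP[cp pt] zp]|flat] :=
    pselect (exists2 p : rat, c < ratr p < t & 0 < rho S (X (ratr p) w)).
  left; have te : t < t + e by rewrite ltrDl.
  have [q] := rat_in_itvoo te; rewrite in_itv/= => /andP[tq qe].
  have [M hM] : exists M, rN M < rho S (X (ratr p) w).
    exact: (@filter_ex _ \oo _ _ (near_infty_natSinv_lt (PosNum zp))).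
  exists (S, (p, q), (N, M)); split => //=.
  - exact: le_trans c0 (ltW cp).
  - exact: lt_trans tq.
  - split; [move=> u /andP[pu uq]|exact: ltW|].
      by apply: he; [apply: le_lt_trans ce (lt_le_trans cp pu)|exact: le_lt_trans qe].
    by exists t; [rewrite (ltW pt) (ltW tq)|exact: rhoS].
right; have [p] := rat_in_itvoo ct; rewrite in_itv/= => /andP[cp pt].
have [q] := rat_in_itvoo pt; rewrite in_itv/= => /andP[pq qt].
exists (p, q); split => //=; first exact: le_trans c0 (ltW cp).
move=> u /andP[pu uq]; have u0 : 0 <= u by exact: le_trans c0 (le_trans (ltW cp) pu).
(* [rho S] is known to vanish only at rational times. By continuity, a nonzero gap at [u] would
   persist at a rational time close to [u]. *)
apply/eqP; rewrite -subr_eq0; apply/negPn/negP => gu.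
have FF' : Filter (nbhs u) := nbhs_filter u.
have /nbhs_ballP[e' /= e'0 he'] := @cvgr_neq0 _ _ _ _ FF' _ _ (cgap i u u0) gu.
have uI : u < Num.min t (u + e') by rewrite lt_min (le_lt_trans uq qt) ltrDl.
have [s] := rat_in_itvoo uI; rewrite in_itv/= lt_min => /and3P[us st se].
have us' : ball u e' (ratr s) by rewrite /ball/= ltr_distl; lra.
move/negP: (he' _ us'); apply.
rewrite /gap subr_eq0; apply/eqP/rhoi/eqP; rewrite eq_le rho0 andbT leNgt.
apply/negP => h; apply: flat; exists s => //.
by rewrite st andbT (lt_le_trans cp)// (le_trans pu)// ltW.
Unshelve. all: by end_near. Qed.
End Solution.

Theorem theorem6 (R : realType) (dO : measure_display) (Omega : measurableType dO)
  (P : probability Omega R) (F : R -> set (set Omega)) (d m : nat)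
  (B : R -> Omega -> 'rV[R]_d)
  (phi : 'I_m -> R -> \bar R) (n : 'I_m -> 'rV[R]_d) (a : 'I_m -> R)
  (X : R -> Omega -> 'rV[R]_d) (L : R -> Omega -> R) (i : 'I_m) :
  usual_filtration P F ->
  brownian P F B ->
  (forall k, econvex (phi k) /\ elsc (phi k) /\
     (forall u, u < 0 -> phi k u = +oo%E) /\
     (forall u, 0 < u -> phi k u \is a fin_num) /\
     (forall u, 0 < u -> derivable (fin_part (phi k)) u 1) /\
     (forall u, 0 < u -> {for u, continuous (derive1 (fin_part (phi k)))})) ->
  (forall k, dotv (n k) (n k) = 1) ->
  injective n ->
  (exists x, Dopen n a x) ->
  msde_solution P F B phi n a X L ->
  (* p_i(0) = -oo *)
  (\int[lebesgue_measure]_(u in `]0%R, 1%R])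
     (expR (2 * (fin_part (phi i) u - fin_part (phi i) 1)))%:E = +oo)%E ->
  {ae P, forall w, forall t, 0 < t -> ~ Hplane n a i (X t w)} /\
  {ae P, forall w, forall t, 0 < t -> ~ Kface n a i (X t w)}.
Proof.
move=> uF bB hphi n1 n_inj D0 sol idiv.
have notH := face_not_hit uF bB hphi n1 n_inj D0 sol idiv.
split; apply: filterS notH => w notH t t0; first exact: notH.
by move=> [Xt _]; exact: (notH t t0 Xt).
Qed.
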